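(* Let $\{(X_t,Y_t)\}_{t\in\mathbb{T}}$ be a centered Markov Additive Process with state space $\mathbb{X}\times\mathbb{R}^d$, $\mathbb{X}=\{1,\ldots,N\}$, $\mathbb{T}=\mathbb{N}$ or $\mathbb{T}=[0,\infty)$, satisfying conditions (I-A), (M3), (AC1) and (AC2) (all defined in the context). Assume moreover that the asymptotic covariance matrix $\Sigma$ (the covariance matrix of the Gaussian limit in distribution $\mathcal{N}(0,\Sigma)$ of $t^{-1/2}Y_t$ as $t\to+\infty$) is invertible. Then, for every $k\in\mathbb{X}$, the density $f_{k,t}(\cdot)$ of the absolutely continuous part of the probability distribution of $t^{-1/2}Y_t$ under $\mathbb{P}_k$ satisfies, as $t\to+\infty$, $$\sup_{y\in\mathbb{R}^d}\big|f_{k,t}(y)-\eta_{\Sigma}(y)\big|\ \le\ O\big(t^{-1/2}\big)+O\Big(\sup_{y\notin\mathcal{D}_t}\eta_{\Sigma}(t^{-1/2}y)\Big),$$ where $\eta_\Sigma(\cdot)$ denotes the density of $\mathcal{N}(0,\Sigma)$ and $\mathcal{D}_t$ is the open convex set of condition (AC2).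
   Context: Setting. $\mathbb{X}=\{1,\ldots,N\}$, $\mathbb{T}=\mathbb{N}$ or $[0,\infty)$; all time parameters below range over $\mathbb{T}$. A Markov Additive Process (MAP) $\{(X_t,Z_t)\}_{t\in\mathbb{T}}$ on $\mathbb{X}\times\mathbb{R}^d$ is a Markov process whose transition semigroup $\{Q_t\}_{t\in\mathbb{T}}$ satisfies $Q_t(k,y;\{\ell\}\times B)=Q_t(k,0;\{\ell\}\times(B-y))$ for all $k,\ell\in\mathbb{X}$, $y\in\mathbb{R}^d$, $B$ Borel. Then $\{X_t\}$ is a Markov process on $\mathbb{X}$, with transition semigroup $\{P_t\}_{t\in\mathbb{T}}$, assumed to have a unique invariant probability $\pi$. $\mathbb{P}_k,\mathbb{E}_k$ denote probability and expectation given $X_0=k$ (additive component started at $0$), and $\mathbb{E}_\pi=\sum_k\pi(k)\mathbb{E}_k$. The MAP $\{(X_t,Y_t)\}$ is centered: $Y_t=Z_t-tm$ for a MAP $\{(X_t,Z_t)\}$ with $m=\mathbb{E}_\pi[Z_1]$ (so $\mathbb{E}_\pi[Y_1]=0$). Norm: for a complex $N\times N$ matrix $A$, $\|A\|_0=\max_{k,\ell}|A_{k,\ell}|$; $\|\cdot\|$ is the Euclidean norm. Lebesgue decomposition: for $k,\ell\in\mathbb{X}$, the measure $B\mapsto\mathbb{P}_k\{X_t=\ell,\,Y_t\in B\}$ on $\mathbb{R}^d$ is written as $\int_B g_{k,\ell,t}(y)\,dy+\mu_{k,\ell,t}(B)$ with $g_{k,\ell,t}\ge0$ measurable and $\mu_{k,\ell,t}$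 a bounded positive measure singular with respect to Lebesgue measure. Put $G_t(y)=(g_{k,\ell,t}(y))_{k,\ell}$, $\mathcal{M}_t=(\mu_{k,\ell,t})_{k,\ell}$, $\mathcal{M}_t(1_{\mathbb{R}^d})=(\mu_{k,\ell,t}(\mathbb{R}^d))_{k,\ell}$, and $\widehat G_t(\zeta)=\big(\int_{\mathbb{R}^d}e^{i\langle\zeta,y\rangle}g_{k,\ell,t}(y)\,dy\big)_{k,\ell}$. The density $f_{k,t}$ is $f_{k,t}(y)=t^{d/2}g_{k,t}(t^{1/2}y)$ with $g_{k,t}=\sum_{\ell}g_{k,\ell,t}$, using the versions of $g_{k,\ell,t}$ given by (AC2). Conditions. (I-A): the stochastic matrix $P:=P_1$ is irreducible and aperiodic. (M$\alpha$): $M_\alpha:=\max_{k\in\mathbb{X}}\sup_{v\in(0,1]\cap\mathbb{T}}\mathbb{E}_k[\|Y_v\|^\alpha]<\infty$; (M3) is the case $\alpha=3$. (AC1): there exist $c>0$ and $\rho\in(0,1)$ such that $\|\mathcal{M}_t(1_{\mathbb{R}^d})\|_0\le c\rho^t$ for all $t>0$, and there exists $t_0>0$ such that $\rho^{t_0}\max(2,cN)\le1/4$ and $\Gamma_{t_0}(\zeta):=\sup_{w\in[t_0,2t_0)}\|\widehat G_w(\zeta)\|_0\to0$ as $\|\zeta\|\to+\infty$. (AC2): for any $t>0$ there is an open convex subset $\mathcal{D}_t$ of $\mathbb{R}^d$ such that $G_t$ vanishes on $\mathbb{R}^d\setminus\overline{\mathcal{D}}_t$, $G_t$ is continuous on $\overline{\mathcal{D}}_t$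 and differentiable on $\mathcal{D}_t$, and, with $\partial\mathcal{D}_t=\overline{\mathcal{D}}_t\setminus\mathcal{D}_t$: $\sup_{t>0}\sup_{y\in\overline{\mathcal{D}}_t}\|G_t(y)\|_0<\infty$; $\sup_{y\in\partial\mathcal{D}_t}\|G_t(y)\|_0=O(t^{-(d+1)/2})$; and $\sup_{t>0}\sup_{y\in\mathcal{D}_t}\|\frac{\partial G_t}{\partial y_j}(y)\|_0<\infty$ for $j=1,\ldots,d$. Asymptotic covariance: under (I-A) and $\mathrm{(M2)}$ it is known that $t^{-1/2}Y_t$ converges in distribution, as $t\to+\infty$, to a $d$-dimensional Gaussian law $\mathcal{N}(0,\Sigma)$; this defines $\Sigma$. Suprema of nonnegative quantities over the empty set are $0$. *)

(* Defs.v *)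
From HB Require Import structures.
From mathcomp Require Import all_boot all_order all_algebra.
From mathcomp Require Import all_classical all_reals all_analysis.
From mathcomp Require Import measurable_realfun.
From mathcomp.real_closed Require Import complex.

Set Implicit Arguments.
Unset Strict Implicit.
Unset Printing Implicit Defensive.

Import Order.TTheory GRing.Theory Num.Theory.
Import numFieldNormedType.Exports.

Local Open Scope classical_set_scope.
Local Open Scope ring_scope.

Section borel_matrix.
Context {R : realType} {m n : nat}.

Let borel0 : <<s @open 'M[R]_(m, n) >> set0.
Proof. exact: sigma_algebra0. Qed.

Let borelC A : <<s @open 'M[R]_(m, n) >> A -> <<s @open 'M[R]_(m, n) >> (~` A).
Proof. exact: sigma_algebraC. Qed.

Let borelU (F : (set 'M[R]_(m, n))^nat) :
  (forall i, <<s @open 'M[R]_(m, n) >> (F i)) ->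
  <<s @open 'M[R]_(m, n) >> (\bigcup_i F i).
Proof. exact: sigma_algebra_bigcup. Qed.

HB.instance Definition _ :=
  @isMeasurable.Build (sigma_display (@open 'M[R]_(m, n))) 'M[R]_(m, n)
    <<s @open 'M[R]_(m, n) >> borel0 borelC borelU.

End borel_matrix.

HB.instance Definition _ (n : nat) := isPointed.Build 'I_n.+1 ord0.

HB.instance Definition _ (n : nat) :=
  @isMeasurable.Build default_measure_display 'I_n.+1
    discrete_measurable discrete_measurable0
    discrete_measurableC discrete_measurableU.

Section measurable_matrix.
Context {R : realType} {m n : nat}.

Lemma open_measurable_mx (U : set 'M[R]_(m, n)) : open U -> measurable U.
Proof. by move=> oU; exact: sub_sigma_algebra. Qed.

Lemma measurable_fun_coord i j :
  measurable_fun setT (fun A : 'M[R]_(m, n) => A i j).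
Proof.
apply: (measurability _ (RGenOpens.measurableE R)).
move=> _ [_ [a [b ->]] <-]; rewrite setTI; apply: open_measurable_mx.
by apply: open_comp => // A _; exact: coord_continuous.
Qed.

Lemma open_mx_bigcup_ball (U : set 'M[R]_(m, n)) : open U ->
  U = \bigcup_(p in [set p : 'M[rat]_(m, n) * nat |
         ball (map_mx ratr p.1 : 'M[R]_(m, n)) p.2.+1%:R^-1 `<=` U])
       ball (map_mx ratr p.1 : 'M[R]_(m, n)) p.2.+1%:R^-1.
Proof.
move=> oU; apply/seteqP; split=> [A UA|A [p pU /pU]//].
have /nbhs_ballP[e /= e0 eU] : nbhs A U by exact: open_nbhs_nbhs.
have [k ke] : exists k, (k.+1%:R^-1 : R) < e / 2.
  have e20 : 0 < e / 2 by rewrite divr_gt0.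
  have [k _ /(_ k (leqnn k))] := near_infty_natSinv_lt (PosNum e20).
  by exists k.
have /choice[q qP] : forall ij : 'I_m * 'I_n,
    exists q : rat, `|A ij.1 ij.2 - ratr q| < k.+1%:R^-1.
  move=> ij; have k0 : A ij.1 ij.2 - k.+1%:R^-1 < A ij.1 ij.2 + k.+1%:R^-1.
    by rewrite ltrD2l gtrN.
  have [q] := rat_in_itvoo k0; rewrite in_itv/= => /andP[q1 q2].
  by exists q; rewrite distrC ltr_distl q1 q2.
pose Q := \matrix_(i, j) q (i, j).
have AQ : ball (map_mx ratr Q : 'M[R]_(m, n)) k.+1%:R^-1 A.
  split=> // i j; rewrite /ball/= !mxE distrC.
  exact: (qP (i, j)).
exists (Q, k) => //= B QB; apply: eU.
have := ball_triangle (ball_sym AQ) QB.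
by apply: le_ball; rewrite [leRHS]splitr; apply: lerD; exact: ltW.
Qed.

Lemma measurable_fun_mx d (T : measurableType d) (f : T -> 'M[R]_(m, n)) :
  (forall i j, measurable_fun setT (fun x => f x i j)) -> measurable_fun setT f.
Proof.
move=> mf; apply: (measurability (@open 'M[R]_(m, n))) => //.
move=> _ [U /open_mx_bigcup_ball -> <-]; rewrite setTI preimage_bigcup.
rewrite bigcup_mkcond; apply: countable_bigcupT_measurable => //= -[Q k].
case: ifPn => // _ /=.
rewrite (_ : _ @^-1` _ = \bigcap_(ij in [set: 'I_m * 'I_n])
    ((fun x => f x ij.1 ij.2) @^-1` ball (ratr (Q ij.1 ij.2) : R) k.+1%:R^-1)).
  apply: fin_bigcap_measurable => // -[i j] _ /=.
  rewrite -[X in measurable X]setTI; apply: mf => //.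
  exact: measurable_ball.
apply/seteqP; split => [x [_ xQ] [i j] _ /=|x xQ].
  by have := xQ i j; rewrite !mxE.
by split=> // i j; rewrite !mxE; exact: (xQ (i, j)).
Qed.

End measurable_matrix.

(* [lebesgue_rV d] is the d-fold product of the Lebesgue measure on R; the lemma
   [lebesgue_rV_box] computes it on boxes. *)

Section lebesgue_rV_succ.
Context {R : realType} {d : nat} (nu : {sigma_finite_measure set 'rV[R]_d -> \bar R}).

Definition rV_cons (p : measurableTypeR R * 'rV[R]_d) : 'rV[R]_d.+1 :=
  \row_j (if unlift ord0 j is Some i then p.2 0 i else p.1).

Lemma measurable_rV_cons : measurable_fun setT rV_cons.
Proof.
apply: measurable_fun_mx => i j; under eq_fun do rewrite mxE.
case: unliftP => [k|] _; last exact: measurable_fst.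
exact: (measurableT_comp (measurable_fun_coord 0 k) measurable_snd).
Qed.

Definition lebesgue_rV_succ : set 'rV[R]_d.+1 -> \bar R :=
  pushforward (@lebesgue_measure R \x nu)%E rV_cons.

Let succ0 : lebesgue_rV_succ set0 = 0%E.
Proof. by rewrite /lebesgue_rV_succ /pushforward preimage_set0 measure0. Qed.

Let succ_ge0 A : (0 <= lebesgue_rV_succ A)%E.
Proof. by rewrite /lebesgue_rV_succ /pushforward; exact: measure_ge0. Qed.

Let succ_semi_sigma_additive : semi_sigma_additive lebesgue_rV_succ.
Proof.
move=> F mF tF mUF; rewrite /lebesgue_rV_succ /pushforward preimage_bigcup.
have mpre A : measurable A -> measurable (rV_cons @^-1` A).
  by move=> mA; rewrite -[X in measurable X]setTI; exact: measurable_rV_cons.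
apply: measure_semi_sigma_additive.
- by move=> k; exact: mpre.
- apply/trivIsetP => /= i j _ _ ij; rewrite -preimage_setI.
  by move/trivIsetP : tF => /(_ _ _ _ _ ij) ->//; rewrite preimage_set0.
- by rewrite -preimage_bigcup; exact: mpre.
Qed.

HB.instance Definition _ := isMeasure.Build _ _ _
  lebesgue_rV_succ succ0 succ_ge0 succ_semi_sigma_additive.

Let measurable_uncons :
  measurable_fun setT (fun v : 'rV[R]_d.+1 =>
    (v 0 0, \row_j v 0 (lift ord0 j)) : measurableTypeR R * 'rV[R]_d).
Proof.
apply/measurable_fun_pairP; split; first exact: measurable_fun_coord.
apply: measurable_fun_mx => i j /=.
by under eq_fun do rewrite mxE; exact: measurable_fun_coord.
Qed.

Let rV_consK p : (rV_cons p 0 0, \row_j rV_cons p 0 (lift ord0 j)) = p.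
Proof.
case: p => x v; congr pair; first by rewrite mxE unlift_none.
by apply/rowP => j; rewrite !mxE liftK.
Qed.

Let succ_sigma_finite : sigma_finite setT lebesgue_rV_succ.
Proof.
have [F UF mF] : sigma_finite setT (@lebesgue_measure R \x nu)%E.
  have /sigma_finiteP[F [TF ndF Foo]] := sigma_finiteT (@lebesgue_measure R).
  have /sigma_finiteP[G [TG ndG Goo]] := sigma_finiteT nu.
  exists (fun n => F n `*` G n).
    rewrite -setXTT TF TG predeqE => -[x y]; split.
      move=> [/= [n _ Fnx] [k _ Gky]]; exists (maxn n k) => //; split.
      - by move: x Fnx; exact/subsetPset/ndF/leq_maxl.
      - by move: y Gky; exact/subsetPset/ndG/leq_maxr.
    by move=> [n _ []/= ? ?]; split; exists n.
  move=> k; have [? ?] := Foo k; have [? ?] := Goo k.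
  split; first exact: measurableX.
  by rewrite product_measure1E// lte_mul_pinfty// ge0_fin_numE.
exists (fun n => (fun v : 'rV[R]_d.+1 =>
    (v 0 0, \row_j v 0 (lift ord0 j)) : measurableTypeR R * 'rV[R]_d) @^-1` F n).
  by rewrite -preimage_bigcup -UF preimage_setT.
move=> n; have [mFn Fnoo] := mF n; split.
  by rewrite -[X in measurable X]setTI; exact: measurable_uncons.
rewrite /lebesgue_rV_succ /pushforward (_ : _ @^-1` _ = F n)//.
by apply/seteqP; split=> p /=; rewrite rV_consK.
Qed.

HB.instance Definition _ :=
  Measure_isSigmaFinite.Build _ _ _ lebesgue_rV_succ succ_sigma_finite.

End lebesgue_rV_succ.

Fixpoint lebesgue_rV {R : realType} (d : nat) :
    {sigma_finite_measure set 'rV[R]_d -> \bar R} :=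
  if d is d'.+1 then lebesgue_rV_succ (@lebesgue_rV R d') else \d_(0 : 'rV[R]_0).

Lemma lebesgue_rV_box {R : realType} d (a b : 'rV[R]_d) :
  (forall j, a 0 j <= b 0 j) ->
  lebesgue_rV d [set v | forall j, a 0 j <= v 0 j <= b 0 j]
    = (\prod_j (b 0 j - a 0 j))%:E.
Proof.
elim: d a b => [|d IHd] a b ab.
  by rewrite /= diracE mem_set ?big_ord0// => -[].
rewrite /= /lebesgue_rV_succ /pushforward.
rewrite (_ : _ @^-1` _ = `[a 0 0, b 0 0]%classic `*`
    [set v : 'rV[R]_d | forall j, (\row_j a 0 (lift ord0 j)) 0 j <= v 0 j <=
                                  (\row_j b 0 (lift ord0 j)) 0 j]); last first.
  apply/seteqP; split => -[x v] /= => [xv|[xab vab] j].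
    split; first by have := xv 0; rewrite mxE unlift_none in_itv.
    by move=> j; have := xv (lift ord0 j); rewrite !mxE liftK.
  rewrite mxE; case: unliftP => [k ->|->]; last by move: xab; rewrite in_itv.
  by have := vab k; rewrite !mxE.
rewrite product_measure1E//=; last first.
  rewrite (_ : mkset _ = \bigcap_(j in [set: 'I_d]) ((fun v : 'rV[R]_d => v 0 j) @^-1`
     `[(\row_j a 0 (lift ord0 j)) 0 j, (\row_j b 0 (lift ord0 j)) 0 j])).
    apply: fin_bigcap_measurable => // j _.
    by rewrite -[X in measurable X]setTI; exact: measurable_fun_coord.
  apply/seteqP; split => [v vab j _ /=|v vab j].
    by rewrite in_itv/=; exact: vab.
  by have := vab j I; rewrite /= in_itv.
rewrite IHd; last by move=> j; rewrite !mxE.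
rewrite lebesgue_measure_itv/= lte_fin big_ord_recl EFinM.
under eq_bigr do rewrite !mxE.
case: ltgtP (ab 0) => // ->; by rewrite subrr.
Qed.

Section linear_algebra.
Context {R : realType}.
Local Open Scope complex_scope.

Definition dot d (u v : 'rV[R]_d) : R := \sum_j u 0 j * v 0 j.

(* The library norm [`|v|] on ['rV_d] is the sup norm, hence this definition. *)
Definition euclidean_norm d (v : 'rV[R]_d) : R := Num.sqrt (dot v v).

Definition norm0 n (A : 'M[R[i]]_n) : R :=
  \big[Num.max/0]_k \big[Num.max/0]_l ComplexField.Normc.normc (A k l).

Definition complex_mx n (A : 'M[R]_n) : 'M[R[i]]_n :=
  map_mx (fun x : R => x%:C) A.

Definition expi (theta : R) : R[i] := cos theta +i* sin theta.

Definition complex_integral disp (T : measurableType disp)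
    (mu : {measure set T -> \bar R}) (f : T -> R[i]) : R[i] :=
  (\int[mu]_y complex.Re (f y)) +i* (\int[mu]_y complex.Im (f y)).

End linear_algebra.

Section gaussian.
Context {R : realType} {d : nat}.
Local Open Scope complex_scope.

Definition quadratic_form (A : 'M[R]_d) (v : 'rV[R]_d) : R := (v *m A *m v^T) 0 0.

(* The law N(0, Sigma), possibly degenerate, through its characteristic
   function. *)
Definition gaussian_law (Sigma : 'M[R]_d) (nu : probability 'rV[R]_d R) : Prop :=
  [/\ Sigma^T = Sigma,
      forall v, 0 <= quadratic_form Sigma v &
      forall zeta, complex_integral nu (fun y => expi (dot zeta y))
                   = (expR (- (quadratic_form Sigma zeta / 2)))%:C].

Definition gaussian_density (Sigma : 'M[R]_d) (y : 'rV[R]_d) : R :=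
  (Num.sqrt ((2 * pi) ^+ d * \det Sigma))^-1 *
  expR (- (quadratic_form (invmx Sigma) y / 2)).

End gaussian.

Variant time_kind := DiscreteTime | ContinuousTime.

Section time.
Context {R : realType}.

(* Families indexed by time are functions on R of which only the values on
   [time_set tk] matter. *)
Definition time_set (tk : time_kind) : set R :=
  match tk with
  | DiscreteTime => range (fun n : nat => n%:R)
  | ContinuousTime => [set t | 0 <= t]
  end.

Definition time_infty (tk : time_kind) : set_system R :=
  within (time_set tk) (pinfty_nbhs R).

Global Instance time_infty_filter tk : ProperFilter (time_infty tk).
Proof.
apply: Build_ProperFilter_ex => A [M [_ MA]].
have [n Mn] : exists n : nat, M < n%:R.
  by exists (Num.truncn M).+1; exact: truncnS_gt.
exists n%:R; apply: MA => //; case: tk => /=; first by exists n.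
exact: ler0n.
Qed.

Canonical time_infty_filter_on tk :=
  FilterType (time_infty tk) (time_infty_filter tk).

End time.

Arguments time_set R tk : clear implicits.
Arguments time_infty R tk : clear implicits.

Definition cvg_in_law {R : realType} {d disp} {Omega : measurableType disp}
    (F : set_system R) (P : probability Omega R) (V : R -> Omega -> 'rV[R]_d)
    (nu : probability 'rV[R]_d R) : Prop :=
  forall h : 'rV[R]_d -> R, continuous h -> (exists M : R, forall y, `|h y| <= M) ->
    ('E_P[h \o V t] @[t --> F] --> 'E_nu[h])%E.

Section MAP.
Context {R : realType} (tk : time_kind) {n d : nat}.

(* The finite space X is ['I_n.+1], so that N = n.+1. *)
Local Notation X := 'I_n.+1.
Local Notation XRd := ('I_n.+1 * 'rV[R]_d)%type.
Local Notation T := (time_set R tk).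
Local Notation infty := (time_infty R tk).

Definition transition_semigroup (Q : R -> R.-pker XRd ~> XRd) : Prop :=
  (forall x C, measurable C -> Q 0 x C = \d_x C) /\
  (forall s t x C, T s -> T t -> measurable C ->
     Q (s + t) x C = (\int[Q s x]_z Q t z C)%E).

Definition additive_semigroup (Q : R -> R.-pker XRd ~> XRd) : Prop :=
  forall t k l y (B : set 'rV[R]_d), T t -> measurable B ->
    Q t (k, y) ([set l] `*` B) = Q t (k, 0) ([set l] `*` [set z - y | z in B]).

Section process.
Context {disp : measure_display} {Omega : measurableType disp}.
Variables (P : X -> probability Omega R) (Xt : R -> Omega -> X)
  (Zt : R -> Omega -> 'rV[R]_d) (Q : R -> R.-pker XRd ~> XRd).

Definition history (s : R) : set (set Omega) :=
  <<s [set A | exists u (C : set XRd), [/\ T u, u <= s, measurable C &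
         A = [set w | C (Xt u w, Zt u w)]]] >>.

(* Markov property, for each initial law [P k], with respect to the natural
   filtration: Q_t((X_s, Z_s); C) is a version of the conditional probability
   of (X_{s+t}, Z_{s+t}) \in C given the past up to time s. *)
Definition markov_property : Prop :=
  forall k s t A C, T s -> T t -> history s A -> measurable C ->
    P k (A `&` [set w | C (Xt (s + t) w, Zt (s + t) w)])
    = (\int[P k]_(w in A) Q t (Xt s w, Zt s w) C)%E.

Record markov_additive_process : Prop := {
  MAP_measurable : forall t, T t ->
    measurable_fun setT (fun w => (Xt t w, Zt t w) : XRd) ;
  MAP_start : forall k, P k [set w | Xt 0 w = k /\ Zt 0 w = 0] = 1%E ;
  MAP_semigroup : transition_semigroup Q ;
  MAP_additive : additive_semigroup Q ;
  MAP_markov : markov_property }.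

End process.

Definition transition_matrix (Q : R -> R.-pker XRd ~> XRd) (t : R) : 'M[R]_n.+1 :=
  \matrix_(k, l) fine (Q t (k, 0) ([set l] `*` setT)).

Definition invariant_probability (Pt : R -> 'M[R]_n.+1) (p : 'rV[R]_n.+1) : Prop :=
  [/\ forall k, 0 <= p 0 k, \sum_k p 0 k = 1 &
      forall t, T t -> p *m Pt t = p].

Definition unique_invariant_probability (Pt : R -> 'M[R]_n.+1)
    (p : 'rV[R]_n.+1) : Prop :=
  invariant_probability Pt p /\
  forall q, invariant_probability Pt q -> q = p.

Definition irreducible_mx (A : 'M[R]_n.+1) : Prop :=
  forall k l, exists m : nat, 0 < (A ^+ m) k l.

Definition aperiodic_mx (A : 'M[R]_n.+1) : Prop :=
  forall k (p : nat),
    (forall m : nat, (0 < m)%N -> 0 < (A ^+ m) k k -> (p %| m)%N) -> p = 1%N.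

Definition condition_IA (Q : R -> R.-pker XRd ~> XRd) : Prop :=
  irreducible_mx (transition_matrix Q 1) /\ aperiodic_mx (transition_matrix Q 1).

Section centering.
Context {disp : measure_display} {Omega : measurableType disp}.
Variable P : X -> probability Omega R.

Definition stationary_mean (p : 'rV[R]_n.+1) (Zt : R -> Omega -> 'rV[R]_d) :
    'rV[R]_d :=
  \row_j \sum_k p 0 k * fine ('E_(P k)[fun w => (Zt 1 w 0 j)%R])%E.

Definition centered (p : 'rV[R]_n.+1) (Zt : R -> Omega -> 'rV[R]_d)
    (t : R) (w : Omega) : 'rV[R]_d :=
  Zt t w - t *: stationary_mean p Zt.

Variable Yt : R -> Omega -> 'rV[R]_d.

Definition moment_bound (alpha : R) : \bar R :=
  (\big[maxe/0]_k ereal_sup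
    [set 'E_(P k)[fun w => (euclidean_norm (Yt v w) `^ alpha)%R] |
       v in [set v | 0 < v <= 1]%R `&` T])%E.

Definition condition_M (alpha : R) : Prop := (moment_bound alpha < +oo)%E.

Definition asymptotic_covariance (Sigma : 'M[R]_d) : Prop :=
  exists2 nu : probability 'rV[R]_d R, gaussian_law Sigma nu &
    forall k, cvg_in_law (time_infty R tk) (P k)
                (fun t w => t `^ (- 2^-1) *: Yt t w) nu.

End centering.

Section decomposition.
Variables (G : R -> 'rV[R]_d -> 'M[R]_n.+1)
  (mu : R -> X -> X -> {finite_measure set 'rV[R]_d -> \bar R}).

Definition singular_to_lebesgue (nu : {measure set 'rV[R]_d -> \bar R}) : Prop :=
  exists S : set 'rV[R]_d,
    [/\ measurable S, lebesgue_rV d S = 0%E & nu (~` S) = 0%E].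

Definition lebesgue_decomposition disp (Omega : measurableType disp)
    (P : X -> probability Omega R) (Xt : R -> Omega -> X)
    (Yt : R -> Omega -> 'rV[R]_d) : Prop :=
  forall t k l, T t ->
    [/\ measurable_fun setT (fun y => G t y k l),
        forall y, 0 <= G t y k l,
        singular_to_lebesgue (mu t k l) &
        forall B : set 'rV[R]_d, measurable B ->
          P k [set w | Xt t w = l /\ B (Yt t w)] =
          (\int[lebesgue_rV d]_(y in B) (G t y k l)%:E + mu t k l B)%E].

Definition singular_mass (t : R) : 'M[R]_n.+1 :=
  \matrix_(k, l) fine (mu t k l setT).

Definition fourier (t : R) (zeta : 'rV[R]_d) : 'M[R[i]]_n.+1 :=
  \matrix_(k, l) complex_integral (lebesgue_rV d)
    (fun y => expi (dot zeta y) * ((G t y k l)%:C)%C).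

Definition Gamma (t0 : R) (zeta : 'rV[R]_d) : \bar R :=
  ereal_sup [set (norm0 (fourier w zeta))%:E |
               w in [set w | t0 <= w < 2 * t0] `&` T].

Definition condition_AC1 : Prop :=
  exists c rho : R, [/\ 0 < c, 0 < rho < 1,
    forall t, T t -> 0 < t -> norm0 (complex_mx (singular_mass t)) <= c * rho `^ t &
    exists t0 : R, [/\ T t0, 0 < t0,
      rho `^ t0 * Num.max 2 (c * n.+1%:R) <= 4^-1 &
      forall e : R, 0 < e -> exists A : R, forall zeta : 'rV[R]_d,
        A < euclidean_norm zeta -> (Gamma t0 zeta <= e%:E)%E]].

Variable D : R -> set 'rV[R]_d.

(* In the second bound the supremum is that of a set of reals which is bounded
   by the first bound; [sup set0 = 0]. *)
Definition condition_AC2 : Prop :=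
  (forall t, T t -> 0 < t ->
    [/\ open (D t), convex_set (D t),
        forall y : 'rV[R]_d, (~` closure (D t)) y -> G t y = 0,
        {within closure (D t), continuous (G t)} &
        forall y : 'rV[R]_d, D t y -> differentiable (G t) y]) /\
  [/\ exists C : R, forall (t : R) (y : 'rV[R]_d),
        T t -> 0 < t -> closure (D t) y -> norm0 (complex_mx (G t y)) <= C,
      (fun t => sup [set norm0 (complex_mx (G t y)) | y in closure (D t) `\` D t])
        =O_infty (fun t => t `^ (- (d.+1%:R / 2))) &
      forall j : 'I_d, exists C : R, forall (t : R) (y : 'rV[R]_d),
        T t -> 0 < t -> D t y -> norm0 (complex_mx ('D_(delta_mx 0 j) (G t) y)) <= C].

(* Change of variables: if Y_t has density g (summed over the arrival states),
   then t^{-1/2} Y_t has density y |-> t^{d/2} g (t^{1/2} y). *)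
Definition scaled_density (k : X) (t : R) (y : 'rV[R]_d) : R :=
  t `^ (d%:R / 2) * \sum_l G t (t `^ (2^-1) *: y) k l.

End decomposition.

End MAP.

(* Main.v *)
(* Let Phi_t(zeta) be the matrix of the E_k[e^(i<zeta, Y_t>); X_t = l]; these
   matrices form a semigroup in t. Solving two Poisson equations for P_1 yields
   an approximate eigenvector of Phi_1(zeta), with eigenvalue 1 - q(zeta) up to
   O(|zeta|^3), where q(zeta) is homogeneous of degree 2. Telescoping gives, near 0,
   Phi_t(zeta) 1 = e^(-t q(zeta)) + O((|zeta| + t |zeta|^3) e^(-c t |zeta|^2)),
   and the central limit theorem identifies q with the quadratic form of
   Sigma / 2. Away from 0, (AC1) makes Phi_t small at high frequencies, and the
   doubling inequality 1 - |phi(2 zeta)| <= 4 (1 - |phi(zeta)|) transports this to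
   |Phi_t(zeta)| <= C e^(-c t min(1, |zeta|^2)).
   Fourier inversion of the law of Y_t smoothed by a Gaussian kernel of
   polynomially small variance then compares it with the density of
   N(0, t Sigma); the singular part is exponentially small. By (AC2) the density
   of Y_t is Lipschitz on the closure of D_t, which removes the smoothing at the
   points whose distance to the complement of D_t is at least delta_t. Any other
   point of the closure is within delta_t of a boundary point, where the density
   of Y_t is O(t^(-(d+1)/2)), and within delta_t of a point outside D_t, where the
   Gaussian density is bounded by the second error term. *)
Require Import Defs.
From mathcomp Require Import all_boot all_order all_algebra.
From mathcomp Require Import all_classical all_reals all_analysis.
From mathcomp Require Import measurable_realfun.
From mathcomp Require Import ring lra.
From mathcomp.real_closed Require Import complex.

Set Implicit Arguments.
Unset Strict Implicit.
Unset Printing Implicit Defensive.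

Import Order.TTheory GRing.Theory Num.Theory.
Import numFieldNormedType.Exports.

Local Open Scope classical_set_scope.
Local Open Scope ring_scope.

(** * Gaussian integrals *)

(** The characteristic function of Y_t is not known to be integrable, so inversion requires a
    kernel. Since frequencies above 1 are damped by e^(-ct), a kernel of variance t^(-2(d+1)) costs
    only a power of t there, and its spread stays far below the boundary layer. That layer has width
    t^(-(d+1)/2) because densities are finally rescaled by t^(d/2): a Lipschitz error over the layer
    then becomes t^(-1/2). Instead of perturbing the leading eigenvalue, an approximate eigenvector
    is built by linear algebra over the fixed matrix P_1; three moments suffice for it. The global
    bound on Phi_t is proved without any expansion. Its limit at the frequencies zeta / sqrt t gives
    q(zeta) >= c |zeta|^2, which makes Sigma positive definite and puts the Gaussian factor into the
    expansion near 0. Complex estimates are reduced to real ones: |z| is the maximum of p Re z + q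
    Im z over unit vectors (p, q), and K + p cos + q sin is nonnegative when K >= |p| + |q|, so that
    identities between integrals are proved for nonnegative functions first. *)

Section integral_tools.
Context {R : realType} {disp : measure_display} {T : measurableType disp}
  (mu : {measure set T -> \bar R}).

Lemma integrable_dominated (f g : T -> R) : measurable_fun setT f ->
  (forall x, `|f x| <= g x) ->
  mu.-integrable setT (EFin \o g) -> mu.-integrable setT (EFin \o f).
Proof.
move=> mf fg; apply: le_integrable => //; first exact/measurable_EFinP.
by move=> x _ /=; rewrite lee_fin (le_trans (fg x))// ler_norm.
Qed.

Lemma integrableZ (k : R) (f : T -> R) :
  mu.-integrable setT (EFin \o f) -> mu.-integrable setT (fun x => (k * f x)%:E).
Proof. by move=> fi; apply: (@integrableZl _ _ _ mu _ _ k (EFin \o f)). Qed.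

End integral_tools.

Section gauss_1d.
Context {R : realType}.
Local Notation leb := (@lebesgue_measure R).
Implicit Types a c x u th : R.

(** The unnormalized Gaussian of precision [a] centred at [- c]. The shift [c] receives the linear
    term left when the square is completed in one coordinate. *)
Definition bell a c u : R := expR (- (a * (u + c) ^+ 2 / 2)).

Lemma bell_ge0 a c u : 0 <= bell a c u. Proof. exact: expR_ge0. Qed.

Lemma continuous_bell a c : continuous (bell a c).
Proof.
move=> u; apply: continuous_comp; last exact: continuous_expR.
apply: cvgN; apply: cvgMl; apply: cvgMr.
by apply: cvgM; apply: cvgD => //; exact: cvg_cst.
Qed.

Lemma measurable_bell a c : measurable_fun setT (bell a c).
Proof. by apply: continuous_measurable_fun; exact: continuous_bell. Qed.

Lemma bell_normal_fun a c : 0 < a ->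
  bell a c = normal_fun (- c) (Num.sqrt a)^-1.
Proof.
move=> a0; apply/funext => u; rewrite /bell /normal_fun opprK exprVn sqr_sqrtr ?ltW//.
congr expR; field; lra.
Qed.

Lemma integral_bell a c : 0 < a ->
  (\int[leb]_u (bell a c u)%:E = (Num.sqrt (2 * pi / a))%:E)%E.
Proof.
move=> a0; have s0 : (Num.sqrt a)^-1 != 0 by rewrite gt_eqF// invr_gt0 sqrtr_gt0.
have pk := normal_peak_gt0 s0.
have := integral_normal_pdf (- c) (Num.sqrt a)^-1.
rewrite normal_pdfE// -bell_normal_fun//.
under eq_integral do rewrite EFinM.
rewrite ge0_integralZl//=; last 3 first.
- by apply/measurable_EFinP; exact: measurable_bell.
- by move=> u _; rewrite lee_fin bell_ge0.
- by rewrite lee_fin ltW.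
have -> : (normal_peak (Num.sqrt a)^-1) = (Num.sqrt (2 * pi / a))^-1.
  rewrite /normal_peak exprVn sqr_sqrtr ?ltW//; congr (Num.sqrt _)^-1.
  by rewrite -mulr_natr; field; lra.
set I := (\int[_]_(x in _) _)%E => /(congr1 (fun e => (Num.sqrt (2 * pi / a))%:E * e)%E).
rewrite muleA -EFinM divff ?mul1e ?mule1//.
by rewrite gt_eqF// sqrtr_gt0 divr_gt0// mulr_gt0// pi_gt0.
Qed.

Lemma integrable_bell a c : 0 < a -> leb.-integrable setT (EFin \o bell a c).
Proof.
move=> a0; apply/integrableP; split.
  by apply/measurable_EFinP; exact: measurable_bell.
under eq_integral do rewrite /= ger0_norm ?bell_ge0//.
by rewrite integral_bell// ltry.
Qed.

(** Half of the exponent absorbs the factor [v = u + c]: |v| <= 1 + v^2 / 4 <= (1 + 1/a)(1 + a v^2 /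
    4), and the last factor is at most e^(a v^2 / 4). *)
Lemma normM_bell_le a c u : 0 < a ->
  `|u + c| * bell a c u <= (1 + a^-1) * bell (a / 2) c u.
Proof.
move=> a0; set v := u + c.
have -> : bell a c u = bell (a / 2) c u * bell (a / 2) c u.
  by rewrite /bell -expRD; congr expR; field.
rewrite mulrA ler_wpM2r ?bell_ge0//.
have := expR_ge1Dx (a * v ^+ 2 / 4).
rewrite /bell -/v (_ : a / 2 * v ^+ 2 / 2 = a * v ^+ 2 / 4); last by field.
rewrite expRN => h; rewrite ler_pdivrMr ?expR_gt0//.
apply: (@le_trans _ _ ((1 + a^-1) * (1 + a * v ^+ 2 / 4))); last first.
  by rewrite ler_wpM2l// addr_ge0// invr_ge0 ltW.
have := sqr_ge0 (`|v| / 2 - 1); rewrite -(real_normK (num_real v)).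
have aVa : a^-1 * a = 1 by rewrite mulVf// gt_eqF.
have aV0 : 0 < a^-1 by rewrite invr_gt0.
have n0 := normr_ge0 v.
rewrite (_ : (1 + a^-1) * (1 + a * `|v| ^+ 2 / 4) =
  1 + a^-1 + a * `|v| ^+ 2 / 4 + (a^-1 * a) * `|v| ^+ 2 / 4); last by ring.
rewrite aVa => sq; have : 0 <= a * `|v| ^+ 2 by rewrite mulr_ge0 ?sqr_ge0// ltW.
by nra.
Qed.

Lemma integrable_normM_bell a c : 0 < a ->
  leb.-integrable setT (fun u => (`|u + c| * bell a c u)%:E).
Proof.
move=> a0; have a20 : 0 < a / 2 by rewrite divr_gt0.
apply: (@integrable_dominated _ _ _ leb (fun u => `|u + c| * bell a c u) (fun u => (1 + a^-1) * bell (a / 2) c u)).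
- apply: measurable_funM; last exact: measurable_bell.
  by apply: measurableT_comp => //; exact: measurable_funD.
- move=> u; rewrite ger0_norm ?mulr_ge0 ?bell_ge0//.
  exact: normM_bell_le.
- by apply: integrableZ; exact: integrable_bell.
Qed.

Lemma is_derive_bell a c u :
  is_derive u 1 (bell a c) (- (a * (u + c)) * bell a c u).
Proof.
rewrite /bell.
have -> : (fun u => expR (- (a * (u + c) ^+ 2 / 2))) =
   expR \o (fun u => - (a / 2 * (u + c) ^+ 2)).
  by apply/funext => w /=; congr expR; field.
apply: is_derive_eq.
rewrite /GRing.scale /= !(expr1,mulr1,addr0,add0r,mul1r).
rewrite (_ : - (a / 2 * (u + c) ^+ 2) = - (a * (u + c) ^+ 2 / 2)); last by field.
by field.
Qed.

Lemma bell_cvg0 a c : 0 < a -> bell a c n%:R @[n --> \oo] --> 0.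
Proof.
move=> a0.
apply/cvgrPdist_le => e e0.
have A0 : 0 < 2 / (a * e) by rewrite divr_gt0// mulr_gt0.
near=> n.
rewrite sub0r normrN ger0_norm ?bell_ge0//.
have n1 : 1 <= n%:R + c :> R.
  by rewrite -lerBlDr; near: n; exact: nbhs_infty_ger.
have n2 : 2 / (a * e) <= n%:R + c.
  by rewrite -lerBlDr; near: n; exact: nbhs_infty_ger.
rewrite /bell expRN -[leRHS]invrK lef_pV2 ?posrE ?expR_gt0 ?invr_gt0//.
apply: le_trans (expR_ge1Dx _).
have : e^-1 <= a * (n%:R + c) / 2.
  move: n2; rewrite ler_pdivrMr ?mulr_gt0// => n2.
  by rewrite -(ler_pM2r e0) mulVf ?gt_eqF//; nra.
rewrite (_ : a * (n%:R + c) ^+ 2 / 2 = a * (n%:R + c) / 2 * (n%:R + c)); last by field.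
move=> h; apply: (le_trans h).
have : 0 <= a * (n%:R + c) / 2 by rewrite divr_ge0// mulr_ge0 ?(le_trans _ n1)// ltW.
by nra.
Unshelve. all: by end_near. Qed.

Lemma bell_cvg0N a c : 0 < a -> bell a c (- n%:R) @[n --> \oo] --> 0.
Proof.
move=> a0; rewrite (_ : (fun n => _) = fun n => bell a (- c) n%:R).
  exact: bell_cvg0.
by apply/funext => n; rewrite /bell; congr (expR (- (_ * _ / 2))); ring.
Qed.

End gauss_1d.

Section gauss_fourier_1d.
Context {R : realType}.
Local Notation leb := (@lebesgue_measure R).
Implicit Types a c x u th : R.

(** The fundamental theorem of calculus on [-n, n], then dominated convergence. *)
Lemma integral_derivative_eq0 (F f g : R -> R) :
  (forall u, is_derive u 1 F (f u)) -> continuous f ->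
  (forall u, `|f u| <= g u) -> leb.-integrable setT (EFin \o g) ->
  F n%:R @[n --> \oo] --> 0 -> F (- n%:R) @[n --> \oo] --> 0 ->
  \int[leb]_u f u = 0.
Proof.
move=> dF cf fg ig F0 F0N.
have mf : measurable_fun setT f by exact: continuous_measurable_fun.
have cF : continuous F.
  by move=> u; apply/differentiable_continuous/derivable1_diffP.
pose fn n := (EFin \o f) \_ `[- n%:R, n%:R]%classic.
have mfn n : measurable_fun setT (fn n).
  apply/(measurable_restrictT _ _).1 => //.
  by apply/measurable_funTS/measurable_EFinP.
have := @dominated_convergence _ _ _ leb _ measurableT fn (EFin \o f) (EFin \o g) mfn.
case=> //.
- exact/measurable_EFinP.
- apply: aeW => u _; apply: cvg_near_cst; near=> n.
  rewrite /fn patchE ifT// inE/= in_itv/= -ler_norml.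
  by near: n; exact: nbhs_infty_ger.
- apply: aeW => u n _; rewrite /fn patchE; case: ifP => _ /=.
    by rewrite lee_fin fg.
  by rewrite normr0 lee_fin (le_trans _ (fg u)).
move=> fi _ cvI.
have fnE n : (\int[leb]_u fn n u = (F n%:R)%:E - (F (- n%:R))%:E)%E.
  (* The fundamental theorem asks for a nondegenerate interval; at n = 0 both sides vanish. *)
  case: n => [|n].
    by rewrite oppr0 subee// -integral_mkcond oppr0 set_itv1 integral_set1.
  rewrite -integral_mkcond; apply: continuous_FTC2 => //.
  - by rewrite ltrNl -subr_gt0 opprK addr_gt0.
  - exact: continuous_subspaceT.
  - split; [by move=> u _; have [] := dF u| |].
      by apply: cvg_at_right_filter; exact: cF.
    by apply: cvg_at_left_filter; exact: cF.
  - by move=> u _; rewrite derive1E derive_val.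
have cv0 : (\int[leb]_u fn n u)%E @[n --> \oo] --> 0%:E.
  under eq_fun do rewrite fnE -EFinB.
  apply: cvg_EFin; first exact: nearW.
  by rewrite -[0]subr0; apply: cvgB.
rewrite /Rintegral.
have -> : (\int[leb]_u (EFin \o f) u = 0)%E.
  by rewrite -(cvg_lim _ cvI)//; exact: cvg_lim.
by [].
Unshelve. all: by end_near. Qed.

Lemma abs_cos_le1 x : `|cos x| <= 1.
Proof. by rewrite ler_norml cos_geN1 cos_le1. Qed.

Lemma abs_sin_le1 x : `|sin x| <= 1.
Proof. by rewrite ler_norml sin_geN1 sin_le1. Qed.

Lemma cvg_bounded_mul0 (s b : R^nat) : (forall n, `|s n| <= 1) ->
  b n @[n --> \oo] --> 0 -> s n * b n @[n --> \oo] --> 0.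
Proof.
move=> s1 b0; apply/cvgrPdist_le => e e0.
move/cvgrPdist_le : b0 => /(_ e e0); apply: filterS => n.
rewrite !sub0r !normrN normrM; apply: le_trans.
by rewrite ler_piMl.
Qed.

Lemma continuous_phase c x th : continuous (fun u => (u + c) * x + th).
Proof.
by move=> u; apply: cvgD; [apply: cvgMl; apply: cvgD => //|]; exact: cvg_cst.
Qed.

(** The integrand is the derivative of [sin ((u + c) * x + th) * bell a c u]. This gives the
    differential equation in [x] of the cosine transform of [bell]. *)
Lemma bell_ibp a c x th : 0 < a ->
  \int[leb]_u ((x * cos ((u + c) * x + th) - a * (u + c) * sin ((u + c) * x + th))
    * bell a c u) = 0.
Proof.
move=> a0.
have ccos : continuous (fun u => cos ((u + c) * x + th)).
  by move=> u; apply: continuous_comp; [exact: continuous_phase|exact: continuous_cos].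
have csin : continuous (fun u => sin ((u + c) * x + th)).
  by move=> u; apply: continuous_comp; [exact: continuous_phase|exact: continuous_sin].
apply: (@integral_derivative_eq0 (fun u => sin ((u + c) * x + th) * bell a c u) _
   (fun u => `|x| * bell a c u + a * (`|u + c| * bell a c u))).
- move=> u; have := is_derive_bell a c u => db.
  apply: is_derive_eq; rewrite /GRing.scale/= !(mul1r,mulr1,addr0,add0r,scaler0).
  by ring.
- move=> u; apply: cvgM; last exact: continuous_bell.
  apply: cvgB; apply: cvgM; [exact: cvg_cst|exact: ccos| |exact: csin].
  by apply: cvgM; [exact: cvg_cst|apply: cvgD => //; exact: cvg_cst].
- move=> u; rewrite mulrA -mulrDl normrM (ger0_norm (bell_ge0 _ _ _)).
  rewrite ler_wpM2r ?bell_ge0//; apply: (le_trans (ler_normB _ _)).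
  rewrite !normrM (gtr0_norm a0); apply: lerD.
    by rewrite ler_piMr// abs_cos_le1.
  by rewrite ler_piMr ?mulr_ge0 ?abs_sin_le1// ltW.
- rewrite (_ : _ \o _ = ((fun u => (`|x| * bell a c u)%:E) \+ (fun u => (a * (`|u + c| * bell a c u))%:E))%E).
    apply: integrableD => //; apply: integrableZ.
      exact: integrable_bell.
    exact: integrable_normM_bell.
  by apply/funext => u /=; rewrite EFinD.
- by apply: cvg_bounded_mul0; [move=> n; exact: abs_sin_le1|exact: bell_cvg0].
- by apply: cvg_bounded_mul0; [move=> n; exact: abs_sin_le1|exact: bell_cvg0N].
Qed.

Lemma integrable_trig_bell (s : R -> R) a c : 0 < a -> measurable_fun setT s ->
  (forall u, `|s u| <= 1) -> leb.-integrable setT (fun u => (s u * bell a c u)%:E).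
Proof.
move=> a0 ms s1.
apply: (@integrable_dominated _ _ _ leb (fun u => s u * bell a c u) (bell a c)).
- by apply: measurable_funM => //; exact: measurable_bell.
- by move=> u; rewrite normrM (ger0_norm (bell_ge0 _ _ _)) ler_piMl ?bell_ge0.
- exact: integrable_bell.
Qed.

Lemma gauss_ode (F : R -> R) a x : 0 < a ->
  (forall y : R, is_derive y (1 : R) F (- (y / a) * F y)) ->
  F x = F 0 * expR (- (x ^+ 2 / (2 * a))).
Proof.
move=> a0 dF.
have dFe (y : R) : is_derive y (1 : R) (fun y => F y * expR (y ^+ 2 / (2 * a))) 0.
  have dFy := dF y.
  have -> : (fun y => F y * expR (y ^+ 2 / (2 * a))) = F * (expR \o (fun y => (2 * a)^-1 * y ^+ 2)).
    apply/funext => w; rewrite mulrfctE /=; congr (_ * expR _); exact: mulrC.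
  apply: is_derive_eq.
  rewrite /GRing.scale/= !(mul1r,mulr1,addr0,add0r,scaler0,expr1).
  by field; rewrite gt_eqF.
have := is_derive_0_is_cst x 0 dFe.
rewrite expr0n/= mul0r expR0 mulr1 => <-.
by rewrite -mulrA -expRD subrr expR0 mulr1.
Qed.

(** Differentiation under the integral sign and [bell_ibp] give F' = - (x / a) F, which [gauss_ode]
    solves. The phase [th] is free so that it can carry the remaining coordinates in the induction
    on the dimension. *)
Lemma integral_cos_bell a c x th : 0 < a ->
  \int[leb]_u (cos ((u + c) * x + th) * bell a c u) =
  Num.sqrt (2 * pi / a) * expR (- (x ^+ 2 / (2 * a))) * cos th.
Proof.
move=> a0.
pose f x u := cos ((u + c) * x + th) * bell a c u.
pose F x := \int[leb]_u f x u.
have mphase y : measurable_fun setT (fun u => (u + c) * y + th).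
  by apply: continuous_measurable_fun; exact: continuous_phase.
have mcos y : measurable_fun setT (fun u => cos ((u + c) * y + th)).
  apply: measurableT_comp (mphase y); apply: continuous_measurable_fun; exact: continuous_cos.
have msin y : measurable_fun setT (fun u => sin ((u + c) * y + th)).
  apply: measurableT_comp (mphase y); apply: continuous_measurable_fun; exact: continuous_sin.
have df (y u : R) : is_derive y (1 : R) (f ^~ u) (- (u + c) * sin ((u + c) * y + th) * bell a c u).
  rewrite /f; apply: is_derive_eq.
  by rewrite /GRing.scale/= !(mul1r,mulr1,addr0,add0r,scaler0); ring.
have dF (y : R) : is_derive y (1 : R) F (- (y / a) * F y).
  pose G u := `|u + c| * bell a c u.
  have yI : `]y - 1, y + 1[%classic y by rewrite /= in_itv/=; apply/andP; split; lra.
  have fi z : `]y - 1, y + 1[%classic z -> leb.-integrable setT (EFin \o f z).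
    by move=> _; apply: integrable_trig_bell => // u; exact: abs_cos_le1.
  have fd z u : `]y - 1, y + 1[%classic z -> [set: R] u -> derivable (f ^~ u) z 1 by [].
  have G0 u : 0 <= G u by rewrite mulr_ge0 ?bell_ge0.
  have pE z u : partial1of2 f z u = - (u + c) * sin ((u + c) * z + th) * bell a c u.
    by rewrite partial1of2E derive_val.
  have fG z u : `]y - 1, y + 1[%classic z -> [set: R] u -> `|partial1of2 f z u| <= G u.
    move=> _ _; rewrite pE !normrM normrN (ger0_norm (bell_ge0 _ _ _)) /G.
    by rewrite ler_wpM2r ?bell_ge0// ler_piMr// abs_sin_le1.
  have Gi := integrable_normM_bell c a0.
  apply: DeriveDef.
    exact: (derivable_under_integral measurableT yI fi fd G0 Gi fG).
  have := differentiation_under_integral measurableT yI fi fd G0 Gi fG.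
  rewrite derive1E => ->.
  have si : leb.-integrable setT (fun u => ((u + c) * sin ((u + c) * y + th) * bell a c u)%:E).
    apply: (@integrable_dominated _ _ _ leb (fun u => (u + c) * sin ((u + c) * y + th) * bell a c u) G) => //.
      apply: measurable_funM; last exact: measurable_bell.
      by apply: measurable_funM; [exact: measurable_funD|exact: msin].
    move=> u; rewrite !normrM (ger0_norm (bell_ge0 _ _ _)) /G.
    by rewrite ler_wpM2r ?bell_ge0// ler_piMr// abs_sin_le1.
  under eq_Rintegral do rewrite pE.
  have ibp : \int[leb]_u (y * f y u - a * ((u + c) * sin ((u + c) * y + th) * bell a c u)) = 0.
    by rewrite -[RHS](bell_ibp c y th a0); apply: eq_Rintegral => u _; rewrite /f; ring.
  rewrite RintegralB// in ibp; last 2 first.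
    by apply: integrableZ; apply: fi.
    exact: (integrableZ a si).
  rewrite !RintegralZl// in ibp; last exact: fi.
  under eq_Rintegral do rewrite !mulNr -mulN1r.
  rewrite RintegralZl//.
  move: ibp; rewrite -/(f y) -/(F y).
  set J := \int[_]_(x0 in _) _ => ibp.
  have -> : J = y * F y / a.
    have /eqP := ibp; rewrite subr_eq0 => /eqP ->.
    by rewrite mulrAC divff ?mul1r// gt_eqF.
  by rewrite mulN1r; field; rewrite gt_eqF.
rewrite -/(F x) (gauss_ode x a0 dF).
rewrite [RHS]mulrAC; congr (_ * _).
rewrite /F /f; under eq_Rintegral do rewrite mulr0 add0r.
rewrite RintegralZl//; last exact: integrable_bell.
by rewrite mulrC /Rintegral integral_bell.
Qed.
End gauss_fourier_1d.

Section bilinear_form.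
Context {R : realType}.

Definition bilinear_form d (A : 'M[R]_d) (u w : 'rV[R]_d) : R :=
  \sum_i \sum_j u 0 i * A i j * w 0 j.

Lemma bilinear_form_dot d (A : 'M[R]_d) u w : bilinear_form A u w = dot u (w *m A^T).
Proof.
rewrite /bilinear_form /dot; apply: eq_bigr => i _; rewrite mxE mulr_sumr.
by apply: eq_bigr => j _; rewrite mxE mulrAC -mulrA mulrCA mulrC.
Qed.

Lemma quadratic_formE d (A : 'M[R]_d) u : quadratic_form A u = bilinear_form A u u.
Proof.
rewrite /quadratic_form -mulmxA mxE; apply: eq_bigr => i _.
by rewrite mxE mulr_sumr; apply: eq_bigr => j _; rewrite mxE mulrA.
Qed.

Definition spd d (A : 'M[R]_d) : Prop :=
  A^T = A /\ forall v, v != 0 -> 0 < quadratic_form A v.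

Lemma measurable_dot d (c x : 'rV[R]_d) : measurable_fun setT (fun z : 'rV[R]_d => dot (z + c) x).
Proof.
apply: measurable_sum => i; apply: measurable_funM => //.
by under eq_fun do rewrite mxE; apply: measurable_funD => //; exact: measurable_fun_coord.
Qed.

Lemma measurable_quadratic_form d (A : 'M[R]_d) c :
  measurable_fun setT (fun z : 'rV[R]_d => quadratic_form A (z + c)).
Proof.
under eq_fun do rewrite quadratic_formE.
apply: measurable_sum => i; apply: measurable_sum => j.
have mc k : measurable_fun setT (fun z : 'rV[R]_d => (z + c) 0 k).
  by under eq_fun do rewrite mxE; apply: measurable_funD => //; exact: measurable_fun_coord.
by apply: measurable_funM => //; apply: measurable_funM.
Qed.

End bilinear_form.

(** * Splitting one coordinate off a quadratic form *)

Section schur.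
Context {R : realType} {d : nat} (A : 'M[R]_d.+1).
Local Notation a := (A 0 0).

Definition schur_row : 'rV[R]_d := \row_j A 0 (lift ord0 j).

Definition schur_complement : 'M[R]_d :=
  \matrix_(i, j) (A (lift ord0 i) (lift ord0 j) - A 0 (lift ord0 i) * A 0 (lift ord0 j) / a).

Lemma rV_consE (z : 'rV[R]_d.+1) :
  z = rV_cons (z 0 0, \row_j z 0 (lift ord0 j)).
Proof.
by apply/rowP => j; rewrite mxE; case: unliftP => [k ->|->]//; rewrite mxE.
Qed.

Lemma rV_cons0 (p : R * 'rV[R]_d) : rV_cons p 0 0 = p.1.
Proof. by rewrite mxE unlift_none. Qed.

Lemma rV_consS (p : R * 'rV[R]_d) j : rV_cons p 0 (lift ord0 j) = p.2 0 j.
Proof. by rewrite mxE liftK. Qed.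

Lemma rV_consD (p q : R * 'rV[R]_d) : rV_cons (p.1 + q.1, p.2 + q.2) = rV_cons p + rV_cons q.
Proof. by apply/rowP => j; rewrite !mxE; case: unliftP => [k _|_]//; rewrite mxE. Qed.

Hypotheses (At : A^T = A) (a0 : a != 0).

(** Completing the square in the first coordinate, in polarized form: the quadratic case serves the
    exponent of a Gaussian integral, the bilinear one its phase. *)
Lemma bilinear_form_schur (p q : R * 'rV[R]_d) :
  bilinear_form A (rV_cons p) (rV_cons q) =
  a * (p.1 + dot p.2 schur_row / a) * (q.1 + dot q.2 schur_row / a) +
  bilinear_form schur_complement p.2 q.2.
Proof.
have Asym i j : A i j = A j i by rewrite -{1}At mxE.
case: p q => s v [r w] /=.
rewrite /bilinear_form big_ord_recl /= big_ord_recl !rV_cons0 /=.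
under eq_bigr do rewrite rV_consS /=.
under [X in _ + X = _]eq_bigr do rewrite big_ord_recl rV_cons0 rV_consS /=.
under [X in _ + X = _]eq_bigr do under eq_bigr do rewrite rV_consS /=.
rewrite big_split /=.
under [X in _ = _ + X]eq_bigr => i _.
  under eq_bigr => j _.
    rewrite mxE (_ : _ * _ * _ = v 0 i * A (lift ord0 i) (lift ord0 j) * w 0 j
      - v 0 i * A 0 (lift ord0 i) / a * (w 0 j * A 0 (lift ord0 j))); last by field.
  over.
  rewrite sumrB -mulr_sumr.
over.
rewrite sumrB -mulr_suml -mulr_suml.
have -> : \sum_(i < d) s * A 0 (lift ord0 i) * w 0 i = s * dot w schur_row.
  rewrite mulr_sumr; apply: eq_bigr => i _; rewrite mxE; ring.
have -> : \sum_(i < d) v 0 i * A (lift ord0 i) 0 = dot v schur_row.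
  by apply: eq_bigr => i _; rewrite mxE Asym.
have -> : \sum_(i < d) w 0 i * A 0 (lift ord0 i) = dot w schur_row.
  by apply: eq_bigr => i _; rewrite mxE.
rewrite -mulr_suml.
have -> : \sum_(i < d) v 0 i * A 0 (lift ord0 i) = dot v schur_row.
  by apply: eq_bigr => i _; rewrite mxE.
rewrite (_ : ord0 = 0 :> 'I_d.+1)//.
by field.
Qed.

Lemma schur_complement_sym : schur_complement^T = schur_complement.
Proof.
have Asym i j : A i j = A j i by rewrite -{1}At mxE.
by apply/matrixP => i j; rewrite !mxE (Asym (lift ord0 j)) -!mulrA (mulrCA (A 0 (lift ord0 j))).
Qed.

(** One step of block elimination: [A] is a unit lower triangular matrix times a block upper
    triangular one with diagonal blocks [a] and the Schur complement. *)
Lemma det_schur : \det A = a * \det schur_complement.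
Proof.
have Asym i j : A i j = A j i by rewrite -{1}At mxE.
pose L : 'M[R]_(1 + d) := block_mx 1%:M 0 (a^-1 *: schur_row^T) 1%:M.
pose U : 'M[R]_(1 + d) := block_mx a%:M schur_row 0 schur_complement.
have AE : L *m U = A :> 'M[R]_(1 + d).
  apply/esym.
  rewrite /L /U mulmx_block !mul1mx !mul0mx !addr0.
  rewrite -[A in LHS](@submxK _ 1 d 1 d); congr block_mx.
  - by apply/matrixP => i j; rewrite !mxE !ord1 /= ?eqxx ?mulr1n; congr (A _ _); apply/val_inj.
  - apply/matrixP => i j; rewrite !mxE !ord1; congr (A _ _); exact/val_inj.
  - apply/matrixP => i j; rewrite !mxE big_ord1 !mxE !ord1 ?eqxx ?mulr1n mulrC mulrA divff// mul1r.
    by rewrite Asym; congr (A _ _); apply/val_inj.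
  - apply/matrixP => i j; rewrite !mxE big_ord1 !mxE.
    rewrite (_ : rshift 1 i = lift ord0 i); last exact/val_inj.
    rewrite (_ : rshift 1 j = lift ord0 j); last exact/val_inj.
    by field.
have dL : \det L = 1 by apply: etrans (det_lblock _ _ _) _; rewrite !det1 mul1r.
have dU : \det U = a * \det schur_complement.
  by apply: etrans (det_ublock _ _ _) _; rewrite det_scalar1.
by rewrite -[LHS](congr1 determinant AE) [LHS](@det_mulmx _ (1 + d)) dL dU mul1r.
Qed.

End schur.

Section schur_spd.
Context {R : realType} {d : nat} (A : 'M[R]_d.+1).
Hypothesis sA : spd A.

Lemma spd_entry00 : 0 < A 0 0.
Proof.
have := sA.2 (delta_mx 0 0); rewrite quadratic_formE /bilinear_form.
rewrite (bigD1 0)//= (bigD1 0)//= !mxE !eqxx mul1r mulr1 !big1 ?addr0.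
- by apply; apply/eqP => /rowP /(_ 0) /eqP; rewrite !mxE !eqxx oner_eq0.
- by move=> i i0; rewrite big1// => j _; rewrite mxE (negbTE i0) mul0r mul0r.
- by move=> i i0; rewrite !mxE (negbTE i0) mulr0.
Qed.

(** [A] is evaluated at the extension of [v] whose first coordinate annihilates the completed
    square. *)
Lemma spd_schur : spd (schur_complement A).
Proof.
have a0 : A 0 0 != 0 by rewrite gt_eqF// spd_entry00.
split=> [|v v0]; first exact: schur_complement_sym sA.1.
have := sA.2 (rV_cons (- (dot v (schur_row A) / A 0 0), v)).
rewrite !quadratic_formE bilinear_form_schur//=; last exact: sA.1.
rewrite addNr mulr0 add0r; apply.
apply: contra v0 => /eqP /rowP v0; apply/eqP/rowP => j.
by have := v0 (lift ord0 j); rewrite rV_consS !mxE.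
Qed.

End schur_spd.

Section gauss_rV.
Context {R : realType}.
Local Notation leb := (@lebesgue_measure R).

Lemma ge0_integral_rV_succ d (f : 'rV[R]_d.+1 -> \bar R) :
  measurable_fun setT f -> (forall z, (0 <= f z)%E) ->
  (\int[lebesgue_rV d.+1]_z f z =
   \int[lebesgue_rV d]_v \int[leb]_s f (rV_cons (s, v)))%E.
Proof.
move=> mf f0; have mc := @measurable_rV_cons R d.
transitivity (\int[leb \x lebesgue_rV d]_p (f \o (@rV_cons R d)) p)%E.
  apply: (@ge0_integral_pushforward _ _ _ _ R (@rV_cons R d) mc (leb \x lebesgue_rV d)%E setT f) => //.
rewrite fubini_tonelli2//; first exact: measurableT_comp.
by move=> x; exact: f0.
Qed.

Lemma addr_cos_ge0 (p q y : R) : `|q| <= p -> 0 <= p + q * cos y.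
Proof.
move=> qp; have : `|q * cos y| <= p by rewrite normrM (le_trans _ qp)// ler_piMr// abs_cos_le1.
by rewrite ler_norml => /andP[+ _]; rewrite lerNl -subr_ge0 opprK.
Qed.

Lemma ge0_integral_cos_bell (a c x th p q : R) : 0 < a -> `|q| <= p ->
  (\int[leb]_u ((p + q * cos ((u + c) * x + th)) * bell a c u)%:E =
   (Num.sqrt (2 * pi / a) * (p + q * (expR (- (x ^+ 2 / (2 * a))) * cos th)))%:E)%E.
Proof.
move=> a0 qp.
have ic : leb.-integrable setT (fun u => (cos ((u + c) * x + th) * bell a c u)%:E).
  apply: integrable_trig_bell => //; last by move=> u; exact: abs_cos_le1.
  apply: measurableT_comp; apply: continuous_measurable_fun.
    exact: continuous_cos.
  exact: continuous_phase.
under eq_integral do rewrite mulrDl -mulrA EFinD.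
rewrite integralD//; [|exact: (integrableZ p (integrable_bell _ _))|exact: (integrableZ q ic)].
under eq_integral do rewrite EFinM.
under [X in (_ + X)%E]eq_integral do rewrite EFinM.
rewrite !integralZl//; last exact: integrable_bell.
rewrite integral_bell// -(fineK (integrable_fin_num measurableT ic)).
rewrite -[fine _]/(\int[leb]_u (cos ((u + c) * x + th) * bell a c u)) integral_cos_bell//.
by rewrite -!EFinM -EFinD; congr EFin; ring.
Qed.

Lemma bilinear_cos_measurable d (A : 'M[R]_d) c w th :
  measurable_fun setT (fun z : 'rV[R]_d => cos (bilinear_form A (z + c) w + th)).
Proof.
apply: measurableT_comp.
  by apply: continuous_measurable_fun; exact: continuous_cos.
apply: measurable_funD => //.
by under eq_fun do rewrite bilinear_form_dot; exact: measurable_dot.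
Qed.

Lemma measurable_gauss d (A : 'M[R]_d) c :
  measurable_fun setT (fun z : 'rV[R]_d => expR (- (quadratic_form A (z + c) / 2))).
Proof.
apply: measurableT_comp; first exact: measurable_expR.
apply: (@measurable_funN _ _ _ _ (fun z : 'rV[R]_d => quadratic_form A (z + c) / 2)).
by apply: measurable_funM => //; exact: measurable_quadratic_form.
Qed.

(** Induction on the dimension, the first coordinate being integrated out by completing the square.
    The integrands [p + q * cos] with |q| <= p are nonnegative, so Tonelli's theorem applies, and
    the class is stable: one integration multiplies [q] by a factor at most 1. Positivity of the
    determinant is part of the induction because the constant divides by the determinant of the
    Schur complement. *)
Lemma ge0_integral_gauss_rV d (A : 'M[R]_d) (c w : 'rV[R]_d) (th p q : R) :
  spd A -> `|q| <= p ->
  0 < \det A /\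
  (\int[lebesgue_rV d]_z ((p + q * cos (bilinear_form A (z + c) w + th)) *
      expR (- (quadratic_form A (z + c) / 2)))%:E =
   (Num.sqrt ((2 * pi) ^+ d / \det A) *
     (p + q * (expR (- (quadratic_form A w / 2)) * cos th)))%:E)%E.
Proof.
elim: d A c w th p q => [|d IHd] A c w th p q sA qp.
  rewrite det_mx00; split=> //=.
  have b0 (u v : 'rV[R]_0) : bilinear_form A u v = 0 by rewrite /bilinear_form big_ord0.
  rewrite integral_dirac//=; last first.
    apply/measurable_EFinP; apply: measurable_funM; last exact: measurable_gauss.
    by apply: measurable_funD => //; apply: measurable_funM => //; exact: bilinear_cos_measurable.
  rewrite diracT mul1e !quadratic_formE !b0 mul0r oppr0 expR0 add0r divr1 sqrtr1.
  by rewrite mulr1 !mul1r.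
have a0 := spd_entry00 sA; have an0 : A 0 0 != 0 by rewrite gt_eqF.
set a := A 0 0 in a0 an0.
rewrite (rV_consE c) (rV_consE w).
set c0 := c 0 0; set w0 := w 0 0.
set c' := \row_j c 0 (lift ord0 j); set w' := \row_j w 0 (lift ord0 j).
set C := schur_complement A; set b := schur_row A.
have sC : spd C by exact: spd_schur.
(* The frequency of the phase with respect to the completed first coordinate. *)
pose x := a * (w0 + dot w' b / a).
have q1 : `|q * expR (- (x ^+ 2 / (2 * a)))| <= p.
  rewrite normrM (le_trans _ qp)// ler_piMr// ger0_norm ?expR_ge0// -expR0 ler_expR.
  by rewrite oppr_le0 divr_ge0 ?sqr_ge0// mulr_ge0// ltW.
have [dC IC] := IHd C c' w' th p _ sC q1.
have dA : \det A = a * \det C by apply: det_schur => //; exact: sA.1.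
split; first by rewrite dA mulr_gt0.
rewrite ge0_integral_rV_succ; last 2 first.
- apply/measurable_EFinP; apply: measurable_funM; last exact: measurable_gauss.
  by apply: measurable_funD => //; apply: measurable_funM => //; exact: bilinear_cos_measurable.
- move=> z; by rewrite lee_fin mulr_ge0 ?expR_ge0 ?addr_cos_ge0.
have inner v : (\int[leb]_s ((p + q * cos (bilinear_form A (rV_cons (s, v) + rV_cons (c0, c')) (rV_cons (w0, w')) + th)) *
      expR (- (quadratic_form A (rV_cons (s, v) + rV_cons (c0, c')) / 2)))%:E =
   (Num.sqrt (2 * pi / a))%:E * ((p + q * expR (- (x ^+ 2 / (2 * a))) * cos (bilinear_form C (v + c') w' + th)) *
      expR (- (quadratic_form C (v + c') / 2)))%:E)%E.
  pose g := c0 + dot (v + c') b / a.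
  transitivity (\int[leb]_s ((expR (- (quadratic_form C (v + c') / 2)))%:E *
      ((p + q * cos ((s + g) * x + (bilinear_form C (v + c') w' + th))) * bell a g s)%:E))%E.
    apply: eq_integral => s _; rewrite -rV_consD quadratic_formE !bilinear_form_schur//=; try exact: sA.1.
    rewrite -/a -/b -/C -EFinM; congr EFin; rewrite mulrCA; congr (_ * _).
      by congr (p + q * cos _); rewrite /x /g; ring.
    by rewrite /bell -expRD quadratic_formE; congr expR; rewrite /g; field.
  rewrite ge0_integralZl//=; last 2 first.
  - apply/measurable_EFinP; apply: measurable_funM; last exact: measurable_bell.
    apply: measurable_funD => //; apply: measurable_funM => //.
    apply: measurableT_comp; apply: continuous_measurable_fun.
      exact: continuous_cos.
    exact: continuous_phase.
  - move=> s _; by rewrite lee_fin mulr_ge0 ?bell_ge0 ?addr_cos_ge0.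
  rewrite ge0_integral_cos_bell// -!EFinM; congr EFin; rewrite !mulrA; ring.
under eq_integral do rewrite inner.
rewrite ge0_integralZl//; last 2 first.
- apply/measurable_EFinP; apply: measurable_funM; last exact: measurable_gauss.
  by apply: measurable_funD => //; apply: measurable_funM => //; exact: bilinear_cos_measurable.
- move=> z _; by rewrite lee_fin mulr_ge0 ?expR_ge0 ?addr_cos_ge0.
rewrite IC -EFinM; congr EFin; rewrite [LHS]mulrA -sqrtrM; last by rewrite divr_ge0 ?mulr_ge0 ?pi_ge0// ltW.
congr (Num.sqrt _ * (p + _)).
  by rewrite dA exprS; field; rewrite an0 gt_eqF.
rewrite -!mulrA; congr (_ * _); rewrite mulrA; congr (_ * _).
rewrite -expRD !quadratic_formE bilinear_form_schur//=; last exact: sA.1.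
by congr expR; rewrite /x -/b -/C -/a; field.
Qed.

Lemma ge0_integral_gauss d (A : 'M[R]_d) (c : 'rV[R]_d) : spd A ->
  (\int[lebesgue_rV d]_z (expR (- (quadratic_form A (z + c) / 2)))%:E =
   (Num.sqrt ((2 * pi) ^+ d / \det A))%:E)%E.
Proof.
move=> sA; have h : `|0 : R| <= 1 by rewrite normr0.
have [_] := ge0_integral_gauss_rV c 0 0 sA h.
rewrite mul0r addr0 mulr1 => <-; apply: eq_integral => z _.
by rewrite mul0r addr0 mul1r.
Qed.

Lemma integrable_gauss_rV d (A : 'M[R]_d) (c : 'rV[R]_d) : spd A ->
  (lebesgue_rV d).-integrable setT (fun z => (expR (- (quadratic_form A (z + c) / 2)))%:E).
Proof.
move=> sA; apply/integrableP; split.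
  by apply/measurable_EFinP; exact: measurable_gauss.
under eq_integral do rewrite /= ger0_norm ?expR_ge0//.
by rewrite ge0_integral_gauss// ltry.
Qed.

Lemma integral_gauss_rV d (A : 'M[R]_d) (c : 'rV[R]_d) : spd A ->
  \int[lebesgue_rV d]_z expR (- (quadratic_form A (z + c) / 2)) =
  Num.sqrt ((2 * pi) ^+ d / \det A).
Proof. by move=> sA; rewrite /Rintegral ge0_integral_gauss. Qed.

Lemma integral_cos_gauss_rV d (A : 'M[R]_d) (w : 'rV[R]_d) : spd A ->
  \int[lebesgue_rV d]_z (cos (bilinear_form A z w) * expR (- (quadratic_form A z / 2))) =
  Num.sqrt ((2 * pi) ^+ d / \det A) * expR (- (quadratic_form A w / 2)).
Proof.
move=> sA; have h : `|1 : R| <= 1 by rewrite normr1.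
have i1 : (lebesgue_rV d).-integrable setT (fun z => (expR (- (quadratic_form A z / 2)))%:E).
  by have := integrable_gauss_rV 0 sA; under eq_fun do rewrite addr0.
have i2 : (lebesgue_rV d).-integrable setT (fun z => (cos (bilinear_form A z w) * expR (- (quadratic_form A z / 2)))%:E).
  apply: (@integrable_dominated _ _ _ _ (fun z => cos (bilinear_form A z w) * expR (- (quadratic_form A z / 2))) (fun z => expR (- (quadratic_form A z / 2)))) => //.
    apply: measurable_funM.
      have := bilinear_cos_measurable A 0 w 0.
      by under eq_fun do rewrite !addr0.
    have := measurable_gauss A 0.
    by under eq_fun do rewrite !addr0.
  by move=> z; rewrite normrM (ger0_norm (expR_ge0 _)) ler_piMl ?expR_ge0// abs_cos_le1.
(* The case p = q = 1, from which the pure Gaussian integral is subtracted. *)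
have [_ /(congr1 fine)] := ge0_integral_gauss_rV 0 w 0 sA h.
rewrite -[fine (integral _ _ _)]/(\int[lebesgue_rV d]_z
  ((1 + 1 * cos (bilinear_form A (z + 0) w + 0)) * expR (- (quadratic_form A (z + 0) / 2)))).
under eq_Rintegral do rewrite !addr0 mul1r mulrDl mul1r.
rewrite RintegralD//.
have := integral_gauss_rV 0 sA; under eq_Rintegral do rewrite addr0.
by move=> ->; rewrite /= cos0 => e; apply: (addrI _ (etrans e _)); ring.
Qed.

End gauss_rV.

(** * Characteristic functions *)

Import ComplexField.Normc.

Section trigonometric_bounds.
Context {R : realType}.
Implicit Types u v x y : R.

Lemma MVT_bound (f df : R -> R) (K x y : R) :
  (forall v : R, is_derive v (1 : R) f (df v)) ->
  (forall v, Num.min x y <= v <= Num.max x y -> `|df v| <= K) ->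
  `|f y - f x| <= K * `|y - x|.
Proof.
move=> fd dK.
have cf : continuous f.
  by move=> u; apply/differentiable_continuous/derivable1_diffP; have [] := fd u.
wlog xy : x y dK / x <= y.
  move=> h; have [xy|/ltW yx] := leP x y; first exact: h.
  by rewrite distrC (distrC y); apply: h => // v; rewrite minC maxC; exact: dK.
have [c cxy ->] := @MVT_segment R f df x y xy (fun v _ => fd v) (continuous_subspaceT cf).
rewrite normrM ler_wpM2r// dK//.
by rewrite (min_idPl xy) (max_idPr xy); rewrite in_itv in cxy.
Qed.

(** Each use raises the order of a Taylor estimate at 0 by one, from the bound on the derivative;
    the constants obtained this way are not sharp. *)
Lemma MVT_bound0 (f df : R -> R) (K u : R) :
  (forall v : R, is_derive v (1 : R) f (df v)) -> f 0 = 0 ->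
  (forall v, `|v| <= `|u| -> `|df v| <= K) -> `|f u| <= K * `|u|.
Proof.
move=> fd f0 dK; have := @MVT_bound f df K 0 u fd.
rewrite f0 !subr0; apply=> v /andP[v1 v2]; apply: dK.
by move: v1 v2; rewrite minElt maxElt; case: ifPn => u0 a b;
  rewrite ler_norml; apply/andP; split; move: u0; rewrite -?leNgt => u0;
  rewrite ?(gtr0_norm u0) ?(ler0_norm u0); lra.
Qed.

Lemma abs_sin_le u : `|sin u| <= `|u|.
Proof.
rewrite -[leRHS]mul1r; apply: (@MVT_bound0 _ cos); rewrite ?sin0// => v _.
exact: abs_cos_le1.
Qed.

Lemma abs_cos_subr1_le u : `|cos u - 1| <= u ^+ 2.
Proof.
rewrite -(real_normK (num_real u)) expr2.
apply: (@MVT_bound0 (fun u => cos u - 1) (fun u => - sin u)); rewrite ?cos0 ?subrr//.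
- by move=> v; apply: is_derive_eq; rewrite subr0 /GRing.scale/= ?mul1r ?mulr1.
- by move=> v vu; rewrite normrN (le_trans (abs_sin_le _)).
Qed.

Lemma abs_cos_subr1_lin u : `|cos u - 1| <= `|u|.
Proof.
rewrite -[leRHS]mul1r.
apply: (@MVT_bound0 (fun u => cos u - 1) (fun u => - sin u)); rewrite ?cos0 ?subrr//.
- by move=> v; apply: is_derive_eq; rewrite subr0 /GRing.scale/= ?mul1r ?mulr1.
- by move=> v vu; rewrite normrN abs_sin_le1.
Qed.

Lemma abs_sin_subr_le u : `|sin u - u| <= `|u| ^+ 3.
Proof.
rewrite exprSr.
apply: (@MVT_bound0 (fun u => sin u - u) (fun u => cos u - 1)); rewrite ?sin0 ?subrr//.
- by move=> v vu; rewrite (le_trans (abs_cos_subr1_le _))// -(real_normK (num_real v)) lerXn2r ?nnegrE.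
Qed.

Lemma abs_cos_taylor2 u : `|cos u - 1 + u ^+ 2 / 2| <= 2 * `|u| ^+ 3.
Proof.
rewrite [leRHS](_ : _ = 2 * `|u| ^+ 2 * `|u|); last by rewrite -mulrA -exprSr.
apply: (@MVT_bound0 (fun u => cos u - 1 + u ^+ 2 / 2) (fun u => u - sin u)).
- move=> v; rewrite (_ : (fun u => _) = (fun u => cos u - 1 + 2^-1 * u ^+ 2)).
    by apply: is_derive_eq; rewrite /GRing.scale/=; field.
  by apply/funext => w; rewrite (mulrC (w ^+ 2)).
- by rewrite cos0 expr0n/= subrr mul0r addr0.
- move=> v vu; apply: (@le_trans _ _ (2 * `|v| ^+ 2)); last by rewrite ler_wpM2l// lerXn2r ?nnegrE.
  (* The bound needed on |v - sin v| is 2 v^2: the cubic estimate gives it up to |v| = 2, and |v| +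
     |sin v| <= 2 |v| gives it beyond. *)
  have v0 := normr_ge0 v; have [v2|v2] := leP `|v| 2.
    rewrite distrC (le_trans (abs_sin_subr_le v))// exprS ler_wpM2r//.
  rewrite (le_trans (ler_normB _ _))//.
  by have := abs_sin_le v; nra.
Qed.

Lemma abs_cosB_le x y : `|cos x - cos y| <= `|x - y|.
Proof.
rewrite -[leRHS]mul1r; apply: (@MVT_bound cos (fun u => - sin u)) => v _.
by rewrite normrN abs_sin_le1.
Qed.

End trigonometric_bounds.

Section complex_modulus.
Context {R : realType}.
Local Open Scope complex_scope.
Implicit Types z : R[i].

Lemma normc_ge0 z : 0 <= normc z. Proof. by case: z => a b; exact: sqrtr_ge0. Qed.

Lemma normcD_le z z' : normc (z + z') <= normc z + normc z'.
Proof. exact: (@le_normcD R z z'). Qed.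

Lemma normcNE z : normc (- z) = normc z.
Proof. exact: (@normcN R z). Qed.

Lemma normc_real (x : R) : normc x%:C = `|x|.
Proof. by rewrite /normc /= expr0n/= addr0 sqrtr_sqr. Qed.

Lemma normc_imag (x : R) : normc (0 +i* x) = `|x|.
Proof. by rewrite /normc /= expr0n/= add0r sqrtr_sqr. Qed.

Lemma sqr_normc_Re_Im z : normc z ^+ 2 = complex.Re z ^+ 2 + complex.Im z ^+ 2.
Proof. by case: z => a b /=; rewrite sqr_sqrtr// addr_ge0// sqr_ge0. Qed.

Lemma abs_Re_le z : `|complex.Re z| <= normc z.
Proof.
rewrite -(@ler_pXn2r _ 2)// ?nnegrE ?normc_ge0//.
by rewrite sqr_normc_Re_Im real_normK ?num_real// lerDl sqr_ge0.
Qed.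

Lemma normc_le_Re_Im z : normc z <= `|complex.Re z| + `|complex.Im z|.
Proof.
case: z => a b; rewrite (_ : a +i* b = a%:C + (0 +i* b)); last first.
  by apply/eqP; rewrite eq_complex /= addr0 add0r !eqxx.
by rewrite (le_trans (normcD_le _ _))// normc_real normc_imag /= addr0 add0r.
Qed.

Lemma normc_sum (I : Type) (r : seq I) (Q : pred I) (F : I -> R[i]) :
  normc (\sum_(i <- r | Q i) F i) <= \sum_(i <- r | Q i) normc (F i).
Proof.
elim/big_ind2 : _ => //; first by rewrite normc0.
by move=> x1 x2 y1 y2 h1 h2; rewrite (le_trans (normcD_le _ _))// lerD.
Qed.

Lemma Re_sum (I : Type) (r : seq I) (Q : pred I) (F : I -> R[i]) :
  complex.Re (\sum_(i <- r | Q i) F i) = \sum_(i <- r | Q i) complex.Re (F i).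
Proof.
elim: r => [|i r IH]; first by rewrite !big_nil.
by rewrite !big_cons; case: ifP => _ //; rewrite -IH; case: (F i) (\sum_(_ <- r | _) _) => ? ? [].
Qed.

Lemma Im_sum (I : Type) (r : seq I) (Q : pred I) (F : I -> R[i]) :
  complex.Im (\sum_(i <- r | Q i) F i) = \sum_(i <- r | Q i) complex.Im (F i).
Proof.
elim: r => [|i r IH]; first by rewrite !big_nil.
by rewrite !big_cons; case: ifP => _ //; rewrite -IH; case: (F i) (\sum_(_ <- r | _) _) => ? ? [].
Qed.

(** With [normc_dual] this makes the modulus the maximum of the linear forms p Re + q Im over unit
    vectors. An inequality on the modulus of an integral thus follows from a pointwise inequality
    between real functions, for one well chosen phase. *)
Lemma normc_attained z : exists p q : R,
  p ^+ 2 + q ^+ 2 = 1 /\ normc z = p * complex.Re z + q * complex.Im z.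
Proof.
have [z0|z0] := eqVneq (normc z) 0.
  exists 1, 0; rewrite expr1n expr0n/= addr0 z0; split=> //.
  by rewrite (eq0_normc z0) /= mulr0 mul0r addr0.
exists (complex.Re z / normc z), (complex.Im z / normc z).
have := sqr_normc_Re_Im z; move: z0; set m := normc z => m0 e; split.
  by rewrite !expr_div_n -mulrDl -e divff// expf_eq0.
by rewrite mulrAC [in X in _ + X]mulrAC -mulrDl -!expr2 -e expr2 mulfK.
Qed.

Lemma normc_dual (p q : R) z : p ^+ 2 + q ^+ 2 = 1 ->
  p * complex.Re z + q * complex.Im z <= normc z.
Proof.
move=> pq; apply: le_trans (ler_norm _) _.
rewrite -(@ler_pXn2r _ 2)// ?nnegrE ?normc_ge0// real_normK ?num_real//.
rewrite sqr_normc_Re_Im; case: z => a b /=.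
rewrite -subr_ge0 (_ : _ - _ = (p * b - q * a) ^+ 2 + (1 - (p ^+ 2 + q ^+ 2)) * (a ^+ 2 + b ^+ 2)); last by ring.
by rewrite pq subrr mul0r addr0 sqr_ge0.
Qed.

End complex_modulus.

Section characteristic_function.
Context {R : realType} {disp : measure_display} {T : measurableType disp}
  (mu : {measure set T -> \bar R}) (E : set T).
Local Open Scope complex_scope.
Implicit Types U : T -> R.

Definition cf U : R[i] := (\int[mu]_(w in E) cos (U w)) +i* (\int[mu]_(w in E) sin (U w)).

Hypotheses (mE : measurable E) (fE : mu E \is a fin_num).

Lemma bounded_integrable (f : T -> R) (K : R) : measurable_fun setT f ->
  (forall w, `|f w| <= K) -> mu.-integrable E (EFin \o f).
Proof.
move=> mf fK; apply/integrableP; split.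
  by apply/measurable_EFinP/measurable_funTS.
apply: (@le_lt_trans _ _ (\int[mu]_(w in E) (K%:E))%E).
  apply: ge0_le_integral => //=.
  - by apply/measurable_EFinP/measurableT_comp => //; exact/measurable_funTS.
  - by move=> w _; rewrite lee_fin.
by rewrite integral_cst// -(fineK fE) -EFinM ltry.
Qed.

Lemma cos_integrable U : measurable_fun setT U -> mu.-integrable E (EFin \o (fun w => cos (U w))).
Proof.
move=> mU; apply: (@bounded_integrable _ 1) => [|w]; last exact: abs_cos_le1.
by apply: measurableT_comp mU; apply: continuous_measurable_fun; exact: continuous_cos.
Qed.

Lemma sin_integrable U : measurable_fun setT U -> mu.-integrable E (EFin \o (fun w => sin (U w))).
Proof.
move=> mU; apply: (@bounded_integrable _ 1) => [|w]; last exact: abs_sin_le1.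
by apply: measurableT_comp mU; apply: continuous_measurable_fun; exact: continuous_sin.
Qed.

Lemma cf_combination U (p q : R) : measurable_fun setT U ->
  p * complex.Re (cf U) + q * complex.Im (cf U) =
  \int[mu]_(w in E) (p * cos (U w) + q * sin (U w)).
Proof.
move=> mU; have ic := cos_integrable mU; have isn := sin_integrable mU.
rewrite RintegralD//; last 2 first.
- exact: (integrableZl mE p ic).
- exact: (integrableZl mE q isn).
by rewrite !RintegralZl.
Qed.

Lemma integrable_trig_combination U (p q r : R) : measurable_fun setT U ->
  mu.-integrable E (EFin \o (fun w => p * cos (U w) + q * sin (U w) + r)).
Proof.
move=> mU; apply: (@bounded_integrable _ (`|p| + `|q| + `|r|)) => [|w].
  apply: measurable_funD => //; apply: measurable_funD; apply: measurable_funM => //.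
    by apply: measurableT_comp mU; apply: continuous_measurable_fun; exact: continuous_cos.
  by apply: measurableT_comp mU; apply: continuous_measurable_fun; exact: continuous_sin.
rewrite (le_trans (ler_normD _ _))// lerD2r (le_trans (ler_normD _ _))//.
by rewrite lerD// normrM ler_piMr// ?abs_cos_le1 ?abs_sin_le1.
Qed.

Lemma normc_cf_le U : measurable_fun setT U -> normc (cf U) <= fine (mu E).
Proof.
move=> mU; have [p [q [pq ->]]] := normc_attained (cf U).
rewrite cf_combination//.
have -> : fine (mu E) = \int[mu]_(w in E) 1 by rewrite Rintegral_cst// mul1r.
apply: le_Rintegral => //.
- have := integrable_trig_combination p q 0 mU.
  by apply: eq_integrable => // w _ /=; rewrite addr0.
- by apply: (@bounded_integrable (fun=> 1) 1) => // w; rewrite normr1.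
- move=> w _; have := @normc_dual R p q (cos (U w) +i* sin (U w)) pq.
  by rewrite /= cos2Dsin2 sqrtr1.
Qed.

(* With the phase [(p, q)] of [cf U] and [g = p cos U + q sin U], this is the
   integral of [2 g^2 - 1 >= 4 g - 3]. *)
Lemma cf_doubling U : measurable_fun setT U ->
  fine (mu E) - normc (cf (fun w => 2 * U w)) <= 4 * (fine (mu E) - normc (cf U)).
Proof.
move=> mU; have [p [q [pq e]]] := normc_attained (cf U).
have mU2 : measurable_fun setT (fun w => 2 * U w) by exact: measurable_funM.
have pq2 : (p ^+ 2 - q ^+ 2) ^+ 2 + (2 * p * q) ^+ 2 = 1.
  by rewrite (_ : _ + _ = (p ^+ 2 + q ^+ 2) ^+ 2); [rewrite pq expr1n|ring].
have := normc_dual (cf (fun w => 2 * U w)) pq2.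
rewrite cf_combination// => h.
suff : 4 * normc (cf U) - 3 * fine (mu E) <= normc (cf (fun w => 2 * U w)) by lra.
apply: le_trans h.
have -> : 4 * normc (cf U) - 3 * fine (mu E) =
    \int[mu]_(w in E) (4 * p * cos (U w) + 4 * q * sin (U w) + - 3).
  rewrite RintegralD//; last 2 first.
  - have := integrable_trig_combination (4 * p) (4 * q) 0 mU.
    by apply: eq_integrable => // w _ /=; rewrite addr0.
  - by apply: (@bounded_integrable (fun=> - 3) `|- 3|).
  rewrite -cf_combination// Rintegral_cst// e; ring.
apply: le_Rintegral => //.
- exact: integrable_trig_combination.
- have := integrable_trig_combination (p ^+ 2 - q ^+ 2) (2 * p * q) 0 mU2.
  by apply: eq_integrable => // w _ /=; rewrite addr0.
- move=> w _.
  rewrite [2 * U w]mulrC mulr_natr cos_mulr2n sin_mulr2n.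
  have := cos2Dsin2 (U w); set c := cos _; set s := sin _ => cs.
  have g1 := @normc_dual R p q (c +i* s) pq.
  have : 0 <= 2 * (p * c + q * s - 1) ^+ 2 by rewrite mulr_ge0// sqr_ge0.
  rewrite -(mulr_natr (c ^+ 2)) -(mulr_natr (c * s)).
  have -> : (p ^+ 2 - q ^+ 2) * (c ^+ 2 * 2 - 1) + 2 * p * q * (c * s * 2) =
    2 * (p * c + q * s) ^+ 2 - 1 + (p ^+ 2 - q ^+ 2 - 1 + 2 * q ^+ 2) * -1 + 2 * q ^+ 2 * (1 - (c ^+ 2 + s ^+ 2)).
    ring.
  rewrite cs (_ : p ^+ 2 - q ^+ 2 - 1 + 2 * q ^+ 2 = p ^+ 2 + q ^+ 2 - 1); last by ring.
  rewrite pq; lra.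
Qed.

End characteristic_function.

(** * Laws and the Markov property *)

Section integral_like.
Context {R : realType} {disp : measure_display} {S : measurableType disp}.
Local Open Scope ereal_scope.
Implicit Types (f g : S -> \bar R) (Phi Psi : (S -> \bar R) -> \bar R).

Definition ge0_mfun f := measurable_fun setT f /\ forall x, 0 <= f x.

(** What a monotone class argument asks of integration on nonnegative measurable functions. The two
    sides of an identity below are often iterated integrals or sums of integrals; with these axioms
    the identity reduces to indicators, and no measure has to be constructed for each side. *)
Record integral_like Phi : Prop := {
  integral_like_ge0 : forall f, ge0_mfun f -> 0 <= Phi f ;
  integral_like_le : forall f g, ge0_mfun f -> ge0_mfun g ->
    (forall x, f x <= g x) -> Phi f <= Phi g ;
  integral_likeD : forall f g, ge0_mfun f -> ge0_mfun g ->
    Phi (fun x => f x + g x) = Phi f + Phi g ;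
  integral_likeZ : forall (k : R) f, (0 <= k)%R -> ge0_mfun f ->
    Phi (fun x => k%:E * f x) = k%:E * Phi f ;
  integral_like_cvg : forall (F : (S -> \bar R)^nat) f, (forall n, ge0_mfun (F n)) ->
    ge0_mfun f ->
    (forall x, {homo F^~ x : n m / (n <= m)%N >-> n <= m}) ->
    (forall x, F n x @[n --> \oo] --> f x) -> Phi (F n) @[n --> \oo] --> Phi f }.

Lemma ge0_mfun_indic (A : set S) : measurable A -> ge0_mfun (EFin \o \1_A).
Proof.
move=> mA; split=> [|x]; last by rewrite lee_fin.
by apply/measurable_EFinP; exact: measurable_indic.
Qed.

Lemma ge0_mfunZ (k : R) f : (0 <= k)%R -> ge0_mfun f -> ge0_mfun (fun x => k%:E * f x).
Proof.
move=> k0 [mf f0]; split=> [|x]; last by rewrite mule_ge0.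
exact: measurable_funeM.
Qed.

Import HBNNSimple.

Lemma integral_like_unique Phi Psi : integral_like Phi -> integral_like Psi ->
  (forall A, measurable A -> Phi (EFin \o \1_A) = Psi (EFin \o \1_A)) ->
  forall f, ge0_mfun f -> Phi f = Psi f.
Proof.
move=> iPhi iPsi PP f [mf f0].
pose F := nnsfun_approx measurableT mf.
have F0 n : ge0_mfun (EFin \o F n).
  by split=> [|x]; [exact/measurable_EFinP|rewrite lee_fin].
have FE n : Phi (EFin \o F n) = Psi (EFin \o F n).
  set s := finmap.enum_fset (fset_set (range (F n))).
  (* Induction over lists of values of the simple function. Membership in its range is kept because
     homogeneity is available only for nonnegative scalars. *)
  have sum_ge0 (t : seq R) : {subset t <= s} ->
      ge0_mfun (fun x => (\sum_(y <- t) (y * \1_(F n @^-1` [set y]) x))%R%:E) /\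
      Phi (fun x => (\sum_(y <- t) (y * \1_(F n @^-1` [set y]) x))%R%:E) =
      Psi (fun x => (\sum_(y <- t) (y * \1_(F n @^-1` [set y]) x))%R%:E).
    elim: t => [|y t IH] ts.
      under eq_fun do rewrite big_nil.
      have z0 : ge0_mfun (fun=> 0 : \bar R) by split.
      split=> //.
      (* The value at the zero function comes from homogeneity with the scalar 0. *)
      have zE : (fun=> 0 : \bar R) = (fun x : S => 0%:E * (cst 0 : S -> \bar R) x).
        by apply/funext => x; rewrite mul0e.
      by rewrite zE (integral_likeZ iPhi)// (integral_likeZ iPsi)// !mul0e.
    have [|h1 h2] := IH.
      by move=> z zt; apply: ts; rewrite inE zt orbT.
    have mA : measurable (F n @^-1` [set y]) by rewrite -[X in measurable X]setTI; exact: measurable_funP.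
    have y0 : (0 <= y)%R.
      have := ts y; rewrite inE eqxx => /(_ isT).
      rewrite /s in_fset_set// inE => -[x _ <-]; exact: fun_ge0.
    have hy := ge0_mfunZ y0 (ge0_mfun_indic mA).
    have E : (fun x => (\sum_(z <- y :: t) (z * \1_(F n @^-1` [set z]) x))%R%:E) =
       (fun x => (fun x => y%:E * (EFin \o \1_(F n @^-1` [set y])) x) x +
         (fun x => (\sum_(y <- t) (y * \1_(F n @^-1` [set y]) x))%R%:E) x).
      by apply/funext => x; rewrite big_cons EFinD EFinM.
    rewrite E; split.
      by case: hy h1 => ? ? [? ?]; split=> [|x]; [exact: emeasurable_funD|exact: adde_ge0].
    rewrite (integral_likeD iPhi)// (integral_likeD iPsi)// h2.
    by rewrite (integral_likeZ iPhi)// ?(integral_likeZ iPsi)// ?PP//; exact: ge0_mfun_indic.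
  have [] := sum_ge0 s (fun=> id).
  rewrite (_ : (fun x => _) = EFin \o F n)//.
  by apply/funext => x /=; rewrite fimfunE fsbig_finite.
have ndF x : {homo (fun n => EFin \o F n)^~ x : n m / (n <= m)%N >-> n <= m}.
  by move=> a b ab /=; rewrite lee_fin; exact/lefP/nd_nnsfun_approx.
have cvF x : (EFin \o F n) x @[n --> \oo] --> f x by exact: cvg_nnsfun_approx.
have h1 := integral_like_cvg iPhi F0 (conj mf f0) ndF cvF.
have h2 := integral_like_cvg iPsi F0 (conj mf f0) ndF cvF.
have {}h1 : Psi (EFin \o F n) @[n --> \oo] --> Phi f by move: h1; under eq_fun do rewrite FE.
exact: (cvg_unique _ h1 h2).
Qed.

Lemma integral_like_add Phi Psi : integral_like Phi -> integral_like Psi ->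
  integral_like (fun f => Phi f + Psi f).
Proof.
move=> iP iQ; split.
- by move=> f hf; rewrite adde_ge0// ?(integral_like_ge0 iP)// (integral_like_ge0 iQ).
- by move=> f g hf hg fg; rewrite leeD// ?(integral_like_le iP)// (integral_like_le iQ).
- by move=> f g hf hg; rewrite (integral_likeD iP)// (integral_likeD iQ)// addeACA.
- move=> k f k0 hf; rewrite (integral_likeZ iP)// (integral_likeZ iQ)// ge0_muleDr//.
  + exact: (integral_like_ge0 iP).
  + exact: (integral_like_ge0 iQ).
- move=> F f hF hf ndF cvF; apply: cvgeD.
  + by apply: ge0_adde_def; rewrite inE ?(integral_like_ge0 iP) ?(integral_like_ge0 iQ).
  + exact: (integral_like_cvg iP).
  + exact: (integral_like_cvg iQ).
Qed.

(** Closure under mixing. Weighted evaluations [Psi z] produce image measures and densities;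
    integrals against a kernel produce the right-hand side of the semigroup identity. *)
Lemma integral_like_mixture d' (T : measurableType d') (mu : {measure set T -> \bar R})
    (E : set T) (Psi : T -> (S -> \bar R) -> \bar R) :
  measurable E -> (forall z, integral_like (Psi z)) ->
  (forall f, ge0_mfun f -> measurable_fun setT (fun z => Psi z f)) ->
  integral_like (fun f => \int[mu]_(z in E) Psi z f).
Proof.
move=> mE iP mP; split.
- by move=> f hf; apply: integral_ge0 => z _; exact: (integral_like_ge0 (iP z)).
- move=> f g hf hg fg; apply: ge0_le_integral => //.
  + by move=> z _; exact: (integral_like_ge0 (iP z)).
  + by apply: measurable_funTS; exact: mP.
  + by apply: measurable_funTS; exact: mP.
  + by move=> z _; exact: (integral_like_le (iP z)).
- move=> f g hf hg; rewrite -ge0_integralD//.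
  + by apply: eq_integral => z _; exact: (integral_likeD (iP z)).
  + by move=> z _; exact: (integral_like_ge0 (iP z)).
  + by apply: measurable_funTS; exact: mP.
  + by move=> z _; exact: (integral_like_ge0 (iP z)).
  + by apply: measurable_funTS; exact: mP.
- move=> k f k0 hf; rewrite -ge0_integralZl//.
  + by apply: eq_integral => z _; exact: (integral_likeZ (iP z)).
  + by apply: measurable_funTS; exact: mP.
  + by move=> z _; exact: (integral_like_ge0 (iP z)).
- move=> F f hF hf ndF cvF.
  have cz z : Psi z (F n) @[n --> \oo] --> Psi z f by exact: (integral_like_cvg (iP z)).
  rewrite (_ : \int[mu]_(z in E) Psi z f = \int[mu]_(z in E) limn (fun n => Psi z (F n))); last first.
    by apply: eq_integral => z _; apply/esym/cvg_lim.
  apply: (cvg_monotone_convergence mE) => //.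
  + by move=> n; apply: measurable_funTS; exact: mP.
  + by move=> n z _; exact: (integral_like_ge0 (iP z)).
  + move=> z _ a b ab.
    apply: (integral_like_le (iP z)) => // x; exact: ndF.
Qed.

Lemma integral_like_eval (x : S) (k : R) : (0 <= k)%R -> integral_like (fun f => k%:E * f x).
Proof.
move=> k0; split.
- by move=> f [_ f0]; rewrite mule_ge0.
- by move=> f g _ _ fg; rewrite lee_wpmul2l.
- by move=> f g [_ f0] [_ g0]; rewrite ge0_muleDr.
- by move=> c f c0 [_ f0]; rewrite muleCA.
- by move=> F f hF hf ndF cvF; apply: cvgeZl.
Qed.

End integral_like.

Section integral_like_examples.
Context {R : realType} {disp : measure_display} {S : measurableType disp}.
Local Open Scope ereal_scope.

Lemma integral_like_comp d' (T : measurableType d') (mu : {measure set T -> \bar R})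
    (E : set T) (V : T -> S) : measurable E -> measurable_fun setT V ->
  integral_like (fun f : S -> \bar R => \int[mu]_(w in E) f (V w)).
Proof.
move=> mE mV.
rewrite (_ : (fun f => _) = fun f => \int[mu]_(w in E) (1%:E * f (V w))); last first.
  by apply/funext => f; apply: eq_integral => w _; rewrite mul1e.
apply: (@integral_like_mixture _ _ _ _ _ _ _ (fun w f => 1%:E * f (V w))) => //.
- by move=> w; exact: integral_like_eval.
- by move=> f [mf f0]; apply: measurable_funeM; exact: measurableT_comp.
Qed.

Lemma integral_like_density (mu : {measure set S -> \bar R}) (g : S -> R) :
  measurable_fun setT g -> (forall x, 0 <= g x)%R ->
  integral_like (fun f : S -> \bar R => \int[mu]_x ((g x)%:E * f x)).
Proof.
move=> mg g0.
apply: (@integral_like_mixture _ _ _ _ _ _ _ (fun x f => (g x)%:E * f x)) => //.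
- by move=> w; exact: integral_like_eval.
- move=> f [mf f0]; apply: emeasurable_funM => //; exact/measurable_EFinP.
Qed.

Lemma integral_indic_comp d' (T : measurableType d') (mu : {measure set T -> \bar R})
    (E : set T) (V : T -> S) (A : set S) : measurable E -> measurable_fun setT V ->
  measurable A -> \int[mu]_(w in E) (\1_A (V w))%:E = mu (V @^-1` A `&` E).
Proof.
move=> mE mV mA.
have mVA : measurable (V @^-1` A) by rewrite -[X in measurable X]setTI; exact: mV.
transitivity (\int[mu]_(w in E) (\1_(V @^-1` A) w)%:E); last exact: integral_indic.
by apply: eq_integral => w _; rewrite !indicE; congr (_%:R%:E); apply/idP/idP; rewrite !inE.
Qed.

Lemma ge0_integral_law d' (T : measurableType d') (mu : {measure set T -> \bar R})
    (E : set T) (V : T -> S) (lam nu : {measure set S -> \bar R}) (g : S -> R)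
    (f : S -> \bar R) :
  measurable E -> measurable_fun setT V ->
  measurable_fun setT g -> (forall x, 0 <= g x)%R ->
  (forall B, measurable B -> mu (E `&` V @^-1` B) = \int[lam]_(y in B) (g y)%:E + nu B) ->
  ge0_mfun f ->
  \int[mu]_(w in E) f (V w) = \int[lam]_y ((g y)%:E * f y) + \int[nu]_y f y.
Proof.
move=> mE mV mg g0 law hf.
apply: (integral_like_unique (integral_like_comp mu mE mV)
  (integral_like_add (integral_like_density lam mg g0)
    (integral_like_comp nu measurableT (@measurable_id _ S setT)))) => //.
move=> A mA; rewrite integral_indic_comp// setIC law//; congr (_ + _).
  rewrite integral_mkcond; apply: eq_integral => y _ /=.
  by rewrite patchE indicE; case: ifP => /= _; rewrite ?mule1 ?mule0.
by rewrite integral_indic// setIT.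
Qed.

Lemma ge0_integral_eq_law d' (T : measurableType d') (mu : {measure set T -> \bar R})
    (E : set T) (V : T -> S) (nu : {measure set S -> \bar R}) (F : set S) (f : S -> \bar R) :
  measurable E -> measurable F -> measurable_fun setT V ->
  (forall B, measurable B -> mu (E `&` V @^-1` B) = nu (F `&` B)) ->
  ge0_mfun f ->
  \int[mu]_(w in E) f (V w) = \int[nu]_(y in F) f y.
Proof.
move=> mE mF mV law hf.
apply: (integral_like_unique (integral_like_comp mu mE mV)
    (integral_like_comp nu mF (@measurable_id _ S setT))) => //.
by move=> A mA; rewrite integral_indic_comp// setIC law// integral_indic// setIC.
Qed.

End integral_like_examples.

Section measurability.
Context {R : realType} {d : nat}.

Lemma measurable_addr_rV (y : 'rV[R]_d) : measurable_fun setT (fun z : 'rV[R]_d => z + y).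
Proof.
apply: measurable_fun_mx => i j; rewrite (ord1 i); under eq_fun do rewrite mxE.
by apply: measurable_funD => //; exact: measurable_fun_coord.
Qed.

Lemma measurable_set1_rV (y : 'rV[R]_d) : measurable [set y].
Proof.
rewrite (_ : [set y] = \bigcap_(j in [set: 'I_d])
    ((fun z : 'rV[R]_d => z 0 j) @^-1` [set y 0 j])).
  apply: fin_bigcap_measurable => // j _.
  by rewrite -[X in measurable X]setTI; apply: measurable_fun_coord.
apply/seteqP; split => [z -> //|z zy]; apply/rowP => j; exact: zy.
Qed.

End measurability.

(** * Integrals along a Markov additive process *)

Section markov_additive.
Context {R : realType} (tk : time_kind) {n d : nat} {disp : measure_display}
  {Omega : measurableType disp} (P : 'I_n.+1 -> probability Omega R)
  (Xt : R -> Omega -> 'I_n.+1) (Zt : R -> Omega -> 'rV[R]_d)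
  (Q : R -> R.-pker ('I_n.+1 * 'rV[R]_d)%type ~> ('I_n.+1 * 'rV[R]_d)%type).
Hypothesis MAP : markov_additive_process tk P Xt Zt Q.
Local Notation T := (time_set R tk).

Lemma time_set0 : T 0. Proof. by case: tk => /=; [exists 0%N|exact: lexx]. Qed.

Lemma time_setD s t : T s -> T t -> T (s + t).
Proof.
case: tk => /= [[i _ <-] [j _ <-]|]; last exact: addr_ge0.
by exists (i + j)%N; rewrite // natrD.
Qed.

Lemma time_set_nat m : T m%:R.
Proof. by case: tk => /=; [exists m|exact: ler0n]. Qed.

Lemma time_set_ge0 t : T t -> 0 <= t.
Proof. by case: tk => //= -[m _ <-]; exact: ler0n. Qed.

Lemma measurable_state t : T t -> measurable_fun setT (Xt t).
Proof.
move=> Tt; have := MAP_measurable MAP Tt; exact: (measurableT_comp measurable_fst).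
Qed.

Lemma measurable_additive t : T t -> measurable_fun setT (Zt t).
Proof.
move=> Tt; have := MAP_measurable MAP Tt; exact: (measurableT_comp measurable_snd).
Qed.

Lemma measurable_state_event t l : T t -> measurable [set w | Xt t w = l].
Proof.
move=> Tt; rewrite (_ : [set w | _] = setT `&` Xt t @^-1` [set l]); last by rewrite setTI.
exact: measurable_state.
Qed.

(** The Markov property at time 0 with the whole space as past event; almost surely the process
    starts from (k, 0), and the complement of that event is negligible. *)
Lemma law_kernel t k C : T t -> measurable C ->
  P k [set w | C (Xt t w, Zt t w)] = Q t (k, 0%R) C.
Proof.
move=> Tt mC.
have hT : history tk Xt Zt 0 setT.
  rewrite -setC0; apply: sigma_algebraC; exact: sigma_algebra0.
have := MAP_markov MAP k time_set0 Tt hT mC; rewrite add0r setTI => ->.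
have mV := MAP_measurable MAP time_set0.
have mq : measurable_fun setT (fun w => Q t (Xt 0 w, Zt 0 w) C).
  exact: (measurableT_comp (measurable_kernel (Q t) _ mC) mV).
set A := [set w | Xt 0 w = k /\ Zt 0 w = 0].
have mA : measurable A.
  rewrite (_ : A = setT `&` (fun w => (Xt 0 w, Zt 0 w)) @^-1` ([set k] `*` [set 0])).
    apply: mV => //; apply: measurableX => //; exact: measurable_set1_rV.
  by rewrite setTI.
have PA : P k (~` A) = 0%E.
  by rewrite probability_setC// (MAP_start MAP) subee.
rewrite (ge0_negligible_integral (N := ~` A))//.
- rewrite setDE setCK setTI.
  transitivity (\int[P k]_(w in A) Q t (k, 0%R) C)%E.
    by apply: eq_integral => w /set_mem [-> ->].
  rewrite integral_cst//. rewrite [X in (_ * X)%E](_ : _ = 1%E) ?mule1//. exact: (MAP_start MAP k).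
- exact: measurableC.
Qed.

Lemma ge0_integral_law_kernel t k (f : 'I_n.+1 * 'rV[R]_d -> \bar R) : T t -> ge0_mfun f ->
  (\int[P k]_w f (Xt t w, Zt t w) = \int[Q t (k, 0%R)]_z f z)%E.
Proof.
move=> Tt hf.
apply: (@ge0_integral_eq_law _ _ _ _ _ _ setT (fun w => (Xt t w, Zt t w)) _ setT) => //.
  exact: MAP_measurable MAP _ Tt.
by move=> B mB; rewrite !setTI; exact: law_kernel.
Qed.

Lemma ge0_integral_semigroup s t x (f : 'I_n.+1 * 'rV[R]_d -> \bar R) :
  T s -> T t -> ge0_mfun f ->
  (\int[Q (s + t) x]_z f z = \int[Q s x]_z \int[Q t z]_z' f z')%E.
Proof.
move=> Ts Tt hf.
have mid : measurable_fun setT (@id ('I_n.+1 * 'rV[R]_d)%type) by exact: measurable_id.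
apply: (integral_like_unique (integral_like_comp (Q (s + t) x) measurableT mid)
  (@integral_like_mixture _ _ _ _ _ (Q s x) setT
     (fun z f => \int[Q t z]_z' f z')%E measurableT _ _)) => //.
- by move=> z; exact: (integral_like_comp (Q t z) measurableT mid).
- move=> g [mg g0]; apply: measurable_fun_integral_kernel => //.
  by move=> U mU; exact: measurable_kernel.
- move=> A mA; rewrite integral_indic// setIT (MAP_semigroup MAP).2//.
  by apply: eq_integral => z _; rewrite integral_indic// setIT.
Qed.

Lemma ge0_integral_additive t k l y (h : 'rV[R]_d -> \bar R) : T t -> ge0_mfun h ->
  (\int[Q t (k, y)]_(z in [set l] `*` setT) h z.2 =
   \int[Q t (k, 0%R)]_(z in [set l] `*` setT) h (z.2 + y)%R)%E.
Proof.
move=> Tt hh.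
have ml : measurable ([set l] `*` [set: 'rV[R]_d]) by exact: measurableX.
have m2 : measurable_fun setT (fun z : 'I_n.+1 * 'rV[R]_d => z.2 + y).
  exact: (measurableT_comp (measurable_addr_rV y) measurable_snd).
apply: (integral_like_unique (integral_like_comp (Q t (k, y)) ml measurable_snd)
  (integral_like_comp (Q t (k, 0%R)) ml m2)) => //.
move=> A mA; rewrite !integral_indic_comp//.
rewrite (_ : snd @^-1` A `&` _ = [set l] `*` A); last first.
  by apply/seteqP; split => -[a b] /= => [[Ab [-> _]]|[-> Ab]].
rewrite (MAP_additive MAP)//; congr (Q t (k, 0%R) _).
apply/seteqP; split => -[a b] /=.
  by move=> [-> [z Az <-]]; rewrite subrK.
by move=> [Ab [-> _]]; split=> //; exists (b + y) => //; rewrite addrK.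
Qed.

Lemma setX1E (l : 'I_n.+1) : [set l] `*` [set: 'rV[R]_d] = [set z | z.1 = l].
Proof. by apply/seteqP; split => -[a b] //= []. Qed.

Lemma ge0_integral_state t k l (h : 'rV[R]_d -> \bar R) : T t -> ge0_mfun h ->
  (\int[P k]_(w in [set w | Xt t w = l]) h (Zt t w) =
   \int[Q t (k, 0%R)]_(z in [set l] `*` setT) h z.2)%E.
Proof.
move=> Tt [mh h0].
rewrite [LHS]integral_mkcond [RHS]integral_mkcond -ge0_integral_law_kernel//.
  apply: eq_integral => w _; rewrite setX1E !patchE /=.
  by rewrite (_ : (w \in [set w | Xt t w = l]) = ((Xt t w, Zt t w) \in [set z | z.1 = l]))//; apply/idP/idP; rewrite !inE.
split.
  apply/(measurable_restrictT _ _).1; first exact: measurableX.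
  by apply: measurable_funTS; exact: (measurableT_comp mh measurable_snd).
by move=> z; rewrite patchE; case: ifP.
Qed.

(** The path after time s is replaced by a fresh one started from (j, 0), shifted by Z_s: the
    semigroup identity followed by additivity of the kernel. In this form a phase in Z_(s+t)
    factorizes. *)
Lemma ge0_integral_markov s t k l (h : 'rV[R]_d -> \bar R) : T s -> T t -> ge0_mfun h ->
  (\int[P k]_(w in [set w | Xt (s + t) w = l]) h (Zt (s + t) w) =
   \sum_j \int[P k]_(w in [set w | Xt s w = j])
      \int[P j]_(w' in [set w | Xt t w = l]) h (Zt t w' + Zt s w)%R)%E.
Proof.
move=> Ts Tt hh; have [mh h0] := hh.
have hy (y : 'rV[R]_d) : ge0_mfun (fun z : 'rV[R]_d => h (z + y)).
  by split=> [|z]; [exact: (measurableT_comp mh (measurable_addr_rV y))|].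
have mS (j : 'I_n.+1) : measurable ([set j] `*` [set: 'rV[R]_d]) by apply: measurableX.
rewrite ge0_integral_state//; last exact: time_setD.
(* The arrival state is moved into the integrand, since the semigroup identity is about integrals
   over the whole space. *)
pose F (z : 'I_n.+1 * 'rV[R]_d) := if z.1 == l then h z.2 else 0%E.
have FE (x : 'I_n.+1 * 'rV[R]_d) u : (\int[Q u x]_(z in [set l] `*` setT) h z.2 = \int[Q u x]_z F z)%E.
  rewrite integral_mkcond; apply: eq_integral => z _.
  rewrite patchE setX1E /F; case: eqP => zl; first by rewrite mem_set.
  by rewrite memNset.
have hF : ge0_mfun F.
  have E : F = (h \o snd) \_ ([set l] `*` setT).
    apply/funext => z; rewrite patchE setX1E /F; case: eqP => zl; first by rewrite mem_set.
    by rewrite memNset.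
  split=> [|z]; last by rewrite /F; case: ifP.
  rewrite E; apply/(measurable_restrictT _ _).1; first exact: measurableX.
  by apply: measurable_funTS; exact: (measurableT_comp mh measurable_snd).
rewrite FE ge0_integral_semigroup//.
have mI : measurable_fun setT (fun z => \int[Q t z]_z' F z')%E.
  apply: measurable_fun_integral_kernel => //; [|exact: hF.2|exact: hF.1].
  by move=> U mU; exact: measurable_kernel.
have I0 z : (0 <= \int[Q t z]_z' F z')%E by apply: integral_ge0 => z' _; exact: hF.2.
have UT : [set: 'I_n.+1 * 'rV[R]_d] = \big[setU/set0]_(j < n.+1) ([set j] `*` setT).
  apply/seteqP; split => // -[j y] _.
  rewrite -(@bigcup_mkord_ord _ _ (fun j : 'I_n.+1 => [set j] `*` [set: 'rV[R]_d])).
  by exists (val j); [exact: ltn_ord|split=> //=; rewrite inord_val].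
have uI : uniq (index_enum 'I_n.+1) by rewrite /index_enum -enumT enum_uniq.
have tI : trivIset [set` index_enum 'I_n.+1] (fun j : 'I_n.+1 => [set j] `*` [set: 'rV[R]_d]).
  by move=> i j _ _ [[a b]] [[/= -> _] [-> _]].
have mI' := @measurable_funTS _ _ _ _ (\big[setU/set0]_(j < n.+1) ([set j] `*` setT)) _ mI.
rewrite [X in (\int[_]_(z in X) _)%E]UT.
rewrite (ge0_integral_bigsetU (Q s (k, 0%R)) mS uI tI mI' (fun z _ => I0 z)).
apply: eq_bigr => j _.
(* The inner integral is the integral of [F] against the kernel started from (j, y), which is
   measurable in y. *)
have hI : ge0_mfun (fun y => \int[P j]_(w' in [set w | Xt t w = l]) h (Zt t w' + y)%R)%E.
  have E : (fun y => \int[P j]_(w' in [set w | Xt t w = l]) h (Zt t w' + y)%R)%E =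
     (fun y => \int[Q t (j, y)]_z' F z')%E.
    apply/funext => y; rewrite -FE ge0_integral_additive//.
    by rewrite -(ge0_integral_state j l Tt (hy y)).
  rewrite E; split => // .
  have mj : measurable_fun setT (fun y : 'rV[R]_d => (j, y)) by exact: measurable_pair1.
  exact: (measurableT_comp mI mj).
rewrite (ge0_integral_state k j Ts hI); apply: eq_integral => -[a y] /set_mem /= [-> _].
by rewrite -FE ge0_integral_additive// (ge0_integral_state j l Tt (hy y)).
Qed.

End markov_additive.

(** * Characteristic matrices *)

Section dot_product.
Context {R : realType} {d : nat}.
Implicit Types (u v w : 'rV[R]_d) (a : R).

Lemma dotC u v : dot u v = dot v u.
Proof. by apply: eq_bigr => i _; rewrite mulrC. Qed.

Lemma dotDr u v w : dot u (v + w) = dot u v + dot u w.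
Proof. by rewrite /dot -big_split; apply: eq_bigr => i _; rewrite mxE mulrDr. Qed.

Lemma dotZl a u v : dot (a *: u) v = a * dot u v.
Proof. by rewrite /dot mulr_sumr; apply: eq_bigr => i _; rewrite mxE mulrA. Qed.

Lemma dotZr a u v : dot u (a *: v) = a * dot u v.
Proof. by rewrite dotC dotZl dotC. Qed.

Lemma dotNr u v : dot u (- v) = - dot u v.
Proof. by rewrite -scaleN1r dotZr mulN1r. Qed.

Lemma dotBr u v w : dot u (v - w) = dot u v - dot u w.
Proof. by rewrite dotDr dotNr. Qed.

Lemma dot_ge0 u : 0 <= dot u u.
Proof. by apply: sumr_ge0 => i _; rewrite -expr2 sqr_ge0. Qed.

Lemma dot_eq0 u : (dot u u == 0) = (u == 0).
Proof.
apply/idP/idP => [|/eqP ->]; last by rewrite /dot big1// => i _; rewrite mxE mul0r.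
rewrite psumr_eq0; last by move=> i _; rewrite -expr2 sqr_ge0.
move=> /allP u0; apply/eqP/rowP => i; rewrite mxE.
by have := u0 i; rewrite mem_index_enum mulf_eq0 orbb => /(_ isT)/eqP.
Qed.

Lemma sqr_euclidean_norm u : euclidean_norm u ^+ 2 = dot u u.
Proof. by rewrite sqr_sqrtr// dot_ge0. Qed.

Lemma euclidean_norm_ge0 u : 0 <= euclidean_norm u.
Proof. exact: sqrtr_ge0. Qed.

Lemma euclidean_normZ a u : euclidean_norm (a *: u) = `|a| * euclidean_norm u.
Proof.
by rewrite /euclidean_norm dotZl dotZr mulrA sqrtrM ?sqr_ge0// sqrtr_sqr.
Qed.

Lemma measurable_dotr (z : 'rV[R]_d) : measurable_fun setT (fun y : 'rV[R]_d => dot z y).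
Proof.
have := measurable_dot 0 z; under eq_fun do rewrite addr0.
by under eq_fun do rewrite dotC.
Qed.

Lemma cauchy_schwarz u v : `|dot u v| <= euclidean_norm u * euclidean_norm v.
Proof.
rewrite -(@ler_pXn2r _ 2)// ?nnegrE ?mulr_ge0 ?euclidean_norm_ge0//.
rewrite exprMn !sqr_euclidean_norm real_normK ?num_real//.
have [/eqP|v0] := eqVneq (dot v v) 0.
  rewrite dot_eq0 => /eqP ->.
  by rewrite (_ : dot u 0 = 0) ?expr0n ?mulr_ge0 ?dot_ge0// -(scale0r 0) dotZr mul0r.
have vp : 0 < dot v v by rewrite lt_neqAle eq_sym v0 dot_ge0.
have := dot_ge0 (dot v v *: u - dot u v *: v).
rewrite dotBr (dotC _ (dot v v *: u)) (dotC _ (dot u v *: v)) !dotBr !dotZl !dotZr (dotC v u).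
have -> : dot v v * (dot v v * dot u u) - dot v v * (dot u v * dot u v) -
   (dot u v * (dot v v * dot u v) - dot u v * (dot u v * dot v v)) =
   dot v v * (dot u u * dot v v - dot u v ^+ 2) by ring.
by rewrite pmulr_rge0// subr_ge0.
Qed.

End dot_product.

Section trig_integrals.
Context {R : realType} {disp : measure_display} {T : measurableType disp}
  (mu : {measure set T -> \bar R}) (E : set T).
Hypotheses (mE : measurable E) (fE : mu E \is a fin_num).

Lemma integral_trig (U : T -> R) (K p q : R) : measurable_fun setT U ->
  (\int[mu]_(w in E) (K + p * cos (U w) + q * sin (U w))%:E =
   (K * fine (mu E) + p * complex.Re (cf mu E U) + q * complex.Im (cf mu E U))%:E)%E.
Proof.
move=> mU.
have h := integrable_trig_combination mE fE p q K mU.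
rewrite (_ : (\int[mu]_(w in E) _)%E = (\int[mu]_(w in E) (p * cos (U w) + q * sin (U w) + K)%:E)%E); last first.
  by apply: eq_integral => w _; congr EFin; ring.
rewrite -(fineK (integrable_fin_num mE h)).
rewrite -[fine _]/(\int[mu]_(w in E) (p * cos (U w) + q * sin (U w) + K)) RintegralD//; last 2 first.
- have := integrable_trig_combination mE fE p q 0 mU.
  by apply: eq_integrable => // w _ /=; rewrite addr0.
- by apply: (@bounded_integrable _ _ _ _ _ mE fE (fun=> K) `|K|).
rewrite -cf_combination// Rintegral_cst//; congr EFin; ring.
Qed.

(** The constant [K] brings trigonometric integrands into the range of the identities for
    nonnegative functions; its own contribution, a multiple of the mass, is removed afterwards. *)
Lemma trig_ge0 (K p q x : R) : `|p| + `|q| <= K -> 0 <= K + p * cos x + q * sin x.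
Proof.
move=> h; have h1 : `|p * cos x| <= `|p| by rewrite normrM ler_piMr// abs_cos_le1.
have h2 : `|q * sin x| <= `|q| by rewrite normrM ler_piMr// abs_sin_le1.
move: h1 h2; rewrite !ler_norml => /andP[? _] /andP[? _]; lra.
Qed.

Lemma measurable_trig (U : T -> R) (K p q : R) : measurable_fun setT U ->
  measurable_fun setT (fun w => K + p * cos (U w) + q * sin (U w)).
Proof.
move=> mU; apply: measurable_funD.
  apply: measurable_funD => //; apply: measurable_funM => //.
  by apply: measurableT_comp mU; apply: continuous_measurable_fun; exact: continuous_cos.
apply: measurable_funM => //.
by apply: measurableT_comp mU; apply: continuous_measurable_fun; exact: continuous_sin.
Qed.

End trig_integrals.

Section cf_split.
Context {R : realType} {d1 d2 : measure_display} {T : measurableType d1} {S : measurableType d2}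
  (mu : {measure set T -> \bar R}) (E : set T) (V : T -> S)
  (lam nu : {measure set S -> \bar R}) (g : S -> R) (U : S -> R).
Hypotheses (mE : measurable E) (fE : mu E \is a fin_num) (fnu : nu setT \is a fin_num)
  (mV : measurable_fun setT V) (mg : measurable_fun setT g) (g0 : forall x, 0 <= g x)
  (mU : measurable_fun setT U)
  (law : forall B, measurable B ->
    mu (E `&` V @^-1` B) = (\int[lam]_(y in B) (g y)%:E + nu B)%E).
Local Open Scope complex_scope.

Lemma law_mass : mu E = (\int[lam]_y (g y)%:E + nu setT)%E.
Proof. by rewrite -law// preimage_setT setIT. Qed.

Lemma density_fin_num : (\int[lam]_y (g y)%:E)%E \is a fin_num.
Proof.
rewrite ge0_fin_numE; last by apply: integral_ge0 => y _; rewrite lee_fin.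
apply: (@le_lt_trans _ _ (mu E)); first by rewrite law_mass leeDl.
by rewrite -ge0_fin_numE.
Qed.

Lemma density_integrable : lam.-integrable setT (EFin \o g).
Proof.
apply/integrableP; split; first exact/measurable_EFinP.
under eq_integral do rewrite /= ger0_norm//.
by rewrite -ge0_fin_numE ?density_fin_num//; apply: integral_ge0 => y _; rewrite lee_fin.
Qed.

Lemma density_trig_integrable (f : S -> R) : measurable_fun setT f -> (forall y, `|f y| <= 1) ->
  lam.-integrable setT (EFin \o (fun y => f y * g y)).
Proof.
move=> mf f1; apply: (@integrable_dominated _ _ _ lam _ g) => //.
- exact: measurable_funM.
- by move=> y; rewrite normrM (ger0_norm (g0 y)) ler_piMl.
- exact: density_integrable.
Qed.

(** The phase (p, q) is the one at which the modulus on the left is attained. Along it the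
    characteristic function is the sum of the contributions of the density and of the singular part,
    each at most the corresponding modulus. *)
Lemma normc_cf_split : normc (cf mu E (U \o V)) <=
  normc ((\int[lam]_y (cos (U y) * g y)) +i* (\int[lam]_y (sin (U y) * g y))) + fine (nu setT).
Proof.
have [p [q [pq e]]] := normc_attained (cf mu E (U \o V)).
set F := _ +i* _.
have mc : measurable_fun setT (fun y => cos (U y)).
  by apply: measurableT_comp mU; apply: continuous_measurable_fun; exact: continuous_cos.
have ms : measurable_fun setT (fun y => sin (U y)).
  by apply: measurableT_comp mU; apply: continuous_measurable_fun; exact: continuous_sin.
have ic := density_trig_integrable mc (fun y => abs_cos_le1 (U y)).
have isn := density_trig_integrable ms (fun y => abs_sin_le1 (U y)).
pose K := `|p| + `|q|.
pose h y := (K + p * cos (U y) + q * sin (U y))%:E.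
have hh : ge0_mfun h.
  split=> [|y]; last by rewrite lee_fin trig_ge0.
  by apply/measurable_EFinP; exact: measurable_trig.
have := ge0_integral_law mE mV mg g0 law hh.
have mUV : measurable_fun setT (U \o V) by exact: measurableT_comp.
rewrite (integral_trig mE fE K p q mUV) (integral_trig measurableT fnu K p q mU).
have -> : (\int[lam]_x ((g x)%:E * h x) =
  (K * fine (\int[lam]_y (g y)%:E) + p * complex.Re F + q * complex.Im F)%:E)%E.
  transitivity (\int[lam]_x ((K%:E * (g x)%:E + p%:E * (cos (U x) * g x)%:E) + q%:E * (sin (U x) * g x)%:E))%E.
    by apply: eq_integral => x _; rewrite /h -!EFinM -!EFinD; congr EFin; ring.
  have i1 := integrableZl measurableT K density_integrable.
  have i2 := integrableZl measurableT p ic.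
  have i3 := integrableZl measurableT q isn.
  have i12 := integrableD measurableT i1 i2.
  rewrite (integralD measurableT i12 i3) (integralD measurableT i1 i2).
  rewrite (integralZl measurableT density_integrable) (integralZl measurableT ic) (integralZl measurableT isn).
  rewrite -{1}(fineK density_fin_num) -(fineK (integrable_fin_num measurableT ic)) -(fineK (integrable_fin_num measurableT isn)).
  by rewrite -!EFinM -!EFinD.
rewrite law_mass fineD ?density_fin_num// -EFinD => -[] E0.
rewrite e; have h1 := normc_dual F pq.
have h2 := normc_cf_le measurableT fnu mU.
have h3 := normc_dual (cf nu setT U) pq.
have E1 : p * complex.Re (cf mu E (U \o V)) + q * complex.Im (cf mu E (U \o V)) =
    (p * complex.Re F + q * complex.Im F) +
    (p * complex.Re (cf nu setT U) + q * complex.Im (cf nu setT U)).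
  by apply: (addrI (K * (fine (\int[lam]_y (g y)%:E) + fine (nu setT)))); rewrite addrA E0 /F /cf /=; ring.
by rewrite E1 lerD// (le_trans h3).
Qed.

End cf_split.

Section complex_multiplication.
Context {R : realType}.

Lemma cReM (x y : R[i]) :
  complex.Re (x * y) = complex.Re x * complex.Re y - complex.Im x * complex.Im y.
Proof. by case: x y => a b [a' b']. Qed.

Lemma cImM (x y : R[i]) :
  complex.Im (x * y) = complex.Re x * complex.Im y + complex.Im x * complex.Re y.
Proof. by case: x y => a b [a' b'] /=; rewrite addrC. Qed.

Lemma cReB (x y : R[i]) : complex.Re (x - y) = complex.Re x - complex.Re y.
Proof. by case: x y => a b [a' b']. Qed.

Lemma cImB (x y : R[i]) : complex.Im (x - y) = complex.Im x - complex.Im y.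
Proof. by case: x y => a b [a' b']. Qed.

Lemma complexP (x y : R[i]) :
  complex.Re x = complex.Re y -> complex.Im x = complex.Im y -> x = y.
Proof. by case: x y => a b [a' b'] /= -> ->. Qed.

End complex_multiplication.

Section row_sum_bound.
Context {R : realType} {N : nat}.
Implicit Types (A B : 'M[R[i]]_N) (a b : R).

(** A bound on the operator norm for the sup norm on columns. Unlike [norm0] it is
    submultiplicative, and a characteristic matrix satisfies it with the bound 1. *)
Definition row_sums_le A a := forall k, \sum_l normc (A k l) <= a.

Lemma row_sums_leM A B a b : 0 <= b ->
  row_sums_le A a -> row_sums_le B b -> row_sums_le (A *m B) (a * b).
Proof.
move=> b0 hA hB k.
apply: (@le_trans _ _ (\sum_j normc (A k j) * b)); last by rewrite -mulr_suml ler_wpM2r.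
apply: (@le_trans _ _ (\sum_l \sum_j normc (A k j) * normc (B j l))).
  apply: ler_sum => l _; rewrite mxE (le_trans (normc_sum _ _ _))//.
  by apply: ler_sum => j _; rewrite normcM.
rewrite exchange_big/=; apply: ler_sum => j _.
by rewrite -mulr_sumr ler_wpM2l ?normc_ge0.
Qed.

Lemma row_sums_le_weaken A a b : a <= b -> row_sums_le A a -> row_sums_le A b.
Proof. by move=> ab h k; rewrite (le_trans (h k)). Qed.

End row_sum_bound.

Section characteristic_matrix.
Context {R : realType} (tk : time_kind) {n d : nat} {disp : measure_display}
  {Omega : measurableType disp} (P : 'I_n.+1 -> probability Omega R)
  (Xt : R -> Omega -> 'I_n.+1) (Zt : R -> Omega -> 'rV[R]_d)
  (Q : R -> R.-pker ('I_n.+1 * 'rV[R]_d)%type ~> ('I_n.+1 * 'rV[R]_d)%type)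
  (m : 'rV[R]_d).
Hypothesis MAP : markov_additive_process tk P Xt Zt Q.
Local Notation T := (time_set R tk).
Local Notation Yt := (fun (t : R) (w : Omega) => Zt t w - t *: m).
Local Notation state t l := [set w | Xt t w = l].

Definition charmx (t : R) (zeta : 'rV[R]_d) : 'M[R[i]]_n.+1 :=
  \matrix_(k, l) cf (P k) (state t l) (fun w => dot zeta (Yt t w)).

Lemma charmxE t zeta k l :
  charmx t zeta k l = cf (P k) (state t l) (fun w => dot zeta (Yt t w)).
Proof. by rewrite mxE. Qed.

Lemma measurable_centered t : T t -> measurable_fun setT (Yt t).
Proof.
move=> Tt; exact: (measurableT_comp (measurable_addr_rV (- (t *: m))) (measurable_additive MAP Tt)).
Qed.

Lemma measurable_dot_centered t zeta : T t -> measurable_fun setT (fun w => dot zeta (Yt t w)).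
Proof. by move=> Tt; exact: (measurableT_comp (measurable_dotr zeta) (measurable_centered Tt)). Qed.

Lemma state_event t l : T t -> measurable (state t l).
Proof. exact: (measurable_state_event MAP). Qed.

Lemma state_fin_num k t l : T t -> P k (state t l) \is a fin_num.
Proof. by move=> Tt; apply: fin_num_measure; exact: state_event. Qed.

Local Hint Resolve state_event state_fin_num : core.

Lemma ge0_integral_states t k (h : Omega -> \bar R) : T t -> ge0_mfun h ->
  (\int[P k]_w h w = \sum_l \int[P k]_(w in state t l) h w)%E.
Proof.
move=> Tt [mh h0].
have UT : [set: Omega] = \big[setU/set0]_(l < n.+1) state t l.
  apply/seteqP; split => // w _.
  rewrite -(@bigcup_mkord_ord _ _ (fun l : 'I_n.+1 => state t l)).
  by exists (val (Xt t w)); [exact: ltn_ord|rewrite /= inord_val].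
have mS (l : 'I_n.+1) : measurable (state t l) by exact: state_event.
have uI : uniq (index_enum 'I_n.+1) by rewrite /index_enum -enumT enum_uniq.
have tI : trivIset [set` index_enum 'I_n.+1] (fun l : 'I_n.+1 => state t l).
  by move=> i j _ _ [w [/= -> ->]].
have mh' := @measurable_funTS _ _ _ _ (\big[setU/set0]_(l < n.+1) state t l) _ mh.
by rewrite UT (ge0_integral_bigsetU (P k) mS uI tI mh' (fun z _ => h0 z)).
Qed.

Lemma sum_state_prob t k : T t -> \sum_l fine (P k (state t l)) = 1.
Proof.
move=> Tt.
have h1 : ge0_mfun (cst 1%E : Omega -> \bar R) by split=> //; exact: measurable_cst.
have := ge0_integral_states k Tt h1.
have -> : (\int[P k]_w cst 1%E w = 1)%E by rewrite integral_cst// mul1e; exact: probability_setT.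
have pl l : (\int[P k]_(w in state t l) cst 1%E w = P k (state t l))%E.
  by rewrite integral_cst ?mul1e//; exact: state_event.
under eq_bigr do rewrite pl.
by move=> /(congr1 fine) /= ->; rewrite sum_fine// => l _; exact: state_fin_num.
Qed.

Definition charcf t zeta k l : R[i] := cf (P k) (state t l) (fun w => dot zeta (Yt t w)).

(** The addition formulas split the phase at time s + t into a phase at time t, integrated first
    from the intermediate state j, and the phase at time s. The centering splits likewise, being
    linear in time. *)
Lemma markov_trig s t zeta k l (K p q : R) : T s -> T t -> `|p| + `|q| <= K ->
  K * fine (P k (state (s + t) l)) + p * complex.Re (charcf (s + t) zeta k l) +
    q * complex.Im (charcf (s + t) zeta k l) =
  \sum_j (K * fine (P j (state t l)) * fine (P k (state s j)) +
     (p * complex.Re (charcf t zeta j l) + q * complex.Im (charcf t zeta j l)) *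
        complex.Re (charcf s zeta k j) +
     (q * complex.Re (charcf t zeta j l) - p * complex.Im (charcf t zeta j l)) *
        complex.Im (charcf s zeta k j)).
Proof.
move=> Ts Tt pqK; have Tst := time_setD Ts Tt.
pose h (z : 'rV[R]_d) := (K + p * cos (dot zeta (z - (s + t) *: m)) +
  q * sin (dot zeta (z - (s + t) *: m)))%:E.
have hh : ge0_mfun h.
  split=> [|y]; last by rewrite lee_fin trig_ge0.
  apply/measurable_EFinP; apply: measurable_trig.
  exact: (measurableT_comp (measurable_dotr zeta) (measurable_addr_rV _)).
have := ge0_integral_markov MAP k l Ts Tt hh.
rewrite /h (integral_trig (state_event l Tst) (state_fin_num k l Tst) K p q (measurable_dot_centered zeta Tst)).
move=> E0; apply: (@EFin_inj R); rewrite -sumEFin.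
apply: (etrans E0); apply: eq_bigr => j _.
rewrite /charcf -(integral_trig (state_event j Ts) (state_fin_num k j Ts) _ _ _ (measurable_dot_centered zeta Ts)).
apply: eq_integral => w _.
set a := dot zeta (Yt s w).
transitivity (\int[P j]_(w' in state t l) (K + (p * cos a + q * sin a) * cos (dot zeta (Yt t w')) +
    (q * cos a - p * sin a) * sin (dot zeta (Yt t w')))%:E)%E.
  apply: eq_integral => w' _.
  have -> : Zt t w' + Zt s w - (s + t) *: m = Yt t w' + Yt s w.
    by rewrite scalerDl; apply/rowP => i; rewrite !mxE; ring.
  by rewrite dotDr -/a cosD sinD; congr EFin; ring.
rewrite (integral_trig (state_event l Tt) (state_fin_num j l Tt) _ _ _ (measurable_dot_centered zeta Tt)).
by congr EFin; rewrite /charcf; ring.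
Qed.

Lemma charmx_semigroup s t zeta : T s -> T t ->
  charmx (s + t) zeta = charmx s zeta *m charmx t zeta.
Proof.
move=> Ts Tt.
apply/matrixP => k l; rewrite [RHS]mxE [LHS]mxE.
under eq_bigr do rewrite !mxE.
rewrite -/(charcf (s + t) zeta k l); under eq_bigr do rewrite -/(charcf t zeta _ l) -/(charcf s zeta k _).
(* The triples (1, 0, 0), (1, 1, 0) and (1, 0, 1) give the mass, the mass plus the real part and the
   mass plus the imaginary part. *)
have key K p q := @markov_trig s t zeta k l K p q Ts Tt.
have K0 := key 1 0 0; rewrite normr0 addr0 ler01 in K0; have {}K0 := K0 isT.
have K1 := key 1 1 0; rewrite normr0 addr0 normr1 lexx in K1; have {}K1 := K1 isT.
have K2 := key 1 0 1; rewrite normr0 add0r normr1 lexx in K2; have {}K2 := K2 isT.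
have E0 : fine (P k (state (s + t) l)) = \sum_j fine (P j (state t l)) * fine (P k (state s j)).
  rewrite [LHS](_ : _ = 1 * fine (P k (state (s + t) l)) +
     0 * complex.Re (charcf (s + t) zeta k l) + 0 * complex.Im (charcf (s + t) zeta k l)); last by ring.
  by rewrite K0; apply: eq_bigr => j _; ring.
apply: complexP; rewrite ?Re_sum ?Im_sum.
    apply: (addrI (fine (P k (state (s + t) l)))).
    rewrite [LHS](_ : _ = 1 * fine (P k (state (s + t) l)) +
      1 * complex.Re (charcf (s + t) zeta k l) + 0 * complex.Im (charcf (s + t) zeta k l)); last by ring.
    rewrite K1 E0 -big_split; apply: eq_bigr => j _ /=.
    by rewrite ?cReM ?cImM; ring.
  apply: (addrI (fine (P k (state (s + t) l)))).
  rewrite [LHS](_ : _ = 1 * fine (P k (state (s + t) l)) +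
     0 * complex.Re (charcf (s + t) zeta k l) + 1 * complex.Im (charcf (s + t) zeta k l)); last by ring.
  rewrite K2 E0 -big_split; apply: eq_bigr => j _ /=.
  by rewrite ?cReM ?cImM; ring.
Qed.

Lemma charmx_row_sums t zeta : T t -> row_sums_le (charmx t zeta) 1.
Proof.
move=> Tt k; rewrite -(sum_state_prob k Tt); apply: ler_sum => l _; rewrite mxE.
exact: (normc_cf_le (state_event l Tt) (state_fin_num k l Tt) (measurable_dot_centered zeta Tt)).
Qed.

Lemma charmx_doubling t zeta k : T t ->
  1 - \sum_l normc (charmx t (2 *: zeta) k l) <= 4 * (1 - \sum_l normc (charmx t zeta k l)).
Proof.
move=> Tt; have s1 := sum_state_prob k Tt.
rewrite -[X in X - _ <= _]s1 -[X in _ <= 4 * (X - _)]s1 -!sumrB mulr_sumr.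
apply: ler_sum => l _; rewrite !charmxE.
apply: le_trans (cf_doubling (state_event l Tt) (state_fin_num k l Tt) (measurable_dot_centered zeta Tt)).
rewrite lerD2l lerN2 le_eqVlt; apply/orP; left; apply/eqP.
by congr (normc (cf _ _ _)); apply/funext => w; rewrite dotZl.
Qed.

End characteristic_matrix.

Section norm0_bounds.
Context {R : realType} {n : nat}.

Lemma normc_le_norm0 (A : 'M[R[i]]_n) k l : normc (A k l) <= norm0 A.
Proof.
apply: (@le_trans _ _ (\big[Num.max/0]_l0 normc (A k l0))).
  exact: (le_bigmax 0 (fun l0 => normc (A k l0)) l).
exact: (le_bigmax 0 (fun k0 => \big[Num.max/0]_l0 normc (A k0 l0)) k).
Qed.

Lemma entry_le_norm0 (A : 'M[R]_n) k l : `|A k l| <= norm0 (complex_mx A).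
Proof.
by rewrite -normc_real; have := normc_le_norm0 (complex_mx A) k l; rewrite mxE.
Qed.

End norm0_bounds.

Section time_arithmetic.
Context {R : realType} (tk : time_kind).
Local Notation T := (time_set R tk).

Lemma time_setB s t : T s -> T t -> s <= t -> T (t - s).
Proof.
case: tk => /= [[i _ <-] [j _ <-]|_ _]; last by rewrite subr_ge0.
by rewrite ler_nat => ij; exists (j - i)%N; rewrite // natrB.
Qed.

Lemma time_setMn j t : T t -> T (j%:R * t).
Proof.
move=> Tt; elim: j => [|j IH]; first by rewrite mul0r; exact: time_set0.
by rewrite -natr1 mulrDl mul1r; apply: time_setD.
Qed.

End time_arithmetic.

(** Doubling [zeta] until it leaves the ball of radius [A]: at the first such exponent m, 4^m
    |zeta|^2 <= 4 A^2, while 1/2 <= a (2^m zeta) <= 4^m a (zeta). Hence the constant 8 A^2. *)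
Lemma quadrupling_bound (R : realType) (d : nat) (a : 'rV[R]_d -> R) (A : R) :
  1 <= A -> (forall zeta, 0 <= a zeta) ->
  (forall zeta, a (2 *: zeta) <= 4 * a zeta) ->
  (forall zeta, A < euclidean_norm zeta -> 2^-1 <= a zeta) ->
  forall zeta, (8 * A ^+ 2)^-1 * Num.min 1 (dot zeta zeta) <= a zeta.
Proof.
move=> A1 a0 aq aA zeta.
have A2 : 1 <= A ^+ 2 by rewrite exprn_ege1.
have AV : 0 < (8 * A ^+ 2)^-1 by rewrite invr_gt0; lra.
have AVE : (8 * A ^+ 2)^-1 * (8 * A ^+ 2) = 1 by rewrite mulVf// gt_eqF// -invr_gt0.
have [zA|zA] := ltP A (euclidean_norm zeta).
  apply: le_trans (aA _ zA); apply: (@le_trans _ _ ((8 * A ^+ 2)^-1 * 1)).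
    by apply: ler_wpM2l; [exact: ltW|rewrite ge_min lexx].
  by rewrite mulr1; nra.
have [->|z0] := eqVneq zeta 0.
  rewrite (_ : dot 0 0 = 0) ?(min_idPr ler01) ?mulr0//.
  by rewrite -(scale0r 0) dotZl mul0r.
have e0 : 0 < euclidean_norm zeta.
  by rewrite sqrtr_gt0 lt_neqAle eq_sym dot_eq0 z0 dot_ge0.
have iter m : a (2 ^+ m *: zeta) <= 4 ^+ m * a zeta.
  elim: m => [|m IH]; first by rewrite !expr0 scale1r mul1r.
  by rewrite !exprS -scalerA (le_trans (aq _))// -mulrA ler_wpM2l.
have ex : exists m : nat, A < 2 ^+ m * euclidean_norm zeta.
  have [m mh] : exists m : nat, A / euclidean_norm zeta < m%:R.
    by exists (Num.truncn (A / euclidean_norm zeta)).+1; exact: truncnS_gt.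
  exists m; rewrite -ltr_pdivrMr// (lt_le_trans mh)//.
  by rewrite -natrX ler_nat ltnW// ltn_expl.
case: (ex_minnP ex) => m mA mmin.
have m0 : (0 < m)%N.
  by case: m mA {mmin} => //; rewrite expr0 mul1r ltNge zA.
have m1 : 2 ^+ m.-1 * euclidean_norm zeta <= A.
  rewrite leNgt; apply/negP => h; have := mmin _ h.
  by rewrite -{1}(prednK m0) ltnn.
have am : 2^-1 <= 4 ^+ m * a zeta.
  apply: le_trans (iter m); apply: aA.
  by rewrite euclidean_normZ ger0_norm ?exprn_ge0.
have r4 : 4 ^+ m * dot zeta zeta <= 4 * A ^+ 2.
  rewrite -{1}(prednK m0) exprS -mulrA ler_wpM2l//.
  rewrite -sqr_euclidean_norm (_ : 4 = 2 ^+ 2 :> R); last by rewrite -natrX.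
  by rewrite exprAC -exprMn lerXn2r ?nnegrE ?mulr_ge0 ?exprn_ge0 ?(ltW e0)// (le_trans ler01).
have rm : Num.min 1 (dot zeta zeta) <= dot zeta zeta by rewrite ge_min lexx orbT.
apply: (@le_trans _ _ ((8 * A ^+ 2)^-1 * dot zeta zeta)).
  by apply: ler_wpM2l => //; exact: ltW.
have p4 : 0 < 4 ^+ m :> R by rewrite exprn_gt0.
rewrite -(ler_pM2l p4).
apply: le_trans am.
rewrite mulrCA; apply: (@le_trans _ _ ((8 * A ^+ 2)^-1 * (4 * A ^+ 2))).
  by apply: ler_wpM2l => //; exact: ltW.
by rewrite (_ : (8 * A ^+ 2)^-1 * (4 * A ^+ 2) = ((8 * A ^+ 2)^-1 * (8 * A ^+ 2)) / 2) ?AVE ?mul1r//; field; rewrite gt_eqF//; lra.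
Qed.

Section contraction.
Context {R : realType} (tk : time_kind) {n d : nat} {disp : measure_display}
  {Omega : measurableType disp} (P : 'I_n.+1 -> probability Omega R)
  (Xt : R -> Omega -> 'I_n.+1) (Zt : R -> Omega -> 'rV[R]_d)
  (Q : R -> R.-pker ('I_n.+1 * 'rV[R]_d)%type ~> ('I_n.+1 * 'rV[R]_d)%type)
  (m : 'rV[R]_d)
  (G : R -> 'rV[R]_d -> 'M[R]_n.+1)
  (mu : R -> 'I_n.+1 -> 'I_n.+1 -> {finite_measure set 'rV[R]_d -> \bar R}).
Hypothesis MAP : markov_additive_process tk P Xt Zt Q.
Local Notation T := (time_set R tk).
Local Notation Yt := (fun (t : R) (w : Omega) => Zt t w - t *: m).
Local Notation state t l := [set w | Xt t w = l].
Hypothesis dec : lebesgue_decomposition tk G mu P Xt Yt.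
Local Notation charmx := (charmx P Xt Zt m).

Lemma fourierE t zeta k l : fourier G t zeta k l =
  ((\int[lebesgue_rV d]_y (cos (dot zeta y) * G t y k l)) +i*
   (\int[lebesgue_rV d]_y (sin (dot zeta y) * G t y k l)))%C.
Proof.
by rewrite mxE /complex_integral; congr (_ +i* _)%C; apply: eq_Rintegral => y _;
  rewrite ?cReM ?cImM /= mulr0 ?subr0 ?add0r ?addr0.
Qed.

Lemma normc_charmx_le_fourier t zeta k l : T t ->
  normc (charmx t zeta k l) <= normc (fourier G t zeta k l) + fine (mu t k l setT).
Proof.
move=> Tt; have [mg g0 _ law] := dec k l Tt.
rewrite charmxE fourierE.
apply: (@normc_cf_split _ _ _ _ _ (P k) (state t l) (Yt t) (lebesgue_rV d) (mu t k l)
  (fun y => G t y k l) (dot zeta)) => //.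
- exact: (state_event MAP).
- exact: (state_fin_num MAP).
- exact: (fin_num_measure (mu t k l)).
- exact: (measurable_centered m MAP).
- exact: measurable_dotr.
Qed.

Hypothesis AC1 : condition_AC1 tk G mu.

(** Everything happens at the single time [t0] of (AC1). The deficit 1 - (row sum) is at least 1/2
    at high frequencies and at most quadruples when the frequency doubles, so it is at least
    [x zeta] everywhere; then 1 - x <= e^(-x), and multiples of [t0] follow by the semigroup
    property. *)
Lemma charmx_decay : exists C c : R, [/\ 0 < C, 0 < c &
  forall t zeta, T t -> row_sums_le (charmx t zeta)
    (C * expR (- (c * t * Num.min 1 (dot zeta zeta))))].
Proof.
have [c [rho [c0 rho01 Mc [t0 [Tt0 t00 rt GA]]]]] := AC1.
pose N : R := n.+1%:R.
have N0 : 0 < N by rewrite ltr0n.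
(* With this threshold the density parts of a row add up to at most 1/4; (AC1) bounds the singular
   parts of the row by another 1/4. *)
have [A0 hA0] := GA (4 * N)^-1 ltac:(by rewrite invr_gt0 mulr_gt0).
pose A := Num.max 1 A0.
have A1 : 1 <= A by rewrite le_max lexx.
have large zeta k : A < euclidean_norm zeta -> 2^-1 <= 1 - \sum_l normc (charmx t0 zeta k l).
  move=> zA; have {}zA : A0 < euclidean_norm zeta by rewrite (le_lt_trans _ zA)// le_max lexx orbT.
  have gz := hA0 _ zA.
  have hF l : normc (fourier G t0 zeta k l) <= (4 * N)^-1.
    apply: le_trans (normc_le_norm0 _ _ _) _; rewrite -lee_fin; apply: le_trans gz.
    apply: ereal_sup_ubound; exists t0 => //; split=> //=.
    by rewrite lexx /= ltr_pMl// ltr1n.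
  have hM l : fine (mu t0 k l setT) <= c * rho `^ t0.
    have := entry_le_norm0 (singular_mass mu t0) k l; rewrite mxE => h.
    by rewrite (le_trans (ler_norm _))// (le_trans h)// Mc.
  have : \sum_l normc (charmx t0 zeta k l) <= \sum_(l < n.+1) ((4 * N)^-1 + c * rho `^ t0).
    apply: ler_sum => l _; apply: (le_trans (normc_charmx_le_fourier zeta k l Tt0)).
    by rewrite lerD.
  rewrite sumr_const card_ord -[X in _ <= X]mulr_natl -/N mulrDr.
  have -> : N * (4 * N)^-1 = 4^-1 by field; rewrite gt_eqF.
  have : rho `^ t0 * (c * N) <= 4^-1.
    by apply: le_trans rt; rewrite ler_wpM2l ?powR_ge0// le_max lexx orbT.
  lra.
pose c1 : R := (8 * A ^+ 2)^-1.
have c10 : 0 < c1 by rewrite invr_gt0 mulr_gt0// exprn_gt0// (lt_le_trans ltr01).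
pose x (zeta : 'rV[R]_d) : R := c1 * Num.min 1 (dot zeta zeta).
have min0 (zeta : 'rV[R]_d) : 0 <= Num.min 1 (dot zeta zeta) :> R by rewrite le_min ler01 dot_ge0.
have x0 zeta : 0 <= x zeta by rewrite mulr_ge0// ltW.
have xc zeta : x zeta <= c1 by rewrite -[leRHS]mulr1; apply: ler_wpM2l; [exact: ltW|rewrite ge_min lexx].
have step zeta : row_sums_le (charmx t0 zeta) (expR (- x zeta)).
  move=> k; apply: (@le_trans _ _ (1 - x zeta)); last first.
    by have := expR_ge1Dx (- x zeta).
  suff : x zeta <= 1 - \sum_l normc (charmx t0 zeta k l) by lra.
  apply: (@quadrupling_bound _ _ (fun zeta => 1 - \sum_l normc (charmx t0 zeta k l)) A) => //.
  - by move=> z; rewrite subr_ge0; exact: (charmx_row_sums m MAP).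
  - by move=> z; exact: (charmx_doubling m MAP).
  - by move=> z; exact: large.
have pow zeta j : row_sums_le (charmx (j%:R * t0) zeta) (expR (- x zeta) ^+ j).
  elim: j => [|j IH].
    by rewrite mul0r expr0; apply: (charmx_row_sums m MAP); exact: time_set0.
  rewrite -natr1 mulrDl mul1r (charmx_semigroup m MAP)//; last exact: time_setMn.
  by rewrite exprSr; apply: row_sums_leM => //; exact: expR_ge0.
(* The factor [expR c1] pays for rounding t / t0 down to an integer, as [x zeta] never exceeds
   [c1]. *)
exists (expR c1), (c1 / t0); split; [exact: expR_gt0|exact: divr_gt0|].
move=> t zeta Tt; have t_ge0 := time_set_ge0 Tt.
pose j := Num.truncn (t / t0).
have q0 : 0 <= t / t0 by rewrite divr_ge0// ltW.
have /andP[j1 j2] := truncn_itv q0.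
have jt : j%:R * t0 <= t by rewrite -ler_pdivlMr.
have Tj : T (j%:R * t0) by exact: time_setMn.
have Ts := time_setB Tj Tt jt.
rewrite -[t in charmx t _](subrKC (j%:R * t0)) (charmx_semigroup m MAP)//.
apply: row_sums_le_weaken (row_sums_leM ler01 (pow zeta j) (charmx_row_sums m MAP zeta Ts)).
rewrite mulr1 -expRM_natl -expRD ler_expR.
rewrite (_ : c1 / t0 * t * Num.min 1 (dot zeta zeta) = x zeta * (t / t0)); last first.
  by rewrite /x; field; rewrite gt_eqF.
have := x0 zeta; have := xc zeta; set X := x zeta => Xc X0.
have : X * (t / t0) <= X * j.+1%:R by apply: ler_wpM2l => //; exact: ltW.
rewrite -natr1; lra.
Qed.

End contraction.

(** * Expansion of the leading eigenvalue *)

Section exp_bounds.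
Context {R : realType}.

Lemma expR_subr1_le (x : R) : `|expR x - 1| <= expR `|x| * `|x|.
Proof.
apply: (@MVT_bound0 _ (fun x => expR x - 1) expR); rewrite ?expR0 ?subrr//.
- by move=> v; apply: is_derive_eq; rewrite subr0.
- by move=> v vx; rewrite ger0_norm ?expR_ge0// ler_expR (le_trans (ler_norm _)).
Qed.

Lemma expR_taylor1_le (x : R) : `|expR x - 1 - x| <= expR `|x| * x ^+ 2.
Proof.
rewrite -(real_normK (num_real x)) expr2 mulrA.
apply: (@MVT_bound0 _ (fun x => expR x - 1 - x) (fun x => expR x - 1)).
- by move=> v; apply: is_derive_eq; rewrite subr0.
- by rewrite expR0 subr0 subrr.
- move=> v vx; apply: (le_trans (expR_subr1_le v)).
  by apply: ler_pM; rewrite ?expR_ge0// ler_expR.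
Qed.

End exp_bounds.

(** * Poisson equation of a finite irreducible chain *)

Section poisson_equation.
Context {R : realType} {n : nat} (P : 'M[R]_n.+1) (p : 'rV[R]_n.+1).
Hypotheses (P0 : forall k l, 0 <= P k l) (P1 : forall k, \sum_l P k l = 1)
  (irr : irreducible_mx P) (p1 : \sum_k p 0 k = 1) (pP : p *m P = p).

Lemma stochastic_power m : (forall k l, 0 <= (P ^+ m) k l) /\
  forall k, \sum_l (P ^+ m) k l = 1.
Proof.
elim: m => [|m [IH0 IH1]].
  split=> [k l|k]; first by rewrite expr0 mxE ler0n.
  rewrite (bigD1 k)//= big1 ?addr0; first by rewrite expr0 mxE eqxx.
  by move=> l lk; rewrite expr0 mxE eq_sym (negbTE lk).
split=> [k l|k].
  by rewrite exprS mxE sumr_ge0// => j _; rewrite mulr_ge0.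
under eq_bigr do rewrite exprS mxE.
rewrite exchange_big/= -[RHS](P1 k); apply: eq_bigr => j _.
by rewrite -mulr_sumr IH1 mulr1.
Qed.

(* Maximum principle: a maximum of a harmonic function spreads along the
   powers of P. *)
Lemma harmonic_const (x : 'cV[R]_n.+1) : P *m x = x -> forall k l, x k 0 = x l 0.
Proof.
move=> Px.
have Pm m : (P ^+ m) *m x = x.
  by elim: m => [|m IH]; rewrite ?expr0 ?mul1mx// exprSr -mulmxA Px.
pose k0 := [arg max_(k > ord0) x k 0]%O.
have k0P k : x k 0 <= x k0 0.
  by rewrite /k0; case: (@arg_maxP _ _ _ ord0 xpredT (fun k => x k 0)) => // i _; apply.
suff h l : x l 0 = x k0 0 by move=> k l; rewrite !h.
have [m mp] := irr k0 l.
have [m0 m1] := stochastic_power m.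
have /matrixP/(_ k0 0) := Pm m; rewrite mxE => e.
have z : \sum_j (P ^+ m) k0 j * (x k0 0 - x j 0) = 0.
  under eq_bigr do rewrite mulrBr.
  by rewrite sumrB -mulr_suml m1 mul1r e subrr.
have /eqP := z; rewrite psumr_eq0; last first.
  by move=> j _; rewrite mulr_ge0// subr_ge0.
move=> /allP /(_ l); rewrite mem_index_enum => /(_ isT).
by rewrite mulf_eq0 gt_eqF//= subr_eq0 => /eqP ->.
Qed.

(** [H] is the inverse of B = 1 - P + e p, the fundamental matrix of the chain, where e is the
    column of ones. As p B = p, a column killed by B has mean 0 and is harmonic, hence constant,
    hence zero. For the same reason H f has mean 0 when f has, and the rank-one term disappears from
    B (H f) = f. *)
Lemma poisson_equation : exists H : 'M[R]_n.+1,
  forall f : 'cV[R]_n.+1, p *m f = 0 -> H *m f = P *m (H *m f) + f.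
Proof.
pose e : 'cV[R]_n.+1 := const_mx 1.
have pe : p *m e = 1%:M.
  apply/matrixP => i j; rewrite !mxE !ord1 eqxx -[RHS]p1.
  by apply: eq_bigr => k _; rewrite mxE mulr1.
pose B := 1%:M - P + e *m p.
have pB : p *m B = p.
  by rewrite mulmxDr mulmxBr mulmx1 pP subrr add0r mulmxA pe mul1mx.
have uB : B \in unitmx.
  (* Invertibility is read off the left kernel of the transpose, that is, off the columns killed by
     [B]. *)
  rewrite -unitmx_tr -row_free_unit -kermx_eq0; apply/eqP/row_matrixP => i.
  rewrite row0; set y := row i _.
  have yB : y *m B^T = 0 by rewrite /y -row_mul mulmx_ker row0.
  have Bx : B *m y^T = 0 by apply: trmx_inj; rewrite trmx_mul trmxK trmx0.
  have px : p *m y^T = 0 by rewrite -pB -mulmxA Bx mulmx0.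
  have Pxx : P *m y^T = y^T.
    move: Bx; rewrite mulmxDl mulmxBl mul1mx -mulmxA px mulmx0 addr0.
    by move/eqP; rewrite subr_eq0 => /eqP.
  apply/rowP => j; rewrite [RHS]mxE.
  have := px; move=> /matrixP/(_ 0 0); rewrite mxE [RHS]mxE.
  have hc := harmonic_const Pxx.
  under eq_bigr do rewrite (hc _ j).
  by rewrite -mulr_suml p1 mul1r => yj; rewrite -[RHS]yj [RHS]mxE.
exists (invmx B) => f pf.
have BH : B *m (invmx B *m f) = f by rewrite mulKVmx.
have pH : p *m (invmx B *m f) = 0 by rewrite -{1}pB -mulmxA BH.
move: BH; rewrite {1}/B mulmxDl mulmxBl mul1mx -mulmxA pH mulmx0 addr0.
by move=> h; apply/eqP; rewrite addrC -subr_eq h.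
Qed.

End poisson_equation.

Section approximate_eigenvector.
Context {R : realType} {n : nat} (P : 'M[R]_n.+1) (p : 'rV[R]_n.+1) (H : 'M[R]_n.+1).
Hypotheses (P1 : forall k, \sum_l P k l = 1) (p0 : forall k, 0 <= p 0 k)
  (p1 : \sum_k p 0 k = 1)
  (HP : forall f : 'cV[R]_n.+1, p *m f = 0 -> H *m f = P *m (H *m f) + f).
Implicit Types (M S : 'M[R]_n.+1).

(** [M] and [S] stand for the first and second moment matrices, so that Phi is P + iM - S/2 up to
    third order. For an eigenvector 1 + i a - b and an eigenvalue 1 - q, the first-order terms match
    when a = P a + M 1, and those of second order when b + q = P b + S 1 / 2 + M a. Here a is
    [corrector1] and b is [corrector2]. *)
Definition corrector1 M : 'cV[R]_n.+1 := H *m (M *m const_mx 1).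

Definition second_order M S : 'cV[R]_n.+1 :=
  2^-1 *: (S *m const_mx 1) + M *m corrector1 M.

(** The number that gives the right-hand side of the second Poisson equation mean 0, and so makes
    that equation solvable. *)
Definition eigen_exponent M S : R := (p *m second_order M S) 0 0.

Definition corrector2 M S : 'cV[R]_n.+1 :=
  H *m (second_order M S - const_mx (eigen_exponent M S)).

Definition eigenvector M S : 'cV[R[i]]_n.+1 :=
  \col_k ((1 - corrector2 M S k 0) +i* corrector1 M k 0)%C.

Lemma eigenvectorE M S k :
  eigenvector M S k 0 = ((1 - corrector2 M S k 0) +i* corrector1 M k 0)%C.
Proof. by rewrite mxE. Qed.

Lemma abs_mulmx_le m1 (A : 'M[R]_(m1, n.+1)) (f : 'cV[R]_n.+1) (x y : R) k :
  (forall l, `|A k l| <= x) -> (forall l, `|f l 0| <= y) ->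
  `|(A *m f) k 0| <= n.+1%:R * x * y.
Proof.
move=> Ax fy; rewrite mxE (le_trans (ler_norm_sum _ _ _))//.
apply: (@le_trans _ _ (\sum_(l < n.+1) x * y)); last by rewrite sumr_const card_ord -[X in X <= _]mulr_natl mulrA.
by apply: ler_sum => l _; rewrite normrM ler_pM.
Qed.

Lemma abs_mean_le (f : 'cV[R]_n.+1) (y : R) :
  (forall l, `|f l 0| <= y) -> `|(p *m f) 0 0| <= y.
Proof.
move=> fy; rewrite mxE (le_trans (ler_norm_sum _ _ _))//.
rewrite -[leRHS]mul1r -p1 mulr_suml; apply: ler_sum => l _.
by rewrite normrM (ger0_norm (p0 l)) ler_wpM2l.
Qed.

Lemma mean_const (x : R) : p *m const_mx x = x%:M.
Proof.
apply/matrixP => i j; rewrite !mxE !ord1 eqxx mulr1n -[RHS]mul1r -p1 mulr_suml.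
by apply: eq_bigr => k _; rewrite mxE.
Qed.

Lemma corrector1E M k : p *m (M *m const_mx 1) = 0 :> 'cV[R]_1 ->
  corrector1 M k 0 = \sum_l (P k l * corrector1 M l 0 + M k l).
Proof.
move=> pM; have /matrixP/(_ k 0) := HP pM; rewrite -/(corrector1 M) mxE => {1}->.
rewrite big_split/= !mxE; congr (_ + _).
by apply: eq_bigr => l _; rewrite mxE mulr1.
Qed.

Lemma second_orderE M S k :
  second_order M S k 0 = \sum_l S k l / 2 + \sum_l M k l * corrector1 M l 0.
Proof.
rewrite mxE; congr (_ + _); last by rewrite mxE.
by rewrite !mxE mulr_sumr; apply: eq_bigr => l _; rewrite mxE; field.
Qed.

Lemma corrector2E M S k :
  corrector2 M S k 0 = \sum_l (P k l * corrector2 M S l 0 + (S k l / 2 + M k l * corrector1 M l 0))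
     - eigen_exponent M S.
Proof.
have pf : p *m (second_order M S - const_mx (eigen_exponent M S)) = 0.
  rewrite mulmxBr mean_const; apply/eqP; rewrite subr_eq0; apply/eqP/matrixP => i j.
  by rewrite !ord1 [RHS]mxE eqxx mulr1n.
have /matrixP/(_ k 0) := HP pf; rewrite -/(corrector2 M S) => {1}->.
rewrite mxE [X in X + _]mxE [X in _ + X]mxE second_orderE mxE [const_mx _ _ _]mxE.
by rewrite !big_split/= !addrA.
Qed.

(** The orders 0, 1 and 2 in [rho] cancel by the two Poisson equations; the remaining products have
    order at least 3. The constant [K'] precedes [M], [S] and [Phi], so it is the same for all
    frequencies. *)
Lemma eigenvector_bounds (K : R) : 0 <= K -> exists2 K', 0 <= K' &
  forall M S (Phi : 'M[R[i]]_n.+1) (rho : R), 0 <= rho <= 1 ->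
  (forall k l, `|M k l| <= K * rho) -> (forall k l, `|S k l| <= K * rho ^+ 2) ->
  (forall k l, normc (Phi k l - ((P k l - S k l / 2) +i* M k l)%C) <= K * rho ^+ 3) ->
  p *m (M *m const_mx 1) = 0 :> 'cV[R]_1 ->
  [/\ `|eigen_exponent M S| <= K' * rho ^+ 2,
      forall k, normc (eigenvector M S k 0 - 1) <= K' * rho &
      forall k, normc ((Phi *m eigenvector M S) k 0 -
        ((1 - eigen_exponent M S)%:C)%C * eigenvector M S k 0) <= K' * rho ^+ 3].
Proof.
move=> K0.
pose N : R := n.+1%:R.
pose h := \sum_k \sum_l `|H k l|.
have h0 : 0 <= h by apply: sumr_ge0 => k _; apply: sumr_ge0.
have Hh k l : `|H k l| <= h.
  rewrite /h (bigD1 k)//= (bigD1 l)//= -addrA lerDl addr_ge0//; first exact: sumr_ge0.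
  by apply: sumr_ge0 => i _; apply: sumr_ge0.
have N0 : 0 <= N by rewrite ler0n.
(* [A], [F], [B] bound [corrector1], [second_order], [corrector2] in units of rho, rho^2 and rho^2;
   [V] bounds the eigenvector. *)
pose A := N * h * (N * K).
pose F := N * K / 2 + N * K * A.
pose B := N * h * (2 * F).
have A0 : 0 <= A by rewrite !mulr_ge0.
have F0 : 0 <= F by rewrite addr_ge0 ?divr_ge0 ?mulr_ge0.
have B0 : 0 <= B by rewrite !mulr_ge0.
have NK0 : 0 <= N * K by rewrite mulr_ge0.
pose V := 1 + A + B.
exists (V + F + (N * K * V + (N * K * B + F * B) + (N * K * A + N * K * B + F * A))).
  by rewrite /V !addr_ge0// ?mulr_ge0 // ?addr_ge0.
move=> M S Phi rho /andP[r0 r1] hM hS hPhi pM.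
set a := corrector1 M; set b := corrector2 M S; set q := eigen_exponent M S.
have r2 : 0 <= rho ^+ 2 by rewrite exprn_ge0.
have r3 : 0 <= rho ^+ 3 by rewrite exprn_ge0.
have r12 : rho ^+ 2 <= rho by rewrite expr2 ler_piMr.
have r23 : rho ^+ 3 <= rho ^+ 2 by rewrite exprS ler_piMl.
have ba k : `|a k 0| <= A * rho.
  have -> : A * rho = n.+1%:R * h * (N * (K * rho)) by rewrite /A /N; ring.
  apply: abs_mulmx_le => // l.
  have := @abs_mulmx_le _ M (const_mx 1 : 'cV[R]_n.+1) (K * rho) 1 l (hM l); rewrite mulr1 -/N; apply.
  by move=> j; rewrite mxE normr1.
have bf k : `|second_order M S k 0| <= F * rho ^+ 2.
  rewrite mxE (le_trans (ler_normD _ _))// /F mulrDl lerD//.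
    rewrite mxE normrM ger0_norm// mulrC (_ : N * K / 2 * rho ^+ 2 = N * (K * rho ^+ 2) / 2); last by ring.
    rewrite ler_wpM2r//.
    have := @abs_mulmx_le _ S (const_mx 1 : 'cV[R]_n.+1) (K * rho ^+ 2) 1 k (hS k); rewrite mulr1 -/N; apply.
    by move=> j; rewrite mxE normr1.
  rewrite (_ : N * K * A * rho ^+ 2 = n.+1%:R * (K * rho) * (A * rho)); last by rewrite /N; ring.
  exact: abs_mulmx_le.
have bq : `|q| <= F * rho ^+ 2 by apply: abs_mean_le.
have bb k : `|b k 0| <= B * rho ^+ 2.
  have -> : B * rho ^+ 2 = n.+1%:R * h * (2 * (F * rho ^+ 2)) by rewrite /B /N; ring.
  apply: abs_mulmx_le => // l; rewrite !mxE (le_trans (ler_normB _ _))//.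
  have := bf l; rewrite !mxE => bfl.
  by rewrite (_ : 2 * (F * rho ^+ 2) = F * rho ^+ 2 + F * rho ^+ 2); [exact: lerD|ring].
have bv1 k : normc (eigenvector M S k 0 - 1) <= (A + B) * rho.
  rewrite (le_trans (normc_le_Re_Im _))// mxE /= -/a -/b subr0 addrAC subrr add0r normrN.
  rewrite addrC mulrDl lerD//; apply: (le_trans (bb k)).
  by rewrite ler_wpM2l.
have bv k : normc (eigenvector M S k 0) <= V.
  rewrite -[eigenvector M S k 0](subrK 1) (le_trans (normcD_le _ _))// normc1 /V.
  have h1 := bv1 k; have h2 : (A + B) * rho <= A + B by rewrite ler_piMr// addr_ge0.
  lra.
set R3 := N * K * V + _ + _.
have V0 : 0 <= V by rewrite /V; lra.
have R30 : 0 <= R3.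
  by rewrite /R3; do !apply: addr_ge0; apply: mulr_ge0.
split.
- by apply: (le_trans bq); rewrite ler_wpM2r//; rewrite /V; lra.
- by move=> k; apply: (le_trans (bv1 k)); rewrite ler_wpM2r//; rewrite /V; lra.
- move=> k; apply: (@le_trans _ _ (R3 * rho ^+ 3)); last by rewrite ler_wpM2r//; rewrite /V; lra.
(* The truncated expansion of row k of [Phi]; what it omits has third order and is applied to a
   bounded vector. *)
pose L l : R[i] := ((P k l - S k l / 2) +i* M k l)%C.
have -> : (Phi *m eigenvector M S) k 0 - ((1 - q)%:C)%C * eigenvector M S k 0 =
   \sum_l (Phi k l - L l) * eigenvector M S l 0 +
   (\sum_l L l * eigenvector M S l 0 - ((1 - q)%:C)%C * eigenvector M S k 0).
  by rewrite addrA -big_split/= mxE; congr (_ - _); apply: eq_bigr => l _; rewrite mulrBl subrK.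
(* The Poisson equation of [corrector2] has removed all terms of order at most 2 from the real part;
   below, that of [corrector1] does so for the imaginary part. *)
have ReE : complex.Re (\sum_l L l * eigenvector M S l 0 - ((1 - q)%:C)%C * eigenvector M S k 0) =
   2^-1 * (\sum_l S k l * b l 0) - q * b k 0.
  rewrite cReB Re_sum.
  rewrite (eq_bigr (fun l => P k l - (P k l * b l 0 + (S k l / 2 + M k l * a l 0)) +
    2^-1 * (S k l * b l 0))); last by move=> l _; rewrite cReM eigenvectorE /= -/a -/b; field.
  rewrite big_split sumrB P1 /= cReM eigenvectorE /= -/a -/b mul0r subr0 mulr_sumr.
  have := corrector2E M S k; rewrite -/b -/a -/q => e.
  have -> : \sum_l (P k l * b l 0 + (S k l / 2 + M k l * a l 0)) = b k 0 + q by rewrite e subrK.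
  ring.
have ImE : complex.Im (\sum_l L l * eigenvector M S l 0 - ((1 - q)%:C)%C * eigenvector M S k 0) =
   - (2^-1 * \sum_l (S k l * a l 0)) - \sum_l M k l * b l 0 + q * a k 0.
  rewrite cImB Im_sum.
  rewrite (eq_bigr (fun l => (P k l * a l 0 + M k l) - 2^-1 * (S k l * a l 0) -
    M k l * b l 0)); last by move=> l _; rewrite cImM eigenvectorE /= -/a -/b; field.
  rewrite !sumrB -corrector1E// cImM eigenvectorE /= -/a -/b mul0r addr0 mulr_sumr.
  ring.
apply: (le_trans (normcD_le _ _)); rewrite /R3 -addrA mulrDl lerD//.
  apply: (le_trans (normc_sum _ _ _)).
  apply: (@le_trans _ _ (\sum_(l < n.+1) (K * rho ^+ 3 * V))).
    by apply: ler_sum => l _; rewrite normcM ler_pM ?normc_ge0//; apply: hPhi.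
  by rewrite sumr_const card_ord -[X in X <= _]mulr_natl -/N le_eqVlt; apply/orP; left; apply/eqP; ring.
apply: (le_trans (normc_le_Re_Im _)); rewrite ReE ImE mulrDl.
have sum_le (X : 'M[R]_n.+1) (y : 'cV[R]_n.+1) x1 x2 : (forall k l, `|X k l| <= x1) ->
    (forall l, `|y l 0| <= x2) -> `|\sum_l X k l * y l 0| <= N * x1 * x2.
  by move=> h1 h2; have := abs_mulmx_le (h1 k) h2; rewrite mxE.
have r4 : rho ^+ 4 <= rho ^+ 3 by rewrite exprS ler_piMl.
have sb := sum_le S b _ _ hS bb; have sa := sum_le S a _ _ hS ba; have mb := sum_le M b _ _ hM bb.
have qb : `|q * b k 0| <= (F * rho ^+ 2) * (B * rho ^+ 2) by rewrite normrM ler_pM.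
have qa : `|q * a k 0| <= (F * rho ^+ 2) * (A * rho) by rewrite normrM ler_pM.
have half (x : R) : `|2^-1 * x| <= `|x| by rewrite normrM ger0_norm// ler_piMl//; lra.
apply: lerD.
  apply: (le_trans (ler_normB _ _)).
  apply: (@le_trans _ _ (N * (K * rho ^+ 2) * (B * rho ^+ 2) + (F * rho ^+ 2) * (B * rho ^+ 2))).
    by rewrite lerD// (le_trans (half _)).
  rewrite (_ : _ + _ = (N * K * B + F * B) * rho ^+ 4); last by ring.
  by rewrite ler_wpM2l// addr_ge0 ?mulr_ge0.
apply: (@le_trans _ _ (N * (K * rho ^+ 2) * (A * rho) + N * (K * rho) * (B * rho ^+ 2) + (F * rho ^+ 2) * (A * rho))).
  apply: (le_trans (ler_normD _ _)); rewrite lerD//.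
  apply: (le_trans (ler_normB _ _)); rewrite lerD//.
  by rewrite normrN (le_trans (half _)).
by rewrite le_eqVlt; apply/orP; left; apply/eqP; ring.
Qed.

End approximate_eigenvector.

Lemma measurable_euclidean_norm (R : realType) d :
  measurable_fun setT (@euclidean_norm R d).
Proof.
apply: (measurableT_comp (f := @Num.sqrt R)).
  by apply: continuous_measurable_fun; exact: sqrt_continuous.
apply: measurable_sum => i; apply: measurable_funM; exact: measurable_fun_coord.
Qed.

Lemma integral_prob_cst (R : realType) d (T : measurableType d) (P : probability T R) (a : R) :
  (\int[P]_w a%:E = a%:E)%E.
Proof.
rewrite integral_cst// (_ : (P : {measure set T -> \bar R}) setT = 1%E) ?mule1//.
exact: probability_setT.
Qed.

Lemma Rintegral_sum (R : realType) d (T : measurableType d) (mu : {measure set T -> \bar R})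
    (I : Type) (s : seq I) (f : I -> T -> R) :
  (forall i, mu.-integrable setT (EFin \o f i)) ->
  \int[mu]_x (\sum_(i <- s) f i x) = \sum_(i <- s) \int[mu]_x f i x.
Proof.
move=> fi; rewrite /Rintegral.
under eq_integral do rewrite -sumEFin.
rewrite (integral_sum measurableT fi) sum_fine// => i _.
exact: (integrable_fin_num measurableT (fi i)).
Qed.

(** * Moments of the additive component and Taylor expansion at time 1 *)

Section moments.
Context {R : realType} (tk : time_kind) {n d : nat} {disp : measure_display}
  {Omega : measurableType disp} (P : 'I_n.+1 -> probability Omega R)
  (Xt : R -> Omega -> 'I_n.+1) (Zt : R -> Omega -> 'rV[R]_d)
  (Q : R -> R.-pker ('I_n.+1 * 'rV[R]_d)%type ~> ('I_n.+1 * 'rV[R]_d)%type)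
  (m : 'rV[R]_d).
Hypothesis MAP : markov_additive_process tk P Xt Zt Q.
Local Notation T := (time_set R tk).
Local Notation Yt := (fun (t : R) (w : Omega) => Zt t w - t *: m).
Local Notation state t l := [set w | Xt t w = l].
Local Notation charmx := (charmx P Xt Zt m).

Lemma third_moment : condition_M tk P Yt 3 -> exists2 M : R, 0 <= M &
  forall k v, 0 < v <= 1 -> T v ->
    (\int[P k]_w (euclidean_norm (Yt v w) ^+ 3)%:E <= M%:E)%E.
Proof.
rewrite /condition_M; set B := moment_bound _ _ _ _ => Boo.
have B0 : (0 <= B)%E by exact: bigmax_ge_id.
exists (fine B); first exact: fine_ge0.
move=> k v v01 Tv; rewrite fineK ?ge0_fin_numE//.
apply: (@le_trans _ _ (ereal_sup [set 'E_(P k)[fun w => (euclidean_norm (Yt v w) `^ 3)%R] |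
       v in [set v | 0 < v <= 1]%R `&` T])%E); last first.
  exact: (@le_bigmax _ _ _ _ (fun k => ereal_sup [set 'E_(P k)[fun w => (euclidean_norm (Yt v w) `^ 3)%R] |
       v in [set v | 0 < v <= 1]%R `&` T])%E).
apply: ereal_sup_ubound; exists v => //.
rewrite unlock; apply: eq_integral => w _.
by rewrite (powR_mulrn 3) ?euclidean_norm_ge0.
Qed.

Variable M : R.
Hypotheses (M0 : 0 <= M) (HM : forall k v, 0 < v <= 1 -> T v ->
    (\int[P k]_w (euclidean_norm (Yt v w) ^+ 3)%:E <= M%:E)%E).

(** The powers and Taylor remainders of a phase that occur below are all dominated by some
    [a + b * |Y_v|^3], so that (M3) gives both integrability and the bound. *)
Lemma moment_dominated k v (E : set Omega) (f : Omega -> R) (a b : R) :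
  0 < v <= 1 -> T v -> 0 <= a -> 0 <= b -> measurable E -> measurable_fun setT f ->
  (forall w, `|f w| <= a + b * euclidean_norm (Yt v w) ^+ 3) ->
  (P k).-integrable E (EFin \o f) /\ `|\int[P k]_(w in E) f w| <= a + b * M.
Proof.
move=> v01 Tv a0 b0 mE mf fab.
have mY : measurable_fun setT (fun w => euclidean_norm (Yt v w) ^+ 3).
  apply: measurable_funX.
  apply: (measurableT_comp (f := @euclidean_norm R d)). exact: measurable_euclidean_norm.
  exact: (measurable_centered m MAP Tv).
have Y0 w : 0 <= euclidean_norm (Yt v w) ^+ 3 by rewrite exprn_ge0// euclidean_norm_ge0.
have le1 : (\int[P k]_(w in E) `|f w|%:E <= (a + b * M)%:E)%E.
  apply: (@le_trans _ _ (\int[P k]_(w in E) (a%:E + b%:E * (euclidean_norm (Yt v w) ^+ 3)%:E))%E).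
    apply: ge0_le_integral => //.
    - by apply/measurable_EFinP/measurableT_comp => //; exact: measurable_funTS.
    - apply: emeasurable_funD => //; apply: measurable_funeM; apply/measurable_EFinP.
      exact: measurable_funTS.
    - by move=> w _; rewrite -EFinM -EFinD lee_fin.
  apply: (@le_trans _ _ (\int[P k]_w (a%:E + b%:E * (euclidean_norm (Yt v w) ^+ 3)%:E))%E).
    apply: ge0_subset_integral => //.
    - apply: emeasurable_funD => //; apply: measurable_funeM; exact/measurable_EFinP.
    - by move=> w _; rewrite adde_ge0 ?mule_ge0 ?lee_fin.
  rewrite ge0_integralD//; last 2 first.
  - by move=> w _; rewrite mule_ge0 ?lee_fin.
  - by apply: measurable_funeM; exact/measurable_EFinP.
  rewrite integral_prob_cst ge0_integralZl//; last first.
  - by move=> w _; rewrite lee_fin.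
  - exact/measurable_EFinP.
  by rewrite EFinD EFinM leeD2l// lee_wpmul2l ?lee_fin// HM.
have fi : (P k).-integrable E (EFin \o f).
  apply/integrableP; split; first by apply/measurable_EFinP/measurable_funTS.
  by apply: (le_lt_trans le1); rewrite ltry.
split=> //; apply: (le_trans (le_normr_Rintegral mE fi)).
rewrite -lee_fin; apply: le_trans le1; rewrite /Rintegral fineK//.
have := integrable_abse fi.
by move=> /(integrable_fin_num mE).
Qed.

Lemma Rintegral_states t k (f : Omega -> R) : T t -> (P k).-integrable setT (EFin \o f) ->
  \int[P k]_w f w = \sum_l \int[P k]_(w in state t l) f w.
Proof.
move=> Tt fi.
have mS (l : 'I_n.+1) : measurable (state t l) by exact: (state_event MAP).
have UT : [set: Omega] = \big[setU/set0]_(l < n.+1) state t l.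
  apply/seteqP; split => // w _.
  rewrite -(@bigcup_mkord_ord _ _ (fun l : 'I_n.+1 => state t l)).
  by exists (val (Xt t w)); [exact: ltn_ord|rewrite /= inord_val].
have uI : uniq (index_enum 'I_n.+1) by rewrite /index_enum -enumT enum_uniq.
have tI : trivIset [set` index_enum 'I_n.+1] (fun l : 'I_n.+1 => state t l).
  by move=> i j _ _ [w [/= -> ->]].
have mf : measurable_fun (\big[setU/set0]_(l < n.+1) state t l) (EFin \o f).
  by rewrite -UT; exact: measurable_int fi.
rewrite /Rintegral [X in (\int[_]_(w in X) _)%E]UT (integral_bigsetU_EFin (P k) mS uI tI mf).
rewrite sum_fine// => l _; apply: integrable_fin_num => //.
exact: (integrableS measurableT).
Qed.

Definition mean_mx (zeta : 'rV[R]_d) : 'M[R]_n.+1 :=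
  \matrix_(k, l) \int[P k]_(w in state 1 l) dot zeta (Yt 1 w).

Definition second_mx (zeta : 'rV[R]_d) : 'M[R]_n.+1 :=
  \matrix_(k, l) \int[P k]_(w in state 1 l) (dot zeta (Yt 1 w) ^+ 2).

Definition state_mx : 'M[R]_n.+1 := \matrix_(k, l) fine (P k (state 1 l)).

Let T1 : T 1 := time_set_nat tk 1.
Let I01 : 0 < (1 : R) <= 1. Proof. by rewrite ltr01 lexx. Qed.

Lemma pow_le_1Dcube (y : R) : 0 <= y -> y <= 1 + y ^+ 3 /\ y ^+ 2 <= 1 + y ^+ 3.
Proof.
move=> y0; have [y1|/ltW y1] := leP y 1.
  have y3 : 0 <= y ^+ 3 by rewrite exprn_ge0.
  have y2 : y ^+ 2 <= 1 by rewrite exprn_ile1.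
  split; lra.
have y12 : y <= y ^+ 2 by rewrite expr2 ler_peMr.
have y23 : y ^+ 2 <= y ^+ 3 by rewrite (exprS _ 2) ler_peMl ?sqr_ge0.
split; lra.
Qed.

Lemma abs_dot_le v (zeta : 'rV[R]_d) w :
  `|dot zeta (Yt v w)| <= euclidean_norm zeta * (1 + euclidean_norm (Yt v w) ^+ 3).
Proof.
apply: (le_trans (cauchy_schwarz _ _)); rewrite ler_wpM2l ?euclidean_norm_ge0//.
by have [] := pow_le_1Dcube (euclidean_norm_ge0 (Yt v w)).
Qed.

Lemma sqr_dot_le v (zeta : 'rV[R]_d) w :
  dot zeta (Yt v w) ^+ 2 <= euclidean_norm zeta ^+ 2 * (1 + euclidean_norm (Yt v w) ^+ 3).
Proof.
rewrite -(real_normK (num_real _)).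
apply: (@le_trans _ _ ((euclidean_norm zeta * euclidean_norm (Yt v w)) ^+ 2)).
  by rewrite lerXn2r ?nnegrE ?mulr_ge0 ?euclidean_norm_ge0// cauchy_schwarz.
rewrite exprMn ler_wpM2l ?exprn_ge0 ?euclidean_norm_ge0//.
by have [] := pow_le_1Dcube (euclidean_norm_ge0 (Yt v w)).
Qed.

Lemma cube_dot_le v (zeta : 'rV[R]_d) w :
  `|dot zeta (Yt v w)| ^+ 3 <= euclidean_norm zeta ^+ 3 * euclidean_norm (Yt v w) ^+ 3.
Proof.
by rewrite -exprMn lerXn2r ?nnegrE ?mulr_ge0 ?euclidean_norm_ge0// cauchy_schwarz.
Qed.

Lemma dot_integrable k v (zeta : 'rV[R]_d) (E : set Omega) : 0 < v <= 1 -> T v -> measurable E ->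
  (P k).-integrable E (EFin \o (fun w => dot zeta (Yt v w))) /\
  `|\int[P k]_(w in E) dot zeta (Yt v w)| <= euclidean_norm zeta * (1 + M).
Proof.
move=> v01 Tv mE; rewrite mulrDr mulr1.
apply: (moment_dominated k v01 Tv) => //; rewrite ?euclidean_norm_ge0//.
  exact: (measurable_dot_centered m MAP).
by move=> w; have := abs_dot_le v zeta w; rewrite mulrDr mulr1.
Qed.

Lemma sqr_dot_integrable k v (zeta : 'rV[R]_d) (E : set Omega) : 0 < v <= 1 -> T v -> measurable E ->
  (P k).-integrable E (EFin \o (fun w => dot zeta (Yt v w) ^+ 2)) /\
  `|\int[P k]_(w in E) dot zeta (Yt v w) ^+ 2| <= euclidean_norm zeta ^+ 2 * (1 + M).
Proof.
move=> v01 Tv mE; rewrite mulrDr mulr1.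
apply: (moment_dominated k v01 Tv) => //; rewrite ?exprn_ge0 ?euclidean_norm_ge0//.
  by apply: measurable_funX; exact: (measurable_dot_centered m MAP).
by move=> w; rewrite ger0_norm ?sqr_ge0//; have := sqr_dot_le v zeta w; rewrite mulrDr mulr1.
Qed.

(** The constant [3 * (1 + M)] is common to the three estimates because [eigenvector_bounds] takes a
    single [K]. The 3 comes from the Taylor remainders: 2 for the cosine, 1 for the sine. *)
Lemma mean_mx_le zeta k l : `|mean_mx zeta k l| <= 3 * (1 + M) * euclidean_norm zeta.
Proof.
rewrite mxE; have [_ h] := dot_integrable k zeta I01 T1 (state_event MAP l T1).
apply: (le_trans h); rewrite [leRHS]mulrC ler_wpM2l ?euclidean_norm_ge0//; have := M0; lra.
Qed.

Lemma second_mx_le zeta k l : `|second_mx zeta k l| <= 3 * (1 + M) * euclidean_norm zeta ^+ 2.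
Proof.
rewrite mxE; have [_ h] := sqr_dot_integrable k zeta I01 T1 (state_event MAP l T1).
apply: (le_trans h); rewrite [leRHS]mulrC ler_wpM2l ?exprn_ge0 ?euclidean_norm_ge0//; have := M0; lra.
Qed.

Lemma mean_mxZ (a : R) zeta : mean_mx (a *: zeta) = a *: mean_mx zeta.
Proof.
apply/matrixP => k l; rewrite !mxE.
have [h _] := dot_integrable k zeta I01 T1 (state_event MAP l T1).
rewrite -RintegralZl//; last exact: (state_event MAP).
by apply: eq_Rintegral => w _; rewrite dotZl.
Qed.

Lemma second_mxZ (a : R) zeta : second_mx (a *: zeta) = a ^+ 2 *: second_mx zeta.
Proof.
apply/matrixP => k l; rewrite !mxE.
have [h _] := sqr_dot_integrable k zeta I01 T1 (state_event MAP l T1).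
rewrite -RintegralZl//; last exact: (state_event MAP).
by apply: eq_Rintegral => w _; rewrite dotZl exprMn.
Qed.

Lemma charmx1_taylor zeta k l :
  normc (charmx 1 zeta k l - ((state_mx k l - second_mx zeta k l / 2) +i* mean_mx zeta k l)%C)
  <= 3 * (1 + M) * euclidean_norm zeta ^+ 3.
Proof.
have mE := state_event MAP l T1; have fE := state_fin_num MAP k l T1.
have mU := measurable_dot_centered m MAP zeta T1.
have [i1 _] := dot_integrable k zeta I01 T1 mE.
have [i2 _] := sqr_dot_integrable k zeta I01 T1 mE.
have ic := cos_integrable mE fE mU; have isn := sin_integrable mE fE mU.
apply: (le_trans (normc_le_Re_Im _)); rewrite cReB cImB charmxE !mxE /=.
have i1c : (P k).-integrable (state 1 l) (EFin \o cst (1 : R)).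
  by apply: (@bounded_integrable _ _ _ _ _ mE fE (fun=> 1) 1) => // w; rewrite normr1.
have mc : measurable_fun setT (fun w => cos (dot zeta (Yt 1 w))).
  by apply: (measurableT_comp _ mU); apply: continuous_measurable_fun; exact: continuous_cos.
have ms : measurable_fun setT (fun w => sin (dot zeta (Yt 1 w))).
  by apply: (measurableT_comp _ mU); apply: continuous_measurable_fun; exact: continuous_sin.
set e3 := euclidean_norm zeta ^+ 3.
have e30 : 0 <= e3 by rewrite exprn_ge0// euclidean_norm_ge0.
have [_ h1] : (P k).-integrable (state 1 l) (EFin \o (fun w => cos (dot zeta (Yt 1 w)) - 1 + 2^-1 * dot zeta (Yt 1 w) ^+ 2)) /\
   `|\int[P k]_(w in state 1 l) (cos (dot zeta (Yt 1 w)) - 1 + 2^-1 * dot zeta (Yt 1 w) ^+ 2)| <= 0 + (2 * e3) * M.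
  have e230 : 0 <= 2 * e3 by apply: mulr_ge0.
  apply: (moment_dominated k I01 T1) => //.
    by apply: measurable_funD; [exact: measurable_funB|apply: measurable_funM => //; exact: measurable_funX].
  move=> w; rewrite add0r -mulrA; apply: le_trans (_ : 2 * `|dot zeta (Yt 1 w)| ^+ 3 <= _).
    by rewrite [2^-1 * _]mulrC; exact: abs_cos_taylor2.
  by rewrite ler_wpM2l// cube_dot_le.
have [_ h2] : (P k).-integrable (state 1 l) (EFin \o (fun w => sin (dot zeta (Yt 1 w)) - dot zeta (Yt 1 w))) /\
   `|\int[P k]_(w in state 1 l) (sin (dot zeta (Yt 1 w)) - dot zeta (Yt 1 w))| <= 0 + e3 * M.
  apply: (moment_dominated k I01 T1) => //.
    exact: measurable_funB.
  move=> w; rewrite add0r; apply: (le_trans (abs_sin_subr_le _)); exact: cube_dot_le.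
rewrite RintegralB// in h2.
rewrite RintegralD// in h1; last 2 first.
- have := integrableB mE ic i1c; by [].
- exact: (integrableZl mE 2^-1 i2).
rewrite RintegralB// RintegralZl// Rintegral_cst// mul1r in h1.
rewrite opprB addrA -addrAC [_ / 2]mulrC.
apply: (le_trans (lerD h1 h2)).
rewrite !add0r; have : 0 <= e3 * M by rewrite mulr_ge0.
rewrite (_ : 3 * (1 + M) * e3 = 3 * e3 + 3 * (e3 * M)); last by ring.
rewrite -mulrA; lra.
Qed.

(** Uniformity in [v], provided by the supremum in (M3), is what later controls the fractional part
    of a continuous time. *)
Lemma charmx_ones_le k v zeta : 0 < v <= 1 -> T v ->
  normc (\sum_l charmx v zeta k l - 1) <= 2 * (1 + M) * euclidean_norm zeta.
Proof.
move=> v01 Tv.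
have fT : P k setT \is a fin_num by exact: fin_num_measure.
have mU := measurable_dot_centered m MAP zeta Tv.
have ic := cos_integrable measurableT fT mU; have isn := sin_integrable measurableT fT mU.
have i1c : (P k).-integrable setT (EFin \o cst (1 : R)).
  by apply: (@bounded_integrable _ _ _ _ _ measurableT fT (fun=> 1) 1) => // w; rewrite normr1.
apply: (le_trans (normc_le_Re_Im _)); rewrite cReB cImB Re_sum Im_sum /= subr0.
under eq_bigr do rewrite charmxE /=.
under [X in _ + `|X|]eq_bigr do rewrite charmxE /=.
rewrite -!Rintegral_states//.
have {1}-> : (1 : R) = \int[P k]_w cst 1 w by rewrite /Rintegral integral_prob_cst.
rewrite -RintegralB//.
have e0 := euclidean_norm_ge0 zeta.
have mc : measurable_fun setT (fun w => cos (dot zeta (Yt v w))).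
  by apply: (measurableT_comp _ mU); apply: continuous_measurable_fun; exact: continuous_cos.
have ms : measurable_fun setT (fun w => sin (dot zeta (Yt v w))).
  by apply: (measurableT_comp _ mU); apply: continuous_measurable_fun; exact: continuous_sin.
have [_ h1] : (P k).-integrable setT (EFin \o (fun w => cos (dot zeta (Yt v w)) - 1)) /\
   `|\int[P k]_w (cos (dot zeta (Yt v w)) - 1)| <= euclidean_norm zeta + euclidean_norm zeta * M.
  apply: (moment_dominated k v01 Tv) => //; first exact: measurable_funB.
  move=> w; apply: (le_trans (abs_cos_subr1_lin _)).
  by have := abs_dot_le v zeta w; rewrite mulrDr mulr1.
have [_ h2] : (P k).-integrable setT (EFin \o (fun w => sin (dot zeta (Yt v w)))) /\
   `|\int[P k]_w sin (dot zeta (Yt v w))| <= euclidean_norm zeta + euclidean_norm zeta * M.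
  apply: (moment_dominated k v01 Tv) => //.
  move=> w; apply: (le_trans (abs_sin_le _)).
  by have := abs_dot_le v zeta w; rewrite mulrDr mulr1.
apply: (le_trans (lerD h1 h2)); lra.
Qed.

(** Centering of the process is the solvability condition of the first Poisson equation. *)
Lemma mean_mx_centered (p : 'rV[R]_n.+1) zeta :
  (forall j, \sum_k p 0 k * \int[P k]_w (Yt 1 w) 0 j = 0) ->
  p *m (mean_mx zeta *m const_mx 1) = 0 :> 'cV[R]_1.
Proof.
move=> cent; apply/matrixP => i j; rewrite !ord1 mxE [RHS]mxE.
under eq_bigr => k _.
  rewrite mxE (eq_bigr (fun l => \int[P k]_(w in state 1 l) dot zeta (Yt 1 w))); last first.
    by move=> l _; rewrite !mxE mulr1.
  have [h _] := dot_integrable k zeta I01 T1 measurableT.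
  rewrite -Rintegral_states//.
over.
have co k j' : (P k).-integrable setT (EFin \o (fun w => (Yt 1 w) 0 j')).
  have [h _] := dot_integrable k (delta_mx 0 j') I01 T1 measurableT.
  move: h; apply: eq_integrable => // w _ /=; congr EFin.
  rewrite /dot (bigD1 j')//= mxE !eqxx mul1r big1 ?addr0// => i' ij.
  by rewrite mxE (negbTE ij) andbF mul0r.
have E k : \int[P k]_w dot zeta (Yt 1 w) = \sum_j' zeta 0 j' * \int[P k]_w (Yt 1 w) 0 j'.
  transitivity (\int[P k]_w \sum_j' zeta 0 j' * (Yt 1 w) 0 j') => //.
  rewrite Rintegral_sum => [|j'']; last exact: (integrableZ (zeta 0 j'') (co k j'')).
  by apply: eq_bigr => j' _; rewrite (RintegralZl _ measurableT (co k j')).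
under eq_bigr do rewrite E mulr_sumr.
rewrite exchange_big/= big1// => j' _.
under eq_bigr do rewrite mulrCA.
by rewrite -mulr_sumr cent mulr0.
Qed.

End moments.

(** The moment bound covers the times in ]0, 1], so an integer time is split with s = 1 rather than
    s = 0; 2 <= t keeps [i] positive. *)
Lemma time_split (R : realType) (tk : time_kind) (t : R) : time_set R tk t -> 2 <= t ->
  exists i s, [/\ (0 < i)%N, 0 < s <= 1, time_set R tk s & t = i%:R + s].
Proof.
move=> Tt t2; have t0 : 0 <= t by lra.
have /andP[t3 t4] := truncn_itv t0.
set j := Num.truncn t in t3 t4.
have j1 : (1 < j)%N by rewrite -(ltr_nat R); move: t4; rewrite -natr1; lra.
have jE : j%:R = j.-1%:R + 1 :> R by rewrite natr1 prednK// ltnW.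
have [tj|tj] := eqVneq t j%:R.
  exists j.-1, 1; split; [by case: (j) j1 => [|[|]]|by rewrite ltr01 lexx|exact: (time_set_nat tk 1)|].
  by rewrite tj jE.
exists j, (t - j%:R); split; [by rewrite ltnW| |exact: time_setB (time_set_nat _ _) Tt t3|by rewrite subrKC].
rewrite subr_gt0 lt_neqAle eq_sym tj t3 /= lerBlDl natr1 ltW//.
Qed.

(** * From one time step to large times *)

Section char_asymptotics.
Context {R : realType} (tk : time_kind) {n d : nat}.
Local Notation T := (time_set R tk).
Variables (Phi : R -> 'rV[R]_d -> 'M[R[i]]_n.+1) (q : 'rV[R]_d -> R)
  (v : 'rV[R]_d -> 'cV[R[i]]_n.+1) (K C0 c0 : R).
Implicit Types (zeta xi : 'rV[R]_d).
Hypotheses (PhiD : forall s t zeta, T s -> T t -> Phi (s + t) zeta = Phi s zeta *m Phi t zeta)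
  (Phi_row : forall t zeta, T t -> row_sums_le (Phi t zeta) 1)
  (Phi_decay : forall t zeta, T t ->
    row_sums_le (Phi t zeta) (C0 * expR (- (c0 * t * Num.min 1 (dot zeta zeta)))))
  (C00 : 0 < C0) (c00 : 0 < c0) (K0 : 0 <= K)
  (qZ : forall a zeta, q (a *: zeta) = a ^+ 2 * q zeta)
  (q_le : forall zeta, euclidean_norm zeta <= 1 -> `|q zeta| <= K * euclidean_norm zeta ^+ 2)
  (v_le : forall zeta k, euclidean_norm zeta <= 1 ->
    normc (v zeta k 0 - 1) <= K * euclidean_norm zeta)
  (Phi1_v : forall zeta k, euclidean_norm zeta <= 1 ->
    normc ((Phi 1 zeta *m v zeta) k 0 - ((1 - q zeta)%:C)%C * v zeta k 0)
      <= K * euclidean_norm zeta ^+ 3)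
  (Phi_ones : forall s zeta k, 0 < s <= 1 -> T s ->
    normc (\sum_l Phi s zeta k l - 1) <= K * euclidean_norm zeta).

(** The defect [K] of the eigenvector equation, plus the price of replacing 1 - q by e^(-q): at most
    e^K K^2 |zeta|^4, times the bound 1 + K on the vector. The exponential makes powers compatible
    with real times. *)
Let K2 := K + expR K * K ^+ 2 * (1 + K).

Let K20 : 0 <= K2.
Proof. by rewrite addr_ge0// mulr_ge0 ?addr_ge0// mulr_ge0 ?expR_ge0// sqr_ge0. Qed.

Let Tnat i : T i%:R := time_set_nat tk i.

Lemma normc_v_le zeta k : euclidean_norm zeta <= 1 -> normc (v zeta k 0) <= 1 + K.
Proof.
move=> z1; rewrite -[v zeta k 0](subrK 1) (le_trans (normcD_le _ _))// normc1.
have := v_le k z1; have : K * euclidean_norm zeta <= K by rewrite ler_piMr.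
lra.
Qed.

Lemma Phi1_exp zeta k : euclidean_norm zeta <= 1 ->
  normc ((Phi 1 zeta *m v zeta) k 0 - ((expR (- q zeta))%:C)%C * v zeta k 0)
    <= K2 * euclidean_norm zeta ^+ 3.
Proof.
move=> z1; have e0 := euclidean_norm_ge0 zeta; set e := euclidean_norm zeta in z1 e0 *.
have e3 : 0 <= e ^+ 3 by rewrite exprn_ge0.
have e43 : e ^+ 4 <= e ^+ 3 by rewrite (exprS _ 3) ler_piMl.
have -> : (Phi 1 zeta *m v zeta) k 0 - ((expR (- q zeta))%:C)%C * v zeta k 0 =
  ((Phi 1 zeta *m v zeta) k 0 - ((1 - q zeta)%:C)%C * v zeta k 0) -
  ((expR (- q zeta) - 1 - - q zeta)%:C)%C * v zeta k 0.
  by rewrite !rmorphB/= rmorphN/=; ring.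
apply: (le_trans (normcD_le _ _)); rewrite normcNE normcM normc_real /K2 mulrDl.
apply: lerD; first exact: Phi1_v.
apply: (@le_trans _ _ (expR K * K ^+ 2 * (1 + K) * e ^+ 4)); last first.
  rewrite ler_wpM2l// mulr_ge0 ?addr_ge0// mulr_ge0 ?expR_ge0// sqr_ge0//.
rewrite -[leRHS]mulrA [(1 + K) * _]mulrC mulrA.
apply: ler_pM; rewrite ?normc_ge0//; last exact: normc_v_le.
apply: (le_trans (expR_taylor1_le _)); rewrite normrN sqrrN -mulrA.
have qK := q_le z1.
have qK' : `|q zeta| <= K by rewrite (le_trans qK)// ler_piMr// exprn_ile1.
apply: ler_pM; rewrite ?expR_ge0 ?sqr_ge0 ?ler_expR//.
rewrite -(real_normK (num_real (q zeta))) (_ : K ^+ 2 * e ^+ 4 = (K * e ^+ 2) ^+ 2); last by ring.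
by rewrite lerXn2r ?nnegrE ?mulr_ge0 ?exprn_ge0.
Qed.

(** Phi^i v - lam^i v is the sum of the i terms lam^(i-1-j) Phi^j (Phi v - lam v), and [kappa]
    dominates both lam and the decay of Phi^j. Each term thus carries kappa^(i-1); multiplying by
    [kappa] avoids the shifted exponent. *)
Lemma telescoping zeta (C kappa : R) i k : euclidean_norm zeta <= 1 -> 1 <= C ->
  (forall j, row_sums_le (Phi j%:R zeta) (C * kappa ^+ j)) ->
  expR (- q zeta) <= kappa ->
  kappa * normc ((Phi i.+1%:R zeta *m v zeta) k 0 -
      ((expR (- q zeta) ^+ i.+1)%:C)%C * v zeta k 0)
    <= i.+1%:R * C * (K2 * euclidean_norm zeta ^+ 3) * kappa ^+ i.+1.
Proof.
move=> z1 C1 hC hk; set eps := K2 * _.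
have eps0 : 0 <= eps by rewrite mulr_ge0// exprn_ge0// euclidean_norm_ge0.
have k0 : 0 <= kappa by rewrite (le_trans _ hk)// expR_ge0.
have C0' : 0 <= C by rewrite (le_trans _ C1).
set lam := expR (- q zeta).
have step k' : normc ((Phi 1 zeta *m v zeta) k' 0 - (lam%:C)%C * v zeta k' 0) <= eps.
  exact: Phi1_exp.
elim: i => [|i IH].
  rewrite !expr1 mul1r; apply: (@le_trans _ _ (kappa * eps)); first by rewrite ler_wpM2l.
  by rewrite [leRHS]mulrC ler_wpM2l// ler_peMl.
have -> : (Phi i.+2%:R zeta *m v zeta) k 0 - ((lam ^+ i.+2)%:C)%C * v zeta k 0 =
  \sum_j Phi i.+1%:R zeta k j * ((Phi 1 zeta *m v zeta) j 0 - (lam%:C)%C * v zeta j 0) +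
  (lam%:C)%C * ((Phi i.+1%:R zeta *m v zeta) k 0 - ((lam ^+ i.+1)%:C)%C * v zeta k 0).
  rewrite -[i.+2%:R]natr1 PhiD//; last exact: (time_set_nat tk 1).
  under eq_bigr do rewrite mulrBr mulrCA.
  rewrite sumrB -mulr_sumr -mulmxA mxE [X in (lam%:C)%C * (X - _)]mxE.
  by rewrite mulrBr mulrA -rmorphM/= -exprS addrA subrK.
apply: (@le_trans _ _ (kappa * (C * kappa ^+ i.+1 * eps +
   lam * normc ((Phi i.+1%:R zeta *m v zeta) k 0 - ((lam ^+ i.+1)%:C)%C * v zeta k 0)))).
  rewrite ler_wpM2l// (le_trans (normcD_le _ _))//; apply: lerD.
    apply: (le_trans (normc_sum _ _ _)).
    apply: (@le_trans _ _ (\sum_j normc (Phi i.+1%:R zeta k j) * eps)).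
      by apply: ler_sum => j _; rewrite normcM ler_wpM2l ?normc_ge0.
    by rewrite -mulr_suml ler_wpM2r//; exact: hC.
  by rewrite normcM normc_real ger0_norm ?expR_ge0.
rewrite mulrDr [kappa * (lam * _)]mulrCA.
have h : lam * (kappa * normc ((Phi i.+1%:R zeta *m v zeta) k 0 -
    ((lam ^+ i.+1)%:C)%C * v zeta k 0)) <= kappa * (i.+1%:R * C * eps * kappa ^+ i.+1).
  by apply: ler_pM; rewrite ?expR_ge0 ?mulr_ge0 ?normc_ge0.
apply: (le_trans (lerD (lexx _) h)).
rewrite le_eqVlt; apply/orP; left; apply/eqP.
rewrite -[in RHS]natr1 [in RHS]exprS; ring.
Qed.

(** The vector v is exchanged for the column of ones on both sides, at the cost of |v - 1|. The rate
    [kappa] stays free because the estimate serves twice: with e^|q| while the sign of q is unknown,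
    and with e^(-c0 |zeta|^2) once q is bounded below. *)
Lemma row_sum_exp zeta (C kappa : R) i k : euclidean_norm zeta <= 1 -> 1 <= C -> 0 < kappa ->
  (forall j, row_sums_le (Phi j%:R zeta) (C * kappa ^+ j)) ->
  expR (- q zeta) <= kappa ->
  normc (\sum_l Phi i.+1%:R zeta k l - ((expR (- q zeta) ^+ i.+1)%:C)%C)
    <= kappa ^+ i.+1 * (i.+1%:R * C * K2 * euclidean_norm zeta ^+ 3 / kappa +
         (C + 1) * K * euclidean_norm zeta).
Proof.
move=> z1 C1 k0 hC hk; set lam := expR (- q zeta); set e := euclidean_norm zeta.
have e0 : 0 <= e by exact: euclidean_norm_ge0.
have -> : \sum_l Phi i.+1%:R zeta k l - ((lam ^+ i.+1)%:C)%C =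
  ((Phi i.+1%:R zeta *m v zeta) k 0 - ((lam ^+ i.+1)%:C)%C * v zeta k 0) -
  \sum_l Phi i.+1%:R zeta k l * (v zeta l 0 - 1) + ((lam ^+ i.+1)%:C)%C * (v zeta k 0 - 1).
  under [X in _ - X + _]eq_bigr do rewrite mulrBr mulr1.
  by rewrite sumrB mxE; ring.
rewrite [leRHS](_ : _ = kappa ^+ i.+1 * (i.+1%:R * C * K2 * e ^+ 3 / kappa) +
  kappa ^+ i.+1 * (C * K * e) + kappa ^+ i.+1 * (K * e)); last by ring.
apply: (le_trans (normcD_le _ _)); apply: lerD; last first.
  rewrite normcM normc_real ger0_norm ?exprn_ge0 ?expR_ge0//.
  apply: ler_pM; rewrite ?normc_ge0 ?exprn_ge0 ?expR_ge0//; last exact: v_le.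
  by rewrite lerXn2r ?nnegrE ?expR_ge0 ?(ltW k0)//.
apply: (le_trans (normcD_le _ _)); apply: lerD.
  rewrite mulrA ler_pdivlMr// mulrC.
  by have := telescoping i k z1 C1 hC hk; rewrite -/lam -/e; congr (_ <= _); ring.
rewrite normcNE; apply: (le_trans (normc_sum _ _ _)).
apply: (@le_trans _ _ (\sum_l normc (Phi i.+1%:R zeta k l) * (K * e))).
  by apply: ler_sum => l _; rewrite normcM ler_wpM2l ?normc_ge0// v_le.
rewrite -mulr_suml (_ : kappa ^+ i.+1 * (C * K * e) = (C * kappa ^+ i.+1) * (K * e)); last by ring.
by rewrite ler_wpM2r ?mulr_ge0//; exact: hC.
Qed.

(** By homogeneity i q(xi / sqrt i) = q(xi), so kappa^i stays bounded and the error is O(i^(-1/2)).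
    This limit yields the lower bound on q, and later its identification with the covariance. *)
Lemma cvg_row_sum xi k :
  complex.Re (\sum_l Phi i%:R ((Num.sqrt i%:R)^-1 *: xi) k l) @[i --> \oo] --> expR (- q xi).
Proof.
pose e := euclidean_norm xi; have e0 : 0 <= e by exact: euclidean_norm_ge0.
pose B := expR `|q xi| * (K2 * e ^+ 3 + 2 * K * e).
have B0 : 0 <= B.
  by rewrite mulr_ge0 ?expR_ge0// addr_ge0// ?mulr_ge0// ?exprn_ge0.
apply/cvgrPdist_le => eps eps0.
near=> i.
have i0 : (0 < i)%N by near: i; exact: nbhs_infty_gt.
have ie2 : e ^+ 2 <= i%:R by near: i; exact: nbhs_infty_ger.
(* The final error is at most B / sqrt i. *)
have iB : (B / eps) ^+ 2 <= i%:R by near: i; exact: nbhs_infty_ger.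
set s := (Num.sqrt i%:R)^-1.
have sq0 : 0 < Num.sqrt i%:R :> R by rewrite sqrtr_gt0 ltr0n.
have s0 : 0 < s by rewrite invr_gt0.
have s2 : s ^+ 2 * i%:R = 1.
  by rewrite exprVn sqr_sqrtr ?ler0n// mulVf// pnatr_eq0 -lt0n.
have se : euclidean_norm (s *: xi) = s * e by rewrite euclidean_normZ gtr0_norm.
have z1 : euclidean_norm (s *: xi) <= 1.
  rewrite se mulrC ler_pdivrMr// mul1r -(ler_pXn2r (n := 2))// ?nnegrE ?(ltW sq0)//.
  by rewrite [leRHS]sqr_sqrtr ?ler0n.
pose kappa := expR `|q (s *: xi)|.
have k1 : 1 <= kappa by rewrite -expR0 ler_expR.
have k0 : 0 < kappa := expR_gt0 _.
have hC j : row_sums_le (Phi j%:R (s *: xi)) (1 * kappa ^+ j).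
  apply: row_sums_le_weaken (Phi_row _ (Tnat j)).
  by rewrite mul1r exprn_ege1.
have hk : expR (- q (s *: xi)) <= kappa.
  by rewrite ler_expR (le_trans (ler_norm _))// normrN.
have := @row_sum_exp (s *: xi) 1 kappa i.-1 k z1 (lexx 1) k0 hC hk.
rewrite prednK// -expRM_natl qZ.
have -> : i%:R * - (s ^+ 2 * q xi) = - q xi by rewrite mulrN mulrA [i%:R * _]mulrC s2 mul1r.
have -> : kappa ^+ i = expR `|q xi|.
  rewrite -expRM_natl qZ normrM ger0_norm ?sqr_ge0// mulrA [i%:R * _]mulrC s2 mul1r//.
rewrite se !mulr1 => h.
rewrite distrC; apply: (@le_trans _ _ (normc (\sum_l Phi i%:R (s *: xi) k l - ((expR (- q xi))%:C)%C))).
  by have := abs_Re_le (\sum_l Phi i%:R (s *: xi) k l - ((expR (- q xi))%:C)%C); rewrite cReB.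
apply: (le_trans h); apply: (@le_trans _ _ (B * s)).
  rewrite [leRHS](_ : _ = expR `|q xi| * ((K2 * e ^+ 3 + 2 * K * e) * s)); last by rewrite /B; ring.
  rewrite ler_wpM2l ?expR_ge0//.
  rewrite (_ : i%:R * K2 * (s * e) ^+ 3 / kappa = (s ^+ 2 * i%:R) * (K2 * e ^+ 3 * s) * kappa^-1); last by ring.
  rewrite s2 mul1r [leRHS]mulrDl; apply: lerD.
    by rewrite ler_piMr ?mulr_ge0 ?exprn_ge0 ?(ltW s0)// invf_le1.
  by rewrite (_ : (1 + 1) * K * (s * e) = 2 * K * e * s)//; ring.
rewrite ler_pdivrMr// mulrC -ler_pdivrMr//.
rewrite -(ler_pXn2r (n := 2))// ?nnegrE ?divr_ge0 ?(ltW eps0) ?(ltW sq0)//.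
by rewrite [leRHS]sqr_sqrtr ?ler0n.
Unshelve. all: by end_near. Qed.

(** In the limit the decay hypothesis becomes e^(-q) <= C0 e^(-c0 |xi|^2); homogeneity of degree 2
    then removes the constant [C0], by rescaling. *)
Lemma exponent_lower_bound zeta : c0 * dot zeta zeta <= q zeta.
Proof.
have C1 xi : expR (- q xi) <= C0 * expR (- (c0 * dot xi xi)).
  have cv := @cvg_row_sum xi ord0.
  rewrite -(cvg_lim _ cv)//; apply: limr_le; first exact: cvgP cv.
  near=> i.
  have i0 : (0 < i)%N by near: i; exact: nbhs_infty_gt.
  have ir : dot xi xi <= i%:R by near: i; exact: nbhs_infty_ger.
  set s := (Num.sqrt i%:R)^-1.
  have s2 : s ^+ 2 * i%:R = 1.
    by rewrite exprVn sqr_sqrtr ?ler0n// mulVf// pnatr_eq0 -lt0n.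
  apply: (le_trans (ler_norm _)); apply: (le_trans (abs_Re_le _)).
  apply: (le_trans (normc_sum _ _ _)); apply: (le_trans (Phi_decay _ (Tnat i) _)).
  have E : dot (s *: xi) (s *: xi) = s ^+ 2 * dot xi xi by rewrite dotZl dotZr mulrA.
  have E1 : s ^+ 2 * dot xi xi <= 1 by rewrite -s2 ler_wpM2l// sqr_ge0.
  rewrite E (min_idPr E1) (_ : c0 * i%:R * (s ^+ 2 * dot xi xi) = c0 * (s ^+ 2 * i%:R) * dot xi xi); last by ring.
  by rewrite s2 mulr1.
rewrite leNgt; apply/negP => h.
pose delta := c0 * dot zeta zeta - q zeta.
have d0 : 0 < delta by rewrite subr_gt0.
(* With a^2 delta = C0 the inequality at [a *: zeta] reads e^C0 <= C0, which contradicts 1 + C0 <=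
   e^C0. *)
pose a := Num.sqrt (C0 / delta).
have a2 : a ^+ 2 = C0 / delta by rewrite sqr_sqrtr// divr_ge0// ltW.
have := C1 (a *: zeta); rewrite qZ dotZl dotZr.
have -> : c0 * (a * (a * dot zeta zeta)) = a ^+ 2 * q zeta + a ^+ 2 * delta by rewrite /delta; ring.
rewrite opprD expRD mulrCA ler_pMr ?expR_gt0// a2 divfK ?gt_eqF//.
rewrite expRN ler_pdivlMr ?expR_gt0// mul1r.
have := expR_ge1Dx C0; lra.
Unshelve. all: by end_near. Qed.

Lemma char_row_sum_near : exists2 C, 0 <= C & forall t zeta k, T t -> 2 <= t ->
  euclidean_norm zeta <= 1 ->
  normc (\sum_l Phi t zeta k l - ((expR (- (t * q zeta)))%:C)%C) <=
    C * (euclidean_norm zeta + t * euclidean_norm zeta ^+ 3) * expR (- (c0 * t * dot zeta zeta)).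
Proof.
(* A decay constant that is at least 1, as [telescoping] requires. *)
pose C := C0 + 1.
have C1 : 1 <= C by rewrite lerDr ltW.
have C0' : 0 <= C by rewrite (le_trans _ C1).
have D0 : 0 <= (2 * C + 2) * K by apply: mulr_ge0 => //; lra.
have HK : 0 <= C * K2 * expR c0 + (2 * C + 2) * K.
  by apply: addr_ge0 => //; exact: mulr_ge0 (mulr_ge0 C0' K20) (expR_ge0 _).
exists (expR c0 * (C * K2 * expR c0 + (2 * C + 2) * K)).
  by apply: mulr_ge0 => //; exact: expR_ge0.
move=> t zeta k Tt t2 z1.
have [i [s [i0 s01 Ts tE]]] := time_split Tt t2.
have /andP[s0 s1] := s01.
set e := euclidean_norm zeta; have e0 : 0 <= e by exact: euclidean_norm_ge0.
set r := dot zeta zeta; have rE : r = e ^+ 2 by rewrite sqr_euclidean_norm.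
have r0 : 0 <= r by exact: dot_ge0.
have r1 : r <= 1 by rewrite rE exprn_ile1.
pose kappa := expR (- (c0 * r)).
have k0 : 0 < kappa := expR_gt0 _.
have kE j : kappa ^+ j = expR (- (c0 * j%:R * r)).
  by rewrite -expRM_natl; congr expR; ring.
have hC j : row_sums_le (Phi j%:R zeta) (C * kappa ^+ j).
  apply: row_sums_le_weaken (Phi_decay _ (Tnat j)).
  by rewrite -/r (min_idPr r1) kE ler_wpM2r ?expR_ge0// lerDl.
have qr := exponent_lower_bound zeta.
have q0 : 0 <= q zeta by rewrite (le_trans _ qr)// mulr_ge0// ltW.
have hk : expR (- q zeta) <= kappa by rewrite ler_expR lerN2.
have := @row_sum_exp zeta C kappa i.-1 k z1 C1 k0 hC hk; rewrite prednK// => h1.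
(* The time is t = i + s: [h1] is the estimate at time i, while [h2] and [h3] remove s from the
   characteristic matrix and from the exponential, each for a multiple of |zeta|. *)
have h2 : normc (\sum_l Phi t zeta k l - \sum_l Phi i%:R zeta k l) <= kappa ^+ i * (C * K * e).
  rewrite tE PhiD//.
  have -> : \sum_l (Phi i%:R zeta *m Phi s zeta) k l - \sum_l Phi i%:R zeta k l =
     \sum_j Phi i%:R zeta k j * (\sum_l Phi s zeta j l - 1).
    under [RHS]eq_bigr do rewrite mulrBr mulr1 mulr_sumr.
    rewrite sumrB exchange_big/=; congr (_ - _).
    by apply: eq_bigr => l _; rewrite mxE.
  apply: (le_trans (normc_sum _ _ _)).
  apply: (@le_trans _ _ (\sum_l normc (Phi i%:R zeta k l) * (K * e))).
    by apply: ler_sum => l _; rewrite normcM ler_wpM2l ?normc_ge0// Phi_ones.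
  rewrite -mulr_suml (_ : kappa ^+ i * (C * K * e) = (C * kappa ^+ i) * (K * e)); last by ring.
  by rewrite ler_wpM2r ?mulr_ge0//; exact: hC.
have h3 : normc (((expR (- q zeta) ^+ i)%:C)%C - ((expR (- (t * q zeta)))%:C)%C) <= kappa ^+ i * (K * e).
  rewrite -rmorphB normc_real.
  have -> : expR (- (t * q zeta)) = expR (- q zeta) ^+ i * expR (- (s * q zeta)).
    by rewrite -expRM_natl -expRD; congr expR; rewrite tE; ring.
  rewrite -[X in X - _]mulr1 -mulrBr normrM ger0_norm ?exprn_ge0 ?expR_ge0//.
  apply: ler_pM; rewrite ?exprn_ge0 ?expR_ge0//.
    by rewrite lerXn2r ?nnegrE ?expR_ge0 ?(ltW k0).
  have x0 : 0 <= s * q zeta by rewrite mulr_ge0// ltW.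
  have x1 : s * q zeta <= K * e.
    apply: (@le_trans _ _ (q zeta)); first by rewrite ler_piMl.
    have := q_le z1; rewrite ger0_norm// => /le_trans; apply.
    by rewrite ler_wpM2l// expr2 ler_piMr.
  rewrite ger0_norm; last by rewrite subr_ge0 -expR0 ler_expR oppr_le0.
  have := expR_ge1Dx (- (s * q zeta)); lra.
have -> : \sum_l Phi t zeta k l - ((expR (- (t * q zeta)))%:C)%C =
  (\sum_l Phi t zeta k l - \sum_l Phi i%:R zeta k l) +
  (\sum_l Phi i%:R zeta k l - ((expR (- q zeta) ^+ i)%:C)%C) +
  (((expR (- q zeta) ^+ i)%:C)%C - ((expR (- (t * q zeta)))%:C)%C) by ring.
apply: (le_trans (normcD_le _ _)); apply: (le_trans (lerD (le_trans (normcD_le _ _) (lerD h2 h1)) h3)).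
rewrite -!mulrDr -/e.
(* The rate is known at the integer time i; as s and |zeta|^2 are at most 1, passing to t costs a
   factor e^c0. *)
have kie : kappa ^+ i <= expR c0 * expR (- (c0 * t * r)).
  rewrite kE -expRD ler_expR tE.
  have : c0 * (s * r) <= c0 * 1 by rewrite ler_wpM2l ?(ltW c00)// mulr_ile1// ltW.
  lra.
have kv : kappa^-1 <= expR c0.
  by rewrite /kappa expRN invrK ler_expR ler_piMr// ltW.
have it : i%:R <= t by rewrite tE lerDl ltW.
have e3 : 0 <= e ^+ 3 by rewrite exprn_ge0.
apply: (@le_trans _ _ (kappa ^+ i * ((C * K2 * expR c0 + (2 * C + 2) * K) * (e + t * e ^+ 3)))); last first.
  rewrite (_ : _ * _ * expR (- (c0 * t * r)) = (expR c0 * expR (- (c0 * t * r))) *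
     ((C * K2 * expR c0 + (2 * C + 2) * K) * (e + t * e ^+ 3))); last by ring.
  apply: ler_wpM2r => //; apply: mulr_ge0 => //; apply: addr_ge0 => //.
  by apply: mulr_ge0 => //; lra.
rewrite ler_wpM2l ?exprn_ge0 ?(ltW k0)//.
have hA : i%:R * C * K2 * e ^+ 3 / kappa <= C * K2 * expR c0 * (t * e ^+ 3).
  rewrite (_ : C * K2 * expR c0 * (t * e ^+ 3) = (t * C * K2 * e ^+ 3) * expR c0); last by ring.
  have CK : 0 <= C * K2 * e ^+ 3 by apply: mulr_ge0 => //; exact: mulr_ge0.
  rewrite -!(mulrA _ C) -!(mulrA _ (C * K2)); apply: ler_pM => //.
  - by apply: mulr_ge0.
  - by rewrite invr_ge0 ltW.
  - by apply: ler_wpM2r.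
have t0 : 0 <= t by lra.
have hB : 0 <= C * K2 * expR c0 * e.
  by apply: mulr_ge0 => //; exact: mulr_ge0 (mulr_ge0 C0' K20) (expR_ge0 _).
have hD : 0 <= (2 * C + 2) * K * (t * e ^+ 3) by apply: mulr_ge0 => //; exact: mulr_ge0.
move: hA hB hD; set X := i%:R * C * K2 * e ^+ 3 / kappa; set Y := C * K2 * expR c0; set Z := t * e ^+ 3.
have -> : (Y + (2 * C + 2) * K) * (e + Z) = Y * e + Y * Z + (2 * C + 2) * K * Z + (2 * C + 2) * K * e by ring.
have -> : C * K * e + (X + (C + 1) * K * e) + K * e = X + (2 * C + 2) * K * e by ring.
lra.
Qed.

End char_asymptotics.

(** * Gaussian regularization *)

Section isotropic_gauss.
Context {R : realType} {d : nat}.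
Implicit Types (a b : R) (w z x : 'rV[R]_d).
Local Notation leb := (@lebesgue_rV R d).

Lemma quadratic_form_scalar a w : quadratic_form a%:M w = a * dot w w.
Proof.
by rewrite quadratic_formE bilinear_form_dot tr_scalar_mx mul_mx_scalar dotZr.
Qed.

Lemma quadratic_formZl a (A : 'M[R]_d) w : quadratic_form (a *: A) w = a * quadratic_form A w.
Proof. by rewrite /quadratic_form -scalemxAr -scalemxAl mxE. Qed.

Lemma quadratic_formZr a (A : 'M[R]_d) w : quadratic_form A (a *: w) = a ^+ 2 * quadratic_form A w.
Proof. by rewrite /quadratic_form linearZ/= -!scalemxAl -scalemxAr scalerA mxE. Qed.

Lemma spd_scalar a : 0 < a -> spd (a%:M : 'M[R]_d).
Proof.
move=> a0; split; first exact: tr_scalar_mx.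
by move=> v v0; rewrite quadratic_form_scalar mulr_gt0// lt_neqAle eq_sym dot_eq0 v0 dot_ge0.
Qed.

Lemma spdZ a (A : 'M[R]_d) : 0 < a -> spd A -> spd (a *: A).
Proof.
move=> a0 [At Ap]; split; first by rewrite linearZ/= At.
by move=> v v0; rewrite quadratic_formZl mulr_gt0// Ap.
Qed.

Definition gauss_mass a : R := Num.sqrt ((2 * pi) ^+ d / a ^+ d).

Lemma gauss_mass_gt0 a : 0 < a -> 0 < gauss_mass a.
Proof.
by move=> a0; rewrite sqrtr_gt0 divr_gt0// exprn_gt0// mulr_gt0// pi_gt0.
Qed.

(** Hence the kernel [gauss_mass d b * expR (- (b^-1 * |x|^2 / 2))] has total mass [(2 * pi) ^+ d].
    It is left unnormalized, which is where this factor in the later comparisons comes from. *)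
Lemma gauss_massM a : 0 < a -> gauss_mass a * gauss_mass a^-1 = (2 * pi) ^+ d.
Proof.
move=> a0; have p0 : 0 < (2 * pi) ^+ d :> R by rewrite exprn_gt0// mulr_gt0// pi_gt0.
have ad0 : 0 < a ^+ d by rewrite exprn_gt0.
rewrite /gauss_mass exprVn invrK -sqrtrM; last by rewrite divr_ge0// ltW.
rewrite (_ : _ / _ * _ = ((2 * pi) ^+ d) ^+ 2); last by field; rewrite gt_eqF.
by rewrite sqrtr_sqr ger0_norm// ltW.
Qed.

Lemma isotropic_ge0_integral a c : 0 < a ->
  (\int[leb]_z (expR (- (a * dot (z + c) (z + c) / 2)))%:E = (gauss_mass a)%:E)%E.
Proof.
move=> a0; have := ge0_integral_gauss c (spd_scalar a0); rewrite det_scalar => <-.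
by apply: eq_integral => z _; rewrite quadratic_form_scalar.
Qed.

Lemma isotropic_integrable a c : 0 < a ->
  leb.-integrable setT (EFin \o (fun z => expR (- (a * dot (z + c) (z + c) / 2)))).
Proof.
move=> a0; have := integrable_gauss_rV c (spd_scalar a0).
by apply: eq_integrable => // z _ /=; rewrite quadratic_form_scalar.
Qed.

Lemma isotropic_integral a c : 0 < a ->
  \int[leb]_z expR (- (a * dot (z + c) (z + c) / 2)) = gauss_mass a.
Proof. by move=> a0; rewrite /Rintegral isotropic_ge0_integral. Qed.

Lemma isotropic_integrable0 a : 0 < a ->
  leb.-integrable setT (EFin \o (fun z => expR (- (a * dot z z / 2)))).
Proof. by move=> a0; have := isotropic_integrable 0 a0; apply: eq_integrable => // z _ /=; rewrite addr0. Qed.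

Lemma isotropic_integral0 a : 0 < a ->
  \int[leb]_z expR (- (a * dot z z / 2)) = gauss_mass a.
Proof. by move=> a0; rewrite -(isotropic_integral 0 a0); apply: eq_Rintegral => z _; rewrite addr0. Qed.

Lemma fourier_gauss (A : 'M[R]_d) x : spd A ->
  \int[leb]_z (cos (dot z x) * expR (- (quadratic_form A z / 2))) =
  (2 * pi) ^+ d * gaussian_density A x.
Proof.
move=> sA; have [dA _] := @ge0_integral_gauss_rV R d A 0 0 0 0 0 sA ltac:(by rewrite normr0).
have uA : A \in unitmx by rewrite unitmxE unitfE gt_eqF.
have p0 : 0 < (2 * pi) ^+ d :> R by rewrite exprn_gt0// mulr_gt0// pi_gt0.
pose w := x *m invmx A.
transitivity (\int[leb]_z (cos (bilinear_form A z w) * expR (- (quadratic_form A z / 2)))).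
  by apply: eq_Rintegral => z _; rewrite bilinear_form_dot sA.1 /w mulmxKV.
rewrite integral_cos_gauss_rV// /gaussian_density mulrA; congr (_ * expR (- (_ / 2))).
  have s0 : 0 < Num.sqrt ((2 * pi) ^+ d * \det A) by rewrite sqrtr_gt0 mulr_gt0.
  apply: (canRL (mulfK (lt0r_neq0 s0))).
  rewrite -sqrtrM; last by rewrite divr_ge0// ltW.
  rewrite (_ : _ / _ * _ = ((2 * pi) ^+ d) ^+ 2); last by field; rewrite gt_eqF.
  by rewrite sqrtr_sqr ger0_norm// ltW.
rewrite /quadratic_form /w trmx_mul trmx_inv sA.1 -!mulmxA; congr ((_ *m _) 0 0).
by rewrite mulmxA mulVmx// mul1mx.
Qed.

Lemma gaussian_density_scale (A : 'M[R]_d) t x : 0 < t -> spd A ->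
  t `^ (d%:R / 2) * gaussian_density (t *: A) (t `^ 2^-1 *: x) = gaussian_density A x.
Proof.
move=> t0 sA; have [dA _] := @ge0_integral_gauss_rV R d A 0 0 0 0 0 sA ltac:(by rewrite normr0).
have uA : A \in unitmx by rewrite unitmxE unitfE gt_eqF.
rewrite /gaussian_density detZ mulrA; congr (_ * expR (- (_ / 2))).
  rewrite mulrCA sqrtrM ?exprn_ge0 ?(ltW t0)// invfM mulrA.
  rewrite (_ : Num.sqrt (t ^+ d) = t `^ (d%:R / 2)) ?divff ?mul1r ?gt_eqF ?powR_gt0//.
  by rewrite -powR12_sqrt ?exprn_ge0 ?(ltW t0)// -powR_mulrn ?(ltW t0)// -powRrM.
rewrite invmxZ ?unitmxZ ?unitfE ?gt_eqF// quadratic_formZl quadratic_formZr.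
by rewrite powR12_sqrt ?(ltW t0)// sqr_sqrtr ?(ltW t0)// mulKf// gt_eqF.
Qed.

Lemma isotropic_fourier b w : 0 < b ->
  \int[leb]_z (cos (dot z w) * expR (- (b * dot z z / 2))) =
  gauss_mass b * expR (- (b^-1 * dot w w / 2)).
Proof.
move=> b0; transitivity (\int[leb]_z (cos (bilinear_form b%:M z (b^-1 *: w)) * expR (- (quadratic_form b%:M z / 2)))).
  apply: eq_Rintegral => z _; rewrite quadratic_form_scalar bilinear_form_dot tr_scalar_mx.
  by rewrite mul_mx_scalar scalerA divff ?scale1r// gt_eqF.
rewrite integral_cos_gauss_rV; last exact: spd_scalar.
rewrite det_scalar quadratic_form_scalar dotZl dotZr; congr (_ * expR (- (_ / 2))).
by field; rewrite gt_eqF.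
Qed.

End isotropic_gauss.

Arguments gauss_mass {R} d a.

(** * Inversion of a regularized characteristic function *)

Section inversion.
Context {R : realType} {d : nat} {disp : measure_display} {Omega : measurableType disp}
  (P : probability Omega R) (V : Omega -> 'rV[R]_d).
Hypothesis mV : measurable_fun setT V.
Local Notation leb := (@lebesgue_rV R d).

Lemma measurable_phase (x : 'rV[R]_d) :
  measurable_fun setT (fun p : Omega * 'rV[R]_d => dot p.2 (x - V p.1)).
Proof.
apply: measurable_sum => j; apply: measurable_funM.
  exact: (measurableT_comp (measurable_fun_coord 0 j) measurable_snd).
under eq_fun do rewrite !mxE.
apply: measurable_funB => //.
by have := measurableT_comp (measurable_fun_coord 0 j) (measurableT_comp mV (@measurable_fst _ _ Omega 'rV[R]_d)).
Qed.

(** The function e^(-b |z|^2 / 2) cos <z, x - V> is integrated in both orders: integrating in z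
    first yields the Gaussian kernel at x - V. The sine is absent because it is odd in z. *)
Lemma gauss_inversion (b : R) (x : 'rV[R]_d) : 0 < b ->
  leb.-integrable setT (EFin \o (fun z =>
    (\int[P]_w cos (dot z (x - V w))) * expR (- (b * dot z z / 2)))) /\
  \int[P]_w (gauss_mass d b * expR (- (b^-1 * dot (x - V w) (x - V w) / 2))) =
  \int[leb]_z ((\int[P]_w cos (dot z (x - V w))) * expR (- (b * dot z z / 2))).
Proof.
move=> b0.
have me : measurable_fun setT (fun z : 'rV[R]_d => expR (- (b * dot z z / 2))).
  by apply/measurable_EFinP; exact: measurable_int (isotropic_integrable0 b0).
have bV0 : 0 < b^-1 by rewrite invr_gt0.
have igb := @isotropic_integrable0 R d b b0.
have fP : P setT \is a fin_num by exact: fin_num_measure.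
have mc z : measurable_fun setT (fun w => dot z (x - V w)).
  have := measurableT_comp (measurable_phase x) (measurable_pair2 z).
  by [].
(* [1 + cos] instead of [cos], so that Tonelli's theorem applies. *)
pose F (p : Omega * 'rV[R]_d) := ((1 + cos (dot p.2 (x - V p.1))) * expR (- (b * dot p.2 p.2 / 2)))%:E.
have mF : measurable_fun setT F.
  apply/measurable_EFinP; apply: measurable_funM; last exact: (measurableT_comp me measurable_snd).
  apply: measurable_funD => //; apply: measurableT_comp (measurable_phase x).
  by apply: continuous_measurable_fun; exact: continuous_cos.
have c1 y : 0 <= 1 + cos y :> R by rewrite -lerBlDl sub0r cos_geN1.
have F0 p : (0 <= F p)%E by rewrite lee_fin mulr_ge0 ?expR_ge0.
have ic z : P.-integrable setT (EFin \o (fun w => cos (dot z (x - V w)))).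
  exact: cos_integrable (mc z).
have dotmeas w : measurable_fun setT (fun z => dot z (x - V w)).
  by have := measurable_dot 0 (x - V w); under eq_fun do rewrite addr0.
have igc w : leb.-integrable setT (EFin \o (fun z => cos (dot z (x - V w)) * expR (- (b * dot z z / 2)))).
  apply: (@integrable_dominated _ _ _ leb _ (fun z => expR (- (b * dot z z / 2)))).
  - apply: measurable_funM => //; apply: (measurableT_comp _ (dotmeas w)).
    by apply: continuous_measurable_fun; exact: continuous_cos.
  - by move=> z; rewrite normrM (ger0_norm (expR_ge0 _)) ler_piMl ?expR_ge0// abs_cos_le1.
  - exact: igb.
have inner1 w : (\int[leb]_z F (w, z) = (gauss_mass d b + gauss_mass d b * expR (- (b^-1 * dot (x - V w) (x - V w) / 2)))%:E)%E.
  rewrite /F /=.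
  under eq_integral do rewrite mulrDl mul1r EFinD.
  rewrite integralD//; last exact: igc.
  rewrite -(isotropic_fourier (x - V w) b0) -(isotropic_integral0 b0) EFinD.
  by rewrite /Rintegral !fineK//; apply: integrable_fin_num => //; exact: igc.
have inner2 z : (\int[P]_w F (w, z) = (expR (- (b * dot z z / 2)) + (\int[P]_w cos (dot z (x - V w))) * expR (- (b * dot z z / 2)))%:E)%E.
  rewrite /F /=.
  rewrite (_ : (\int[P]_w _)%E = (\int[P]_w ((expR (- (b * dot z z / 2)))%:E + (expR (- (b * dot z z / 2)))%:E * (cos (dot z (x - V w)))%:E))%E); last first.
    by apply: eq_integral => w _; rewrite -EFinM -EFinD; congr EFin; ring.
  rewrite integralD//; last 2 first.
    by apply: (@bounded_integrable _ _ _ _ _ measurableT fP (fun=> expR (- (b * dot z z / 2))) `|expR (- (b * dot z z / 2))|).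
    exact: (integrableZl measurableT _ (ic z)).
  rewrite (integralZl measurableT (ic z)) integral_prob_cst EFinD; congr (_ + _)%E.
  rewrite [in RHS]mulrC EFinM; congr (_ * _)%E.
  by rewrite /Rintegral fineK//; exact: (integrable_fin_num measurableT (ic z)).
have ipsi : leb.-integrable setT (EFin \o (fun z => (\int[P]_w cos (dot z (x - V w))) * expR (- (b * dot z z / 2)))).
  apply: (@integrable_dominated _ _ _ leb _ (fun z => expR (- (b * dot z z / 2)))).
  - have mG := @measurable_fun_fubini_tonelli_G _ _ _ _ _ P F mF F0.
    rewrite (_ : (fun z => _) = (fun z => fine (fubini_G P F z) - expR (- (b * dot z z / 2)))); last first.
      by apply/funext => z; rewrite /fubini_G inner2/= addrAC subrr add0r.
    by apply: measurable_funB => //; exact: measurableT_comp mG.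
  - move=> z; rewrite normrM (ger0_norm (expR_ge0 _)) ler_piMl ?expR_ge0//.
    apply: (le_trans (le_normr_Rintegral measurableT (ic z))).
    have -> : 1 = \int[P]_w 1 :> R by rewrite /Rintegral integral_prob_cst.
    apply: le_Rintegral => //.
    - exact: integrable_norm (ic z).
    - by apply: (@bounded_integrable _ _ _ _ _ measurableT fP (fun=> 1) 1) => // w; rewrite normr1.
    - by move=> w _; exact: abs_cos_le1.
  - exact: igb.
split=> //.
have := fubini_tonelli (m1 := P) (m2 := leb) F mF F0.
under eq_integral do rewrite inner1.
under [in RHS]eq_integral do rewrite inner2.
have mg : measurable_fun setT (fun w => expR (- (b^-1 * dot (x - V w) (x - V w) / 2))).
  have := measurable_int _ (isotropic_integrable (- x) bV0).
  move=> /measurable_EFinP /measurableT_comp /(_ mV).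
  by apply: eq_measurable_fun => w _ /=; rewrite -(opprB x (V w)) dotNr dotC dotNr opprK.
have ig : P.-integrable setT (EFin \o (fun w => gauss_mass d b * expR (- (b^-1 * dot (x - V w) (x - V w) / 2)))).
  apply: (@bounded_integrable _ _ _ _ _ measurableT fP _ (gauss_mass d b)).
    exact: measurable_funM.
  move=> w; rewrite normrM !ger0_norm ?expR_ge0 ?(ltW (@gauss_mass_gt0 R d b b0))//.
  rewrite ler_piMr ?(ltW (@gauss_mass_gt0 R d b b0))// -expR0 ler_expR oppr_le0.
  by rewrite divr_ge0// mulr_ge0 ?invr_ge0 ?(ltW b0)// dot_ge0.
move=> /(congr1 fine).
rewrite -[fine (integral P _ _)]/(\int[P]_w (gauss_mass d b + gauss_mass d b * expR (- (b^-1 * dot (x - V w) (x - V w) / 2)))).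
rewrite -[fine (integral leb _ _)]/(\int[leb]_z (expR (- (b * dot z z / 2)) + (\int[P]_w cos (dot z (x - V w))) * expR (- (b * dot z z / 2)))).
rewrite RintegralD//; last first.
  by apply: (@bounded_integrable _ _ _ _ _ measurableT fP (fun=> gauss_mass d b) `|gauss_mass d b|).
rewrite RintegralD//.
rewrite isotropic_integral0// {1}/Rintegral integral_cst// [X in (_ * X)%E](_ : _ = 1%E) ?mule1; last exact: probability_setT.
by move=> /addrI.
Qed.

End inversion.

Lemma expR_ge_sqr (R : realType) (u : R) : 0 <= u -> u ^+ 2 <= 4 * expR u.
Proof.
move=> u0; have := expR_ge1Dx (u / 2); rewrite -[in X in _ <= 4 * X](@divfK _ 2 _ u)// => h.
have -> : expR (u / 2 * 2) = expR (u / 2) ^+ 2 :> R by rewrite mulr2n mulrDr mulr1 expRD expr2.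
have h1 : (u / 2) ^+ 2 <= expR (u / 2) ^+ 2 by rewrite lerXn2r ?nnegrE ?expR_ge0 ?divr_ge0//; lra.
by move: h1; rewrite expr_div_n; lra.
Qed.

(** In the variable u = sqrt t * rho the polynomial is (u + u^3) / sqrt t, and half of the exponent
    absorbs u + u^3. The rate t^(-1/2) of the theorem originates here. *)
Lemma polynomial_gauss_bound (R : realType) (c : R) : 0 < c ->
  exists2 C, 0 <= C & forall t rho : R, 0 < t -> 0 <= rho ->
    (rho + t * rho ^+ 3) * expR (- (c * t * rho ^+ 2))
      <= C * (Num.sqrt t)^-1 * expR (- (c * t / 2 * rho ^+ 2)).
Proof.
move=> c0; have c1 : 0 < c^-1 by rewrite invr_gt0.
exists (2 + 2 / c + 16 / c ^+ 2); first by rewrite !addr_ge0// divr_ge0// ?exprn_ge0// ltW.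
move=> t rho t0 r0; have s0 : 0 < Num.sqrt t by rewrite sqrtr_gt0.
rewrite -[in X in X <= _](sqr_sqrtr (ltW t0)) -[in X in _ <= X](sqr_sqrtr (ltW t0)).
rewrite [Num.sqrt (_ ^+ 2)]sqrtr_sqr (ger0_norm (ltW s0)).
set s := Num.sqrt t in s0 *; set u := s * rho.
have u0 : 0 <= u by rewrite mulr_ge0// ltW.
have -> : expR (- (c * s ^+ 2 * rho ^+ 2)) =
    expR (- (c / 2 * u ^+ 2)) * expR (- (c * s ^+ 2 / 2 * rho ^+ 2)).
  by rewrite -expRD; congr expR; rewrite /u; field.
rewrite mulrA ler_wpM2r ?expR_ge0//.
have -> : rho + s ^+ 2 * rho ^+ 3 = (u + u ^+ 3) / s by rewrite /u; field; rewrite gt_eqF.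
rewrite mulrAC ler_wpM2r ?invr_ge0 ?(ltW s0)// expRN ler_pdivrMr ?expR_gt0//.
set v := c / 2 * u ^+ 2.
have v0 : 0 <= v by rewrite mulr_ge0 ?sqr_ge0// divr_ge0// ltW.
have e1 := expR_ge1Dx v; have e2 := expR_ge_sqr v0.
have u2 : u ^+ 2 = 2 / c * v by rewrite /v; field; rewrite gt_eqF.
have u4 : u ^+ 4 = 4 / c ^+ 2 * v ^+ 2 by rewrite /v; field; rewrite gt_eqF.
have h1 : u <= 1 + u ^+ 2 by have := sqr_ge0 (u - 2^-1); rewrite sqrrB; lra.
have h3 : u ^+ 3 <= 1 + u ^+ 4.
  have u40 : 0 <= u ^+ 4 by rewrite exprn_ge0.
  have [ul|ul] := leP u 1; first by have := exprn_ile1 3 u0 ul; lra.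
  by have := ler_wpM2r (exprn_ge0 3 u0) (ltW ul); rewrite mul1r -exprS; lra.
apply: (le_trans (lerD h1 h3)); rewrite u2 u4 !mulrDl.
have a1 : 2 / c * v <= 2 / c * expR v by rewrite ler_wpM2l ?divr_ge0// ?ltW//; lra.
have a2 : 4 / c ^+ 2 * v ^+ 2 <= 16 / c ^+ 2 * expR v.
  apply: (@le_trans _ _ (4 / c ^+ 2 * (4 * expR v))); first by rewrite ler_wpM2l// divr_ge0// exprn_ge0// ltW.
  by rewrite le_eqVlt; apply/orP; left; apply/eqP; field; rewrite gt_eqF.
lra.
Qed.

Lemma normc_combination (R : realType) (z : R[i]) (th : R) :
  `|cos th * complex.Re z + sin th * complex.Im z| <= normc z.
Proof.
rewrite ler_norml; apply/andP; split; last exact: normc_dual (cos2Dsin2 _).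
rewrite lerNl opprD -!mulNr; apply: normc_dual.
by rewrite !sqrrN cos2Dsin2.
Qed.

Section inversion_bound.
Context {R : realType} (tk : time_kind) {n d : nat}.
Local Notation T := (time_set R tk).
Local Notation leb := (@lebesgue_rV R d).
Variables (Phi : R -> 'rV[R]_d -> 'M[R[i]]_n.+1) (S : 'M[R]_d) (C C0 c0 : R).
Implicit Types (z x : 'rV[R]_d).
Let q z := quadratic_form S z / 2.
Hypotheses (Sspd : spd S) (C_ge0 : 0 <= C) (C00 : 0 < C0) (c00 : 0 < c0)
  (q_ge : forall z, c0 * dot z z <= q z)
  (Phi_decay : forall t z, T t ->
    row_sums_le (Phi t z) (C0 * expR (- (c0 * t * Num.min 1 (dot z z)))))
  (Phi_near : forall t z k, T t -> 2 <= t -> euclidean_norm z <= 1 ->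
    normc (\sum_l Phi t z k l - ((expR (- (t * q z)))%:C)%C) <=
      C * (euclidean_norm z + t * euclidean_norm z ^+ 3) * expR (- (c0 * t * dot z z))).

(** For |z| <= 1 the expansion applies, and the kernel adds an error of at most |z|. For |z| > 1 the
    decay of Phi_t is only e^(-c0 t), and the kernel supplies integrability; the Gaussian e^(-t q)
    goes into the first term, whose polynomial is then at least 1. *)
Lemma regularized_char_bound t z k b : T t -> 2 <= t -> 0 < b <= 1 ->
  normc (\sum_l Phi t z k l * ((expR (- (b * dot z z / 2)))%:C)%C - ((expR (- (t * q z)))%:C)%C) <=
  (C + 1) * (euclidean_norm z + t * euclidean_norm z ^+ 3) * expR (- (c0 * t * dot z z))
  + C0 * expR (- (c0 * t)) * expR (- (b * dot z z / 2)).
Proof.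
move=> Tt t2 /andP[b0 b1]; have t0 : 0 < t by lra.
have r0 := euclidean_norm_ge0 z; have r2 := sqr_euclidean_norm z.
set r := euclidean_norm z in r0 r2 *; have d0 := dot_ge0 z.
rewrite -mulr_suml; set phi := \sum_l _; set e := expR (- (b * _ / 2)); set E := expR (- (t * q z)).
have e0 : 0 <= e by exact: expR_ge0.
have e1 : e <= 1 by rewrite -expR0 ler_expR oppr_le0 divr_ge0// mulr_ge0// ltW.
have EE : E <= expR (- (c0 * t * dot z z)).
  by rewrite ler_expR lerN2 mulrAC mulrC ler_wpM2l// ltW.
have E0 : 0 <= E by exact: expR_ge0.
have F0 : 0 <= C0 * expR (- (c0 * t)) * e by rewrite mulr_ge0// mulr_ge0 ?expR_ge0// ltW.
have g0 : 0 <= expR (- (c0 * t * dot z z)) by exact: expR_ge0.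
have p0 : 0 <= r + t * r ^+ 3 by rewrite addr_ge0// mulr_ge0 ?exprn_ge0// ltW.
have [rl|rg] := leP r 1.
  have -> : phi * (e%:C)%C - (E%:C)%C = (phi - (E%:C)%C) * (e%:C)%C - ((E * (1 - e))%:C)%C.
    by rewrite rmorphM rmorphB/=; ring.
  apply: (le_trans (normcD_le _ _)); rewrite normcNE normcM !normc_real (ger0_norm e0).
  rewrite ger0_norm ?mulr_ge0 ?subr_ge0// mulrDl mul1r mulrDl.
  apply: ler_wpDr => //; apply: lerD.
    apply: (@le_trans _ _ (normc (phi - (E%:C)%C))); first by rewrite ler_piMr// normc_ge0.
    exact: Phi_near.
  rewrite mulrC; apply: ler_pM => //; first by rewrite subr_ge0.
  have : 1 + - (b * dot z z / 2) <= e by exact: expR_ge1Dx.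
  (* Since b and |z| are at most 1, the kernel error fits into the linear term of the expansion
     error. *)
  have : b * dot z z / 2 <= r.
    rewrite -r2 expr2 mulrA ler_pdivrMr// mulrAC; apply: ler_pM => //.
    - by rewrite mulr_ge0// ltW.
    - by rewrite ler_piMl.
    - by lra.
  have : 0 <= t * r ^+ 3 by rewrite mulr_ge0 ?exprn_ge0// ltW.
  lra.
apply: (le_trans (normcD_le _ _)); rewrite normcNE normcM !normc_real (ger0_norm e0) (ger0_norm E0) addrC.
apply: lerD.
  apply: (le_trans EE); rewrite -[leLHS]mul1r ler_wpM2r//.
  rewrite -[leLHS]mulr1; apply: ler_pM => //; first by rewrite lerDr.
  by apply: ler_wpDr; [rewrite mulr_ge0 ?exprn_ge0// ltW|exact: ltW].
rewrite ler_wpM2r//; apply: (le_trans (normc_sum _ _ _)).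
have := Phi_decay z Tt k; rewrite min_l ?mulr1// -r2; apply: exprn_ege1; exact: ltW.
Qed.

Lemma gauss_massZ (a b : R) : 0 < a -> 0 < b ->
  gauss_mass d (a * b) = gauss_mass d a * (Num.sqrt b) ^- d.
Proof.
move=> a0 b0; rewrite /gauss_mass (exprMn d a b) invfM mulrA sqrtrM; last first.
  by rewrite divr_ge0 ?exprn_ge0 ?mulr_ge0 ?pi_ge0// ltW.
congr (_ * _); rewrite sqrtrV ?exprn_ge0 ?(ltW b0)//; congr (_^-1).
rewrite -[in LHS](sqr_sqrtr (ltW b0)) -exprM mulnC exprM sqrtr_sqr ger0_norm// exprn_ge0//.
Qed.

(** Integration of the preceding bound over z: the first term gives t^(-1/2) (c0 t)^(-d/2), the
    second one the mass of the kernel. [B] precedes the probability measure, hence serves all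
    initial states at once. *)
Lemma smoothed_density_bound : exists2 B, 0 <= B &
  forall (disp : measure_display) (Omega : measurableType disp) (P : probability Omega R)
    (V : Omega -> 'rV[R]_d) t k x b,
  measurable_fun setT V -> T t -> 2 <= t -> 0 < b <= 1 ->
  (forall z, \sum_l Phi t z k l =
    ((\int[P]_w cos (dot z (V w))) +i* (\int[P]_w sin (dot z (V w))))%C) ->
  `|\int[P]_w (gauss_mass d b * expR (- (b^-1 * dot (x - V w) (x - V w) / 2)))
    - (2 * pi) ^+ d * gaussian_density (t *: S) x| <=
  B * ((Num.sqrt t) ^- d.+1 + expR (- (c0 * t)) * gauss_mass d b).
Proof.
have [B1 B10 hB1] := polynomial_gauss_bound c00.
exists ((C + 1) * B1 * gauss_mass d c0 + C0).
  by rewrite addr_ge0 ?(ltW C00)// mulr_ge0 ?(ltW (gauss_mass_gt0 c00))// mulr_ge0// addr_ge0.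
move=> disp Omega P V t k x b mV Tt t2 /andP[b0 b1] hphi.
have fP : P setT \is a fin_num by exact: fin_num_measure.
have t0 : 0 < t by lra.
have [ipsi ->] := gauss_inversion P mV x b0.
have stS : spd (t *: S) by exact: spdZ.
rewrite -(fourier_gauss x stS).
have ct0 : 0 < c0 * t by rewrite mulr_gt0.
have igS : leb.-integrable setT (EFin \o (fun z => cos (dot z x) * expR (- (quadratic_form (t *: S) z / 2)))).
  apply: (@integrable_dominated _ _ _ leb _ (fun z => expR (- (quadratic_form (t *: S) z / 2)))).
  - apply: measurable_funM.
      apply: (measurableT_comp (continuous_measurable_fun (@continuous_cos R))).
      by have := measurable_dot 0 x; under eq_fun do rewrite addr0.
    apply/measurable_EFinP; have := measurable_int _ (integrable_gauss_rV 0 stS).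
    by under eq_fun do rewrite addr0.
  - by move=> z; rewrite normrM (ger0_norm (expR_ge0 _)) ler_piMl ?expR_ge0// abs_cos_le1.
  - have := integrable_gauss_rV 0 stS.
    by apply: eq_integrable => // z _ /=; rewrite addr0.
rewrite -RintegralB//.
apply: (le_trans (le_normr_Rintegral measurableT (integrableB measurableT ipsi igS))).
have ig1 := @isotropic_integrable0 R d _ ct0.
have ig2 := @isotropic_integrable0 R d _ b0.
have i1 := integrableZ ((C + 1) * B1 * (Num.sqrt t)^-1) ig1.
have i2 := integrableZ (C0 * expR (- (c0 * t))) ig2.
pose h z := (C + 1) * B1 * (Num.sqrt t)^-1 * expR (- (c0 * t * dot z z / 2)) +
  C0 * expR (- (c0 * t)) * expR (- (b * dot z z / 2)).
have ih : leb.-integrable setT (EFin \o h).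
  have := integrableD measurableT i1 i2.
  by apply: eq_integrable => // z _ /=; rewrite EFinD.
apply: (@le_trans _ _ (\int[leb]_z h z)).
  apply: le_Rintegral => //.
    exact: (integrable_norm (integrableB measurableT ipsi igS)).
  move=> z _; rewrite /h.
  have mdz : measurable_fun setT (fun w => dot z (V w)).
    exact: (measurableT_comp (measurable_dotr z) mV).
  have cz : \int[P]_w cos (dot z (x - V w)) =
     cos (dot z x) * complex.Re (\sum_l Phi t z k l) + sin (dot z x) * complex.Im (\sum_l Phi t z k l).
    under eq_Rintegral do rewrite dotBr cosB.
    have ci := @cos_integrable _ _ _ P _ measurableT fP _ mdz.
    have si := @sin_integrable _ _ _ P _ measurableT fP _ mdz.
    rewrite RintegralD//; last 2 first.
      exact: integrableZ.
      exact: integrableZ.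
    by rewrite !RintegralZl// hphi.
  have := regularized_char_bound z k Tt t2 (introT andP (conj b0 b1)).
  have hr := hB1 t (euclidean_norm z) t0 (euclidean_norm_ge0 z).
  rewrite !sqr_euclidean_norm in hr.
  have hr' : (C + 1) * (euclidean_norm z + t * euclidean_norm z ^+ 3) * expR (- (c0 * t * dot z z))
     <= (C + 1) * B1 * (Num.sqrt t)^-1 * expR (- (c0 * t * dot z z / 2)).
    have -> : (C + 1) * B1 / Num.sqrt t * expR (- (c0 * t * dot z z / 2)) =
      (C + 1) * (B1 / Num.sqrt t * expR (- (c0 * t / 2 * dot z z))).
      by rewrite !mulrA (mulrAC _ (dot z z)).
    by rewrite -[leLHS]mulrA ler_wpM2l ?addr_ge0.
  move=> hc; apply: le_trans (lerD hr' (lexx _)); apply: le_trans hc.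
  (* The difference of the two integrands is the real part of e^(-i <z, x>) times the difference of
     the regularized characteristic function and the Gaussian one. *)
  have := normc_combination (\sum_l Phi t z k l * ((expR (- (b * dot z z / 2)))%:C)%C
      - ((expR (- (t * q z)))%:C)%C) (dot z x).
  rewrite /= -mulr_suml cz quadratic_formZl /q mulrA; case: (\sum_l _) => u v /=.
  by congr (`|_| <= _); ring.
rewrite /h RintegralD//.
rewrite !RintegralZl// !isotropic_integral0// gauss_massZ//.
have s0 : 0 < Num.sqrt t by rewrite sqrtr_gt0.
have m0 := gauss_mass_gt0 (d := d) b0; have m1 := gauss_mass_gt0 (d := d) c00.
set X := Num.sqrt t ^- d.+1; set Y := expR _ * gauss_mass d b.
have X0 : 0 <= X by rewrite invr_ge0 exprn_ge0// ltW.
have Y0 : 0 <= Y by rewrite mulr_ge0 ?expR_ge0// ltW.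
have M0 : 0 <= (C + 1) * B1 * gauss_mass d c0 by rewrite !mulr_ge0 ?addr_ge0// ltW.
have -> : (C + 1) * B1 / Num.sqrt t * (gauss_mass d c0 / Num.sqrt t ^+ d) =
    (C + 1) * B1 * gauss_mass d c0 * X by rewrite /X exprS invfM; ring.
rewrite -[C0 * _ * _]mulrA -/Y mulrDl !mulrDr.
have := mulr_ge0 M0 Y0; have := mulr_ge0 (ltW C00) X0; lra.
Qed.

End inversion_bound.

Section law_bounded.
Context {R : realType} {d1 d2 : measure_display} {T : measurableType d1} {S : measurableType d2}
  (mu : {measure set T -> \bar R}) (E : set T) (V : T -> S)
  (lam nu : {measure set S -> \bar R}) (g : S -> R) (F : S -> R) (M : R).
Hypotheses (mE : measurable E) (fE : mu E \is a fin_num) (fnu : nu setT \is a fin_num)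
  (mV : measurable_fun setT V) (mg : measurable_fun setT g) (g0 : forall x, 0 <= g x)
  (mF : measurable_fun setT F) (F0 : forall x, 0 <= F x) (FM : forall x, F x <= M)
  (law : forall B, measurable B ->
    mu (E `&` V @^-1` B) = (\int[lam]_(y in B) (g y)%:E + nu B)%E).

Lemma integrable_bounded_density : lam.-integrable setT (EFin \o (fun y => F y * g y)).
Proof.
apply: (@integrable_dominated _ _ _ lam _ (fun y => M * g y)).
- exact: measurable_funM.
- by move=> y; rewrite ger0_norm ?mulr_ge0// ler_wpM2r.
- exact: (integrableZ M (density_integrable fE mg g0 law)).
Qed.

Lemma law_bounded : exists s, [/\ 0 <= s, s <= M * fine (nu setT) &
  (\int[mu]_(w in E) (F (V w))%:E = (\int[lam]_y (F y * g y) + s)%:E)%E].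
Proof.
have iF : nu.-integrable setT (EFin \o F).
  by apply: (bounded_integrable measurableT fnu mF) => x; rewrite ger0_norm//; exact: FM.
exists (\int[nu]_y F y); split.
- by apply: Rintegral_ge0 => x _.
- rewrite -Rintegral_cst//; apply: le_Rintegral => //.
  apply: (@bounded_integrable _ _ _ _ _ measurableT fnu (fun=> M) `|M|) => //.
- have h : ge0_mfun (EFin \o F) by split=> [|x]; [exact/measurable_EFinP|rewrite lee_fin].
  rewrite (ge0_integral_law mE mV mg g0 law h) EFinD; congr (_ + _)%E.
    rewrite /Rintegral fineK; last exact: (integrable_fin_num measurableT integrable_bounded_density).
    by apply: eq_integral => x _ /=; rewrite -EFinM mulrC.
  by rewrite /Rintegral fineK//; exact: (integrable_fin_num measurableT iF).
Qed.

End law_bounded.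

Section singular_part.
Context {R : realType} (tk : time_kind) {n d : nat} {disp : measure_display}
  {Omega : measurableType disp} (P : 'I_n.+1 -> probability Omega R)
  (Xt : R -> Omega -> 'I_n.+1) (Zt : R -> Omega -> 'rV[R]_d)
  (Q : R -> R.-pker ('I_n.+1 * 'rV[R]_d)%type ~> ('I_n.+1 * 'rV[R]_d)%type)
  (m : 'rV[R]_d)
  (G : R -> 'rV[R]_d -> 'M[R]_n.+1)
  (mu : R -> 'I_n.+1 -> 'I_n.+1 -> {finite_measure set 'rV[R]_d -> \bar R}).
Hypothesis MAP : markov_additive_process tk P Xt Zt Q.
Local Notation T := (time_set R tk).
Local Notation Yt := (fun (t : R) (w : Omega) => Zt t w - t *: m).
Local Notation leb := (@lebesgue_rV R d).
Hypothesis dec : lebesgue_decomposition tk G mu P Xt Yt.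

Lemma singular_part_bound t k (F : 'rV[R]_d -> R) (M : R) : T t -> measurable_fun setT F ->
  (forall y, 0 <= F y) -> (forall y, F y <= M) ->
  leb.-integrable setT (EFin \o (fun y => F y * \sum_l G t y k l)) /\
  `|\int[P k]_w F (Yt t w) - \int[leb]_y (F y * \sum_l G t y k l)| <=
    M * \sum_l singular_mass mu t k l.
Proof.
move=> Tt mF F0 FM.
have mY := measurable_centered m MAP Tt.
have hl l : measurable_fun setT (fun y => G t y k l) /\ (forall y, 0 <= G t y k l) /\
    forall B, measurable B ->
      P k ([set w | Xt t w = l] `&` Yt t @^-1` B) =
      (\int[leb]_(y in B) (G t y k l)%:E + mu t k l B)%E.
  by have [mG G0 _ L] := dec k l Tt.
have fin l := fin_num_measure (mu t k l) _ (@measurableT _ 'rV[R]_d).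
have iFG l : leb.-integrable setT (EFin \o (fun y => F y * G t y k l)).
  have [mG [G0 L]] := hl l.
  exact: (integrable_bounded_density (state_fin_num MAP k l Tt) mG G0 mF F0 FM L).
have /choice[s sP] : forall l, exists s, [/\ 0 <= s, s <= M * singular_mass mu t k l &
    (\int[P k]_(w in [set w | Xt t w = l]) (F (Yt t w))%:E = (\int[leb]_y (F y * G t y k l) + s)%:E)%E].
  move=> l; have [mG [G0 L]] := hl l; rewrite mxE.
  exact: (law_bounded (state_event MAP l Tt) (state_fin_num MAP k l Tt) (fin l) mY mG G0 mF F0 FM L).
have FsumE : (fun y => F y * \sum_l G t y k l) = fun y => \sum_l F y * G t y k l.
  by apply/funext => y; rewrite mulr_sumr.
rewrite FsumE; split.
  rewrite (_ : EFin \o _ = fun y => (\sum_l (F y * G t y k l)%:E)%E); last first.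
    by apply/funext => y /=; rewrite sumEFin.
  by apply: integrable_sum => // l _; exact: iFG.
have -> : \int[leb]_y (\sum_l F y * G t y k l) = \sum_l \int[leb]_y (F y * G t y k l).
  by rewrite Rintegral_sum.
have -> : \int[P k]_w F (Yt t w) = \sum_l (\int[leb]_y (F y * G t y k l) + s l).
  have hF : ge0_mfun (fun w => (F (Yt t w))%:E).
    split=> [|w]; last by rewrite lee_fin.
    by apply/measurable_EFinP; exact: (measurableT_comp mF mY).
  rewrite /Rintegral (ge0_integral_states MAP k Tt hF).
  rewrite (eq_bigr (fun l => (\int[leb]_y (F y * G t y k l) + s l)%:E)) ?sumEFin//.
  by move=> l _; case: (sP l).
rewrite big_split/= addrAC subrr add0r ger0_norm; last by apply: sumr_ge0 => l _; case: (sP l).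
by rewrite mulr_sumr; apply: ler_sum => l _; case: (sP l).
Qed.

End singular_part.

Section smoothing.
Context {R : realType} {d : nat}.
Local Notation leb := (@lebesgue_rV R d).
Implicit Types (x z : 'rV[R]_d).

(** Within distance [delta] the local bound [L * delta] is used. Beyond, |f z - f x| <= M |x - z|^2
    / delta^2, and half of the kernel's exponent absorbs |x - z|^2 at the price of 4 b; the other
    half is a wider Gaussian, whose mass explains the power of sqrt (1/2). *)
Lemma smoothing_error (f : 'rV[R]_d -> R) (M L b delta : R) x :
  measurable_fun setT f -> 0 < b -> 0 < delta -> 0 <= L ->
  (forall z, `|f z - f x| <= M) ->
  (forall z, euclidean_norm (x - z) < delta -> `|f z - f x| <= L * delta) ->
  `|\int[leb]_z (gauss_mass d b * expR (- (b^-1 * dot (x - z) (x - z) / 2)) * f z)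
     - (2 * pi) ^+ d * f x| <=
  (2 * pi) ^+ d * (L * delta + 4 * M * (Num.sqrt 2^-1) ^- d * b / delta ^+ 2).
Proof.
move=> mf b0 del0 L0 fM fL.
have M0 : 0 <= M by rewrite (le_trans _ (fM x)).
have a0 : 0 < b^-1 by rewrite invr_gt0.
have a20 : 0 < b^-1 * 2^-1 by rewrite mulr_gt0.
have gm0 := ltW (gauss_mass_gt0 (d := d) b0).
pose K z := gauss_mass d b * expR (- (b^-1 * dot (x - z) (x - z) / 2)).
have dE z : dot (x - z) (x - z) = dot (z - x) (z - x).
  by rewrite -(opprB z x) dotNr dotC dotNr opprK.
have iK : leb.-integrable setT (EFin \o K).
  have := integrableZ (gauss_mass d b) (isotropic_integrable (- x) a0).
  by apply: eq_integrable => // z _ /=; rewrite /K dE.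
have IK : \int[leb]_z K z = (2 * pi) ^+ d.
  rewrite -(@gauss_massM R d b b0) -[gauss_mass d b^-1](isotropic_integral (- x) a0) -RintegralZl; [|exact: measurableT|exact: isotropic_integrable].
  by apply: eq_Rintegral => z _; rewrite /K dE.
pose h z := L * delta * K z +
  4 * b * M / delta ^+ 2 * gauss_mass d b * expR (- (b^-1 * 2^-1 * dot (z - x) (z - x) / 2)).
have ih1 := integrableZ (L * delta) iK.
have ih2 := integrableZ (4 * b * M / delta ^+ 2 * gauss_mass d b) (isotropic_integrable (- x) a20).
have c20 : 0 <= 4 * b * M / delta ^+ 2 * gauss_mass d b.
  apply: mulr_ge0 => //; apply: divr_ge0; last by rewrite exprn_ge0// ltW.
  by apply: mulr_ge0 => //; apply: mulr_ge0 => //; exact: ltW.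
have K0 z : 0 <= K z by apply: mulr_ge0 => //; exact: expR_ge0.
have bound z : `|K z * (f z - f x)| <= h z.
  rewrite /h normrM (ger0_norm (K0 z)).
  have e0 := euclidean_norm_ge0 (x - z); have e2 := sqr_euclidean_norm (x - z).
  set r := euclidean_norm (x - z) in e0 e2 *.
  have [rd|rd] := ltP r delta.
    rewrite [in X in X <= _]mulrC; apply: ler_wpDr; last by apply: ler_wpM2r => //; exact: fL.
    by apply: mulr_ge0 => //; exact: expR_ge0.
  apply: ler_wpDl; first by apply: mulr_ge0 => //; apply: mulr_ge0 => //; exact: ltW.
  rewrite -dE /K -e2; set u := b^-1 * 2^-1 * r ^+ 2 / 2.
  have u0 : 0 <= u by rewrite divr_ge0// mulr_ge0 ?sqr_ge0// ltW.
  have -> : expR (- (b^-1 * r ^+ 2 / 2)) = expR (- u) * expR (- u).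
    by rewrite -expRD; congr expR; rewrite /u; field; rewrite gt_eqF.
  have h1 : u * expR (- u) <= 1.
    by rewrite expRN ler_pdivrMr ?expR_gt0// mul1r (le_trans _ (expR_ge1Dx u))// lerDr.
  have r2E : r ^+ 2 = 4 * b * u by rewrite /u; field; rewrite gt_eqF.
  have fr : `|f z - f x| <= M / delta ^+ 2 * r ^+ 2.
    apply: (le_trans (fM z)); rewrite -[leLHS]mulr1 -mulrA ler_wpM2l// mulrC.
    by rewrite ler_pdivlMr ?exprn_gt0// mul1r lerXn2r ?nnegrE// ltW.
  have N0 : 0 <= 4 * b * M / delta ^+ 2 * gauss_mass d b * expR (- u).
    by apply: mulr_ge0 => //; exact: expR_ge0.
  apply: le_trans (ler_piMr N0 h1).
  rewrite [leRHS](_ : _ = gauss_mass d b * (expR (- u) * expR (- u)) * (M / delta ^+ 2 * (4 * b * u))); last by ring.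
  by rewrite -r2E; apply: ler_wpM2l => //; apply: mulr_ge0 => //; apply: mulr_ge0; exact: expR_ge0.
have iD : leb.-integrable setT (EFin \o (fun z => K z * (f z - f x))).
  apply: (@integrable_dominated _ _ _ leb _ h) => //.
    apply: measurable_funM; last exact: measurable_funB.
    by apply/measurable_EFinP; exact: measurable_int iK.
  have := integrableD measurableT ih1 ih2.
  by apply: eq_integrable => // z _ /=; rewrite EFinD.
have -> : \int[leb]_z (K z * f z) - (2 * pi) ^+ d * f x = \int[leb]_z (K z * (f z - f x)).
  have iKx := integrableZ (f x) iK.
  have iKf : leb.-integrable setT (EFin \o (fun z => K z * f z)).
    have := integrableD measurableT iD iKx.
    by apply: eq_integrable => // z _ /=; rewrite -EFinD; congr EFin; ring.
  rewrite -IK mulrC -RintegralZl// -RintegralB//.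
  by apply: eq_Rintegral => z _; rewrite mulrBr [f x * _]mulrC.
apply: (le_trans (le_normr_Rintegral measurableT iD)).
apply: (@le_trans _ _ (\int[leb]_z h z)).
  apply: le_Rintegral => //; first exact: (integrable_norm iD).
  have := integrableD measurableT ih1 ih2.
  by apply: eq_integrable => // z _ /=; rewrite EFinD.
rewrite /h RintegralD; [|exact: measurableT|exact: ih1|exact: ih2].
rewrite (RintegralZl _ measurableT iK) (RintegralZl _ measurableT (isotropic_integrable (- x) a20)) IK.
rewrite (isotropic_integral (- x) a20) (@gauss_massZ R d b^-1 2^-1 a0); last by rewrite invr_gt0.
rewrite -(@gauss_massM R d b b0).
by rewrite le_eqVlt; apply/orP; left; apply/eqP; ring.
Qed.

End smoothing.

(** * Lipschitz densities on convex domains *)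

Section euclidean_topology.
Context {R : realType} {d : nat}.
Implicit Types (x y z v : 'rV[R]_d).

Lemma euclidean_normC x y : euclidean_norm (x - y) = euclidean_norm (y - x).
Proof. by rewrite -(opprB y x) -scaleN1r euclidean_normZ normrN1 mul1r. Qed.

Lemma euclidean_norm0 : euclidean_norm (0 : 'rV[R]_d) = 0.
Proof. by rewrite -(scale0r (0 : 'rV[R]_d)) euclidean_normZ normr0 mul0r. Qed.

Lemma euclidean_normD x y : euclidean_norm (x + y) <= euclidean_norm x + euclidean_norm y.
Proof.
have x0 := euclidean_norm_ge0 x; have y0 := euclidean_norm_ge0 y.
rewrite -(@ler_pXn2r _ 2) ?nnegrE ?addr_ge0 ?euclidean_norm_ge0//.
rewrite sqr_euclidean_norm dotDr dotC dotDr [dot (x + y) y]dotC dotDr.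
rewrite sqrrD !sqr_euclidean_norm [dot y x]dotC.
have := cauchy_schwarz x y; have := ler_norm (dot x y); lra.
Qed.

Lemma le_euclidean_norm x j : `|x 0 j| <= euclidean_norm x.
Proof.
rewrite -sqrtr_sqr ler_wsqrtr// /dot (bigD1 j)//= -expr2 lerDl.
by apply: sumr_ge0 => i _; rewrite -expr2 sqr_ge0.
Qed.

Lemma continuous_euclidean_norm : continuous (@euclidean_norm R d).
Proof.
have cd : continuous (fun y : 'rV[R]_d => \sum_j (y 0 j * y 0 j) : R).
  apply: continuous_big => [|j _ y]; first exact: add_continuous.
  have c : continuous (fun z : 'rV[R]_d => z 0 j : R) by exact: coord_continuous.
  exact: (continuousM (c y) (c y)).
move=> x; apply: (@continuous_comp _ _ _ (fun y : 'rV[R]_d => dot y y) Num.sqrt).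
  exact: cd.
exact: sqrt_continuous.
Qed.

Lemma near_euclidean x (e : R) : 0 < e -> \forall y \near x, euclidean_norm (y - x) < e.
Proof.
move=> e0.
have c : euclidean_norm (y - x) @[y --> x] --> (0 : R).
  rewrite -[X in _ --> X]euclidean_norm0 -(subrr x).
  apply: (@continuous_comp _ _ _ (fun y => y - x) (@euclidean_norm R d)); last exact: continuous_euclidean_norm.
  by have := @continuousB R _ _ _ _ x (@cvg_id _ (nbhs x)) (@cvg_cst _ x _ (nbhs x) _); apply.
have /cvgrPdist_lt /(_ e e0) := c; apply: filterS => y.
by rewrite sub0r normrN ger0_norm// euclidean_norm_ge0.
Qed.

Lemma convex_segment (D : set 'rV[R]_d) x y (s : R) : convex_set D -> D x -> D y ->
  0 <= s <= 1 -> D (x + s *: (y - x)).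
Proof.
move=> cD Dx Dy /andP[s0 s1].
have := cD y x (Itv01 s0 s1) (mem_set Dy) (mem_set Dx).
rewrite inE /conv/=; congr D.
by rewrite scalerBr scalerBl scale1r addrC -addrA; congr (_ + _); rewrite addrC.
Qed.

(** If the segment avoided the boundary, its intersections with D and with the closure of D would
    coincide, and their trace on [0, 1] would be open, closed and nonempty, hence contain 1. *)
Lemma boundary_point (D : set 'rV[R]_d) x y : open D -> D x -> ~ D y ->
  exists2 s : R, 0 <= s <= 1 & (closure D `\` D) (x + s *: (y - x)).
Proof.
move=> oD Dx nDy; apply: contrapT => H.
pose g (s : R) := x + s *: (y - x).
have cg : continuous g.
  by move=> s; apply: cvgD; [exact: cvg_cst|apply: cvgZ; [exact: cvg_id|exact: cvg_cst]].
have E : `[0 : R, 1] `&` g @^-1` D = `[0, 1] `&` g @^-1` closure D.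
  apply/seteqP; split => s [s01 gs]; split => //; first exact: subset_closure.
  apply: contrapT => nD; apply: H; exists s; first by move: s01; rewrite /= in_itv.
  by split.
have conn := @segment_connected R 0 1 (`[0, 1] `&` g @^-1` closure D).
suff : (`[0, 1] `&` g @^-1` closure D : set R) 1.
  move=> [_ c1]; apply: H; exists 1; first by rewrite ler01 lexx.
  by split => //; rewrite scale1r subrKC.
rewrite conn//=; first by rewrite in_itv/= ler01 lexx.
- exists 0; split; first by rewrite /= in_itv/= ler01 lexx.
  by rewrite /= /g scale0r addr0; exact: subset_closure.
- by exists (g @^-1` D) => //; apply: open_comp => // s _; exact: cg.
- exists (g @^-1` closure D) => //.
  by apply: closed_comp => [s _|]; [exact: cg|exact: closed_closure].
Qed.

End euclidean_topology.

Section lipschitz.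
Context {R : realType} {n d : nat}.
Variables (D : set 'rV[R]_d) (g : 'rV[R]_d -> 'M[R]_n.+1) (Cj : 'I_d -> R).
Hypotheses (oD : open D) (cD : convex_set D)
  (gD : forall y, D y -> differentiable g y)
  (gC : {within closure D, continuous g})
  (dg : forall j y, D y -> norm0 (complex_mx ('D_(delta_mx 0 j) g y)) <= Cj j).

Lemma entry_directional_derivative y v k l : D y ->
  derivable (fun z => g z k l) y v /\
  `|'D_v (fun z => g z k l) y| <= (\sum_j Cj j) * euclidean_norm v.
Proof.
move=> Dy; have df := gD Dy; have dv (w : 'rV[R]_d) : derivable g y w by exact: diff_derivable.
have ent (w : 'rV[R]_d) : 'D_w (fun z => g z k l) y = ('D_w g y) k l by rewrite (derive_mx (dv w)) mxE.
split; first by have /derivable_mxP := dv v; exact.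
rewrite ent deriveE// [v in 'd g y v]row_sum_delta linear_sum summxE.
rewrite mulr_suml (le_trans (ler_norm_sum _ _ _))//; apply: ler_sum => j _.
rewrite linearZ mxE normrM mulrC -deriveE//.
apply: ler_pM => //; last exact: le_euclidean_norm.
exact: (le_trans (entry_le_norm0 _ _ _)) (dg j Dy).
Qed.

Lemma entry_lipschitz_interior x y k l : D x -> D y ->
  `|g y k l - g x k l| <= (\sum_j Cj j) * euclidean_norm (y - x).
Proof.
move=> Dx Dy; pose v := y - x; pose phi (s : R) := g (x + s *: v) k l.
have seg s : s \in `[0, 1] -> D (x + s *: v).
  by rewrite in_itv => s01; exact: convex_segment.
have dphi s : s \in `[0, 1] -> derivable phi s 1 /\
    'D_1 phi s = 'D_v (fun z => g z k l) (x + s *: v).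
  move=> s01; have [dr _] := entry_directional_derivative v k l (seg s s01).
  have E : (fun h : R => h^-1 *: ((phi \o shift s) (h *: 1) - phi s)) =
    (fun h => h^-1 *: (((fun z => g z k l) \o shift (x + s *: v)) (h *: v) - g (x + s *: v) k l)).
    apply/funext => h; rewrite /phi /=; congr (_ *: (g _ k l - _)).
    by rewrite [h *: 1]mulr1 scalerDl addrCA addrA [_ + x]addrC.
  by rewrite /derivable /derive E.
have s0 : (0 : R) \in `[0, 1] by rewrite in_itv/= lexx ler01.
have [||c c01] := @MVT_segment R phi ('D_1 phi) 0 1 ler01.
- move=> s; rewrite in_itv/= => /andP[s0' s1]; apply: derivableP.
  by have [] := dphi s _; rewrite ?in_itv/= ?(ltW s0') ?(ltW s1).
- apply: derivable_within_continuous => s s01'; by have [] := dphi s s01'.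
rewrite subr0 mulr1 /phi scale1r scale0r addr0 subrKC => ->.
by rewrite (dphi c c01).2; have [] := entry_directional_derivative v k l (seg c c01).
Qed.

Lemma entry_near x k l (e : R) : closure D x -> 0 < e ->
  exists y, [/\ D y, euclidean_norm (y - x) < e & `|g y k l - g x k l| < e].
Proof.
move=> cx e0; move/subspace_continuousP: gC => /(_ x cx) gc.
have gkl : (fun y => g y k l) @ within (closure D) (nbhs x) --> g x k l.
  exact: (cvg_comp _ (fun M : 'M[R]_n.+1 => M k l) gc (@coord_continuous R _ _ k l (g x))).
have /cvgrPdist_lt /(_ e e0) h := gkl.
have h' : nbhs x [set y | closure D y -> `|g x k l - g y k l| < e] by exact: h.
have [y [Dy [h1 h2]]] := cx _ (filterI h' (near_euclidean x e0)).
exists y; split => //; rewrite distrC; apply: h1; exact: subset_closure.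
Qed.

Lemma entry_lipschitz x y k l : closure D x -> closure D y ->
  `|g y k l - g x k l| <= (\sum_j Cj j) * euclidean_norm (y - x).
Proof.
move=> cx cy; set L := \sum_j Cj j.
have L0 : 0 <= L.
  (* The sign of the [Cj j] comes from a point of [D], which exists because its closure has one. *)
  have [z [Dz _ _]] := entry_near k l cx (@ltr01 R).
  apply: sumr_ge0 => j _; apply: le_trans (dg j Dz); exact: le_trans (entry_le_norm0 _ k l).
apply/ler_addgt0Pr => e e0.
(* Moving both points into [D] costs twice this amount in the values of the function and twice,
   times [L], in the distance. *)
have e1 : 0 < e / (2 + 2 * L) by rewrite divr_gt0// ltr_wpDr// mulr_ge0.
have [x' [Dx' x1 x2]] := entry_near k l cx e1.
have [y' [Dy' y1 y2]] := entry_near k l cy e1.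
set e' := e / _ in e1 x1 x2 y1 y2.
have ee : e = 2 * e' + L * (2 * e') by rewrite /e'; field; rewrite gt_eqF// ltr_wpDr// mulr_ge0.
have h : `|g y' k l - g x' k l| <= L * euclidean_norm (y' - x') by exact: entry_lipschitz_interior.
have h1 : euclidean_norm (y' - x') <= euclidean_norm (y - x) + 2 * e'.
  have -> : y' - x' = (y' - y) + ((y - x) + (x - x')) by rewrite [y - x + _]subrKA subrKA.
  apply: (le_trans (euclidean_normD _ _)); have := euclidean_normD (y - x) (x - x').
  rewrite (euclidean_normC x x'); lra.
have h2 : L * euclidean_norm (y' - x') <= L * (euclidean_norm (y - x) + 2 * e') by rewrite ler_wpM2l.
move: h2; rewrite mulrDr => h2.
have -> : g y k l - g x k l = (g y' k l - g x' k l) - (g y' k l - g y k l) + (g x' k l - g x k l) by ring.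
apply: (le_trans (ler_normD _ _)); have := ler_normB (g y' k l - g x' k l) (g y' k l - g y k l).
clearbody e' L; lra.
Qed.

End lipschitz.

Section pointwise_estimate.
Context {R : realType} {n d : nat}.
Variables (D : set 'rV[R]_d) (g : 'rV[R]_d -> 'M[R]_n.+1) (Cj : 'I_d -> R)
  (k : 'I_n.+1) (h : 'rV[R]_d -> R) (CM beta Lam sigma E b delta : R).
Local Notation leb := (@lebesgue_rV R d).
Local Notation f := (fun y => \sum_l g y k l).
Hypotheses (oD : open D) (cD : convex_set D)
  (gD : forall y, D y -> differentiable g y)
  (gC : {within closure D, continuous g})
  (dg : forall j y, D y -> norm0 (complex_mx ('D_(delta_mx 0 j) g y)) <= Cj j)
  (g0 : forall y l, 0 <= g y k l)
  (mf : measurable_fun setT f)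
  (g_out : forall y, (~` closure D) y -> g y = 0)
  (g_le : forall y, closure D y -> norm0 (complex_mx (g y)) <= CM)
  (g_bd : forall y, (closure D `\` D) y -> norm0 (complex_mx (g y)) <= beta)
  (h0 : forall y, 0 <= h y) (h_lip : forall x y, `|h x - h y| <= Lam * euclidean_norm (x - y))
  (h_out : forall y, ~ D y -> h y <= sigma)
  (CM0 : 0 <= CM) (beta0 : 0 <= beta) (Lam0 : 0 <= Lam) (sigma0 : 0 <= sigma) (E0 : 0 <= E)
  (b0 : 0 < b) (delta0 : 0 < delta)
  (hE : forall x, `|\int[leb]_z (gauss_mass d b * expR (- (b^-1 * dot (x - z) (x - z) / 2)) * f z)
     - (2 * pi) ^+ d * h x| <= E).

Let N : R := n.+1%:R.
(** The absolute values make [L] nonnegative even when [D] is empty and nothing constrains [Cj]. *)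
Let L := \sum_j `|Cj j|.

Let N0 : 0 <= N. Proof. exact: ler0n. Qed.
Let L0 : 0 <= L. Proof. by apply: sumr_ge0. Qed.

Lemma state_density_ge0 y : 0 <= f y.
Proof. by apply: sumr_ge0. Qed.

Lemma sum_le_card (u : 'I_n.+1 -> R) a : (forall l, u l <= a) -> \sum_l u l <= N * a.
Proof.
move=> ua; apply: (le_trans (ler_sum _ (fun l _ => ua l))).
by rewrite sumr_const card_ord mulr_natl.
Qed.

Lemma state_density_le_norm0 y a : norm0 (complex_mx (g y)) <= a -> f y <= N * a.
Proof.
move=> ga; apply: sum_le_card => l; apply: le_trans ga; apply: le_trans (entry_le_norm0 _ k l).
exact: ler_norm.
Qed.

Lemma state_density_le y : f y <= N * CM.
Proof.
have [cy|ncy] := pselect (closure D y); first exact/state_density_le_norm0/g_le.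
by rewrite g_out// big1 ?mulr_ge0// => l _; rewrite mxE.
Qed.

Lemma state_density_lipschitz x y : closure D x -> closure D y -> `|f y - f x| <= N * L * euclidean_norm (y - x).
Proof.
move=> cx cy; rewrite -sumrB (le_trans (ler_norm_sum _ _ _))// -mulrA.
apply: sum_le_card => l.
have dg' j z : D z -> norm0 (complex_mx ('D_(delta_mx 0 j) g z)) <= `|Cj j|.
  by move=> Dz; rewrite (le_trans (dg j Dz))// ler_norm.
exact: (entry_lipschitz cD gD gC dg').
Qed.

(** [h] will be the density of N(0, t Sigma) and [E] the error of the comparison with the smoothed
    density. Smoothing is used only at points deep inside [D]. Elsewhere [f] and [h] are not
    compared: both are nonnegative, and each is bounded by its own share of the right-hand side. *)
Lemma pointwise_estimate x : `|f x - h x| <=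
  E / (2 * pi) ^+ d + (N * L + Lam) * delta
  + 4 * (N * CM) * (Num.sqrt 2^-1) ^- d * b / delta ^+ 2 + N * beta + sigma.
Proof.
have p0 : 0 < (2 * pi) ^+ d :> R by rewrite exprn_gt0// mulr_gt0// pi_gt0.
have NL0 : 0 <= N * L by rewrite mulr_ge0.
have t1 : 0 <= E / (2 * pi) ^+ d by rewrite divr_ge0// ltW.
have t2 : 0 <= N * L * delta by rewrite mulr_ge0// ltW.
have t2' : 0 <= Lam * delta by rewrite mulr_ge0// ltW.
have t3 : 0 <= 4 * (N * CM) * (Num.sqrt 2^-1) ^- d * b / delta ^+ 2.
  apply: divr_ge0; last exact/exprn_ge0/ltW.
  apply: mulr_ge0; last exact: ltW.
  by apply: mulr_ge0; [apply: mulr_ge0 => //; exact: mulr_ge0|rewrite invr_ge0 exprn_ge0// sqrtr_ge0].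
have t4 : 0 <= N * beta by rewrite mulr_ge0.
rewrite (mulrDl (N * L) Lam delta).
set T3 := 4 * (N * CM) * _ * _ / _ in t3 *; set T1 := E / _ in t1 *.
set T2 := N * L * delta in t2 *; set T4 := N * beta in t4 *; set T5 := Lam * delta in t2' *.
have [deep|] := pselect (forall z, euclidean_norm (x - z) < delta -> D z).
  have Dx : D x by apply: deep; rewrite subrr euclidean_norm0.
  have bd z : `|f z - f x| <= N * CM.
    have /= := state_density_le z; have /= := state_density_le x; have /= := state_density_ge0 z; have /= := state_density_ge0 x.
    by rewrite ler_norml; lra.
  have lp z : euclidean_norm (x - z) < delta -> `|f z - f x| <= N * L * delta.
    move=> zd; apply: (le_trans (state_density_lipschitz (subset_closure Dx) (subset_closure (deep z zd)))).
    by rewrite ler_wpM2l// euclidean_normC ltW.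
  have := smoothing_error mf b0 delta0 NL0 bd lp.
  have := hE x; set I := \int[leb]_z _ => h1 h2.
  rewrite -/T2 -/T3 in h2.
  suff : `|f x - h x| <= T1 + (T2 + T3) by move=> hs; apply: (le_trans hs); clearbody T1 T2 T3 T4 T5; move: t2' t4 sigma0; lra.
  rewrite -(ler_pM2l p0) (mulrDr _ T1) (_ : (2 * pi) ^+ d * T1 = E); last by rewrite /T1 mulrC divfK// gt_eqF.
  rewrite -{1}(ger0_norm (ltW p0)) -normrM mulrBr.
  rewrite (_ : _ - _ = (I - (2 * pi) ^+ d * h x) - (I - (2 * pi) ^+ d * f x)); last by ring.
  by apply: (le_trans (ler_normB _ _)); rewrite lerD.
move=> /existsNP[y /not_implyP[xy nDy]].
have /= fx0 := state_density_ge0 x; have hx0 := h0 x.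
(* Outside the closure [f] vanishes and [h] is at most [sigma]. *)
have [cx|ncx] := pselect (closure D x); last first.
  have -> : f x = 0 by rewrite g_out// big1// => l _; rewrite mxE.
  rewrite sub0r normrN ger0_norm//.
  have := h_out (fun Dx => ncx (subset_closure Dx)); clearbody T1 T2 T3 T4 T5; move: sigma0; lra.
(* [f] is compared with its value at a boundary point [w] on the segment from x to y, and [h] with
   its value at [y] itself; if x is not in [D], then [w] is x. *)
have [w [cw nw wx]] : exists w, [/\ closure D w, ~ D w & euclidean_norm (x - w) <= delta].
  have [Dx|nDx] := pselect (D x); last first.
    by exists x; split => //; rewrite subrr euclidean_norm0 ltW.
  have [s /andP[s0 s1] [cw nw]] := boundary_point oD Dx nDy.
  exists (x + s *: (y - x)); split => //.
  rewrite euclidean_normC addrAC subrr add0r euclidean_normZ ger0_norm//.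
  apply: (@le_trans _ _ (euclidean_norm (y - x))).
    by rewrite ler_piMl// euclidean_norm_ge0.
  by rewrite euclidean_normC ltW.
have /= fw : f w <= T4 by apply: state_density_le_norm0; exact: g_bd.
have /= fxw : f x - f w <= T2.
  apply: (le_trans (ler_norm _)); apply: (le_trans (state_density_lipschitz cw cx)).
  by rewrite ler_wpM2l.
have hy : h y <= sigma by exact: h_out.
have hxy : h x - h y <= T5.
  apply: (le_trans (ler_norm _)); apply: (le_trans (h_lip x y)).
  by rewrite ler_wpM2l// ltW.
by rewrite ler_norml; clearbody T1 T2 T3 T4 T5; move: sigma0; lra.
Qed.

End pointwise_estimate.

(** * The uniform estimate *)

(** For s >= 1, s^j <= (s^2)^(j+1), and (u / J)^(j+1) <= e^u with J = j + 1. *)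
Lemma power_expR_bound (R : realType) (c : R) j : 0 < c ->
  exists2 C, 0 <= C & forall s : R, 1 <= s -> s ^+ j * expR (- (c * s ^+ 2)) <= C.
Proof.
move=> c0; pose J : R := j.+1%:R; have J0 : 0 < J by rewrite ltr0n.
exists ((J / c) ^+ j.+1); first by rewrite exprn_ge0// divr_ge0// ltW.
move=> s s1; have s0 : 0 <= s by rewrite (le_trans _ s1).
rewrite expRN ler_pdivrMr ?expR_gt0//; set u := c * s ^+ 2.
have u0 : 0 <= u by rewrite mulr_ge0 ?sqr_ge0// ltW.
have h : (u / J) ^+ j.+1 <= expR u.
  have -> : expR u = expR (u / J) ^+ j.+1 by rewrite -expRM_natl mulrC divfK ?gt_eqF.
  rewrite lerXn2r ?nnegrE ?expR_ge0 ?divr_ge0 ?(ltW J0)//.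
  by apply: le_trans (expR_ge1Dx _); rewrite lerDr.
apply: (@le_trans _ _ ((s ^+ 2) ^+ j.+1)).
  by rewrite -exprM; apply: ler_weXn2l => //; rewrite mul2n -addnn (leq_trans (leqnSn j))// leq_addr.
have -> : (s ^+ 2) ^+ j.+1 = (J / c) ^+ j.+1 * (u / J) ^+ j.+1.
  by rewrite -exprMn; congr (_ ^+ _); rewrite /u; field; rewrite !gt_eqF.
by rewrite ler_wpM2l// exprn_ge0// divr_ge0// ltW.
Qed.

Section gaussian_density_facts.
Context {R : realType} {d : nat}.
Local Notation leb := (@lebesgue_rV R d).
Variables (S : 'M[R]_d) (c0 : R).
Hypotheses (Sspd : spd S) (c00 : 0 < c0) (q_ge : forall z, c0 * dot z z <= quadratic_form S z / 2).

Lemma gaussian_density_ge0 (A : 'M[R]_d) (x : 'rV[R]_d) : 0 <= gaussian_density A x.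
Proof. by rewrite mulr_ge0 ?expR_ge0// invr_ge0 sqrtr_ge0. Qed.

Let integrable_cos_gauss (x : 'rV[R]_d) :
  leb.-integrable setT (EFin \o (fun z => cos (dot z x) * expR (- (quadratic_form S z / 2)))).
Proof.
have ig : leb.-integrable setT (EFin \o (fun z => expR (- (quadratic_form S z / 2)))).
  by have := integrable_gauss_rV 0 Sspd; apply: eq_integrable => // z _ /=; rewrite addr0.
apply: (@integrable_dominated _ _ _ leb _ (fun z => expR (- (quadratic_form S z / 2)))) => //.
- apply: measurable_funM; last by apply/measurable_EFinP; exact: measurable_int ig.
  apply: (measurableT_comp (continuous_measurable_fun (@continuous_cos R))).
  by have := measurable_dot 0 x; under eq_fun do rewrite addr0.
- by move=> z; rewrite normrM (ger0_norm (expR_ge0 _)) ler_piMl ?expR_ge0// abs_cos_le1.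
Qed.

(** The density is written as a Fourier integral, where |cos <z, x> - cos <z, y>| <= |z| |x - y|;
    the remaining first moment in z is finite by the coercivity of [S]. *)
Lemma gaussian_density_lipschitz : exists2 Lam, 0 <= Lam & forall x y : 'rV[R]_d,
  `|gaussian_density S x - gaussian_density S y| <= Lam * euclidean_norm (x - y).
Proof.
have p0 : 0 < (2 * pi) ^+ d :> R by rewrite exprn_gt0// mulr_gt0// pi_gt0.
have [B B0 hB] := polynomial_gauss_bound c00.
have Lam0 : 0 <= B * gauss_mass d c0 / (2 * pi) ^+ d.
  by apply: divr_ge0; [apply: mulr_ge0 => //; exact/ltW/gauss_mass_gt0|exact: ltW].
exists (B * gauss_mass d c0 / (2 * pi) ^+ d) => // x y.
have igc := @isotropic_integrable0 R d _ c00.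
rewrite -(ler_pM2l p0) -{1}(ger0_norm (ltW p0)) -normrM mulrBr -!fourier_gauss// -RintegralB//.
apply: (le_trans (le_normr_Rintegral measurableT (integrableB measurableT (integrable_cos_gauss x) (integrable_cos_gauss y)))).
have ih := integrableZ (B * euclidean_norm (x - y)) igc.
apply: (@le_trans _ _ (\int[leb]_z (B * euclidean_norm (x - y) * expR (- (c0 * dot z z / 2))))).
  apply: le_Rintegral => //.
    exact: (integrable_norm (integrableB measurableT (integrable_cos_gauss x) (integrable_cos_gauss y))).
  move=> z _ /=; rewrite -mulrBl normrM (ger0_norm (expR_ge0 _)).
  have n0 := euclidean_norm_ge0 z; have xy0 := euclidean_norm_ge0 (x - y).
  have h1 : `|cos (dot z x) - cos (dot z y)| <= euclidean_norm z * euclidean_norm (x - y).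
    by rewrite (le_trans (abs_cosB_le _ _))// -dotBr cauchy_schwarz.
  have h2 : euclidean_norm z * expR (- (quadratic_form S z / 2)) <= B * expR (- (c0 * dot z z / 2)).
    have := hB 1 _ ltr01 n0; rewrite sqrtr1 invr1 !mulr1 mul1r sqr_euclidean_norm (mulrAC c0).
    move=> hz; apply: le_trans hz; apply: ler_pM; rewrite ?expR_ge0//.
      by rewrite lerDl exprn_ge0.
    by rewrite ler_expR lerN2.
  apply: (@le_trans _ _ (euclidean_norm z * euclidean_norm (x - y) * expR (- (quadratic_form S z / 2)))).
    by apply: ler_wpM2r => //; exact: expR_ge0.
  by rewrite mulrAC [leRHS]mulrAC; apply: ler_wpM2r.
rewrite (RintegralZl _ measurableT igc) isotropic_integral0// mulrA [_ * (_ / _)]mulrC divfK ?gt_eqF//.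
by rewrite mulrAC.
Qed.

Lemma gaussian_densityZ (t : R) (x : 'rV[R]_d) : 0 < t ->
  gaussian_density (t *: S) x = (Num.sqrt t) ^- d * gaussian_density S (t `^ (- 2^-1) *: x).
Proof.
move=> t0; have s0 : 0 < Num.sqrt t by rewrite sqrtr_gt0.
rewrite -(gaussian_density_scale (t `^ (- 2^-1) *: x) t0 Sspd) scalerA.
rewrite -powRD ?subrr ?powRr0 ?scale1r; last by apply/implyP => _; rewrite gt_eqF.
have -> : t `^ (d%:R / 2) = Num.sqrt t ^+ d.
  by rewrite mulrC powRrM powR12_sqrt ?(ltW t0)// powR_mulrn// ltW.
by rewrite mulKf// gt_eqF// exprn_gt0.
Qed.

End gaussian_density_facts.

Lemma spd_ge0 (R : realType) d (S : 'M[R]_d) v : spd S -> 0 <= quadratic_form S v.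
Proof.
move=> [_ Sp]; have [->|v0] := eqVneq v 0; last exact/ltW/Sp.
by rewrite /quadratic_form !mul0mx mxE.
Qed.

Lemma gaussian_density_le (R : realType) d (S : 'M[R]_d) y : spd S -> S \in unitmx ->
  gaussian_density S y <= (Num.sqrt ((2 * pi) ^+ d * \det S))^-1.
Proof.
move=> sS uS; rewrite ler_piMr ?invr_ge0 ?sqrtr_ge0// -expR0 ler_expR oppr_le0 divr_ge0//.
have -> : quadratic_form (invmx S) y = quadratic_form S (y *m invmx S); last exact: spd_ge0.
by rewrite /quadratic_form trmx_mul trmx_inv sS.1 mulmxKV// mulmxA.
Qed.

Lemma powR_half_opp (R : realType) (t : R) : 0 <= t -> t `^ (- 2^-1) = (Num.sqrt t)^-1.
Proof. by move=> t0; rewrite powRN powR12_sqrt. Qed.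

Lemma powR_half_nat (R : realType) (t : R) j : 0 <= t -> t `^ (j%:R / 2) = Num.sqrt t ^+ j.
Proof. by move=> t0; rewrite mulrC powRrM powR12_sqrt// powR_mulrn// sqrtr_ge0. Qed.

Section density_estimate.
Context {R : realType} (tk : time_kind) {n d : nat} {disp : measure_display}
  {Omega : measurableType disp} (P : 'I_n.+1 -> probability Omega R)
  (Xt : R -> Omega -> 'I_n.+1) (Zt : R -> Omega -> 'rV[R]_d)
  (Q : R -> R.-pker ('I_n.+1 * 'rV[R]_d)%type ~> ('I_n.+1 * 'rV[R]_d)%type)
  (m : 'rV[R]_d)
  (G : R -> 'rV[R]_d -> 'M[R]_n.+1)
  (mu : R -> 'I_n.+1 -> 'I_n.+1 -> {finite_measure set 'rV[R]_d -> \bar R})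
  (D : R -> set 'rV[R]_d) (S : 'M[R]_d) (B Cs c0 c1 : R).
Hypothesis MAP : markov_additive_process tk P Xt Zt Q.
Local Notation T := (time_set R tk).
Local Notation Yt := (fun (t : R) (w : Omega) => Zt t w - t *: m).
Local Notation leb := (@lebesgue_rV R d).
Hypotheses (dec : lebesgue_decomposition tk G mu P Xt Yt)
  (AC2 : condition_AC2 tk G D) (Sspd : spd S) (Su : S \in unitmx)
  (B0 : 0 <= B) (Cs0 : 0 <= Cs) (c00 : 0 < c0) (c10 : 0 < c1)
  (q_ge : forall z, c0 * dot z z <= quadratic_form S z / 2)
  (sing : forall t k, T t -> 0 < t -> \sum_l singular_mass mu t k l <= Cs * expR (- (c1 * t)))
  (smooth : forall t k x b, T t -> 2 <= t -> 0 < b <= 1 ->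
    `|\int[P k]_w (gauss_mass d b * expR (- (b^-1 * dot (x - Yt t w) (x - Yt t w) / 2)))
      - (2 * pi) ^+ d * gaussian_density (t *: S) x| <=
    B * ((Num.sqrt t) ^- d.+1 + expR (- (c0 * t)) * gauss_mass d b)).

Let N : R := n.+1%:R.

(* The variance of the kernel, with s = sqrt t: divided by the square of the
   width s^-(d+1) of the boundary layer, it is still O(s^-(d+1)). *)
Let width (s : R) : R := (s ^+ (4 * d.+1))^-1.

(** The mass of the kernel is a power of s, [s ^+ (2 * d.+1 * d)] up to a constant, which the
    exponential beats. *)
Lemma mass_decay c : 0 < c -> exists2 C, 0 <= C & forall s : R, 1 <= s ->
  expR (- (c * s ^+ 2)) * gauss_mass d (width s) <= C * s ^- d.+1.
Proof.
move=> c_gt0; have [C C0 hC] := power_expR_bound (2 * d.+1 * d + d.+1) c_gt0.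
have g0 := ltW (@gauss_mass_gt0 R d 1 ltr01).
exists (gauss_mass d 1 * C) => [|s s1]; first exact: mulr_ge0.
have s0 : 0 < s by rewrite (lt_le_trans _ s1).
have w0 : 0 < width s by rewrite invr_gt0 exprn_gt0.
have -> : gauss_mass d (width s) = gauss_mass d 1 * s ^+ (2 * d.+1 * d).
  rewrite -[width s]mul1r gauss_massZ//; congr (_ * _).
  rewrite /width (_ : (4 * d.+1)%N = (2 * d.+1 * 2)%N); last by rewrite mulnAC.
  rewrite -(exprVn s) (exprM s^-1 (2 * d.+1) 2) sqrtr_sqr ger0_norm; last by rewrite exprn_ge0// invr_ge0 ltW.
  by rewrite -exprM -exprVn exprVn exprVn invrK.
rewrite ler_pdivlMr ?exprn_gt0// mulrCA -mulrA ler_wpM2l//.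
by rewrite -mulrA -exprD mulrC hC.
Qed.

Lemma density_estimate : exists2 C, 0 <= C & \forall t \near time_infty R tk, forall k y,
  `|scaled_density G k t y - gaussian_density S y| <=
  C * t `^ (- 2^-1) + sup [set gaussian_density S (t `^ (- 2^-1) *: y) | y in ~` D t].
Proof.
have [hD [[CM hCM] /eqO_exP[kb kb0 hkb] /choice[Cj hCj]]] := AC2.
have [Lam Lam0 hLam] := gaussian_density_lipschitz Sspd c00 q_ge.
have [C1 C10 hC1] := mass_decay c00; have [C2 C20 hC2] := mass_decay c10.
pose L := \sum_j `|Cj j|; have L0 : 0 <= L by apply: sumr_ge0.
have N0 : 0 <= N by exact: ler0n.
have p0 : 0 < (2 * pi) ^+ d :> R by rewrite exprn_gt0// mulr_gt0// pi_gt0.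
pose CE := B + B * C1 + Cs * C2.
have CE0 : 0 <= CE by rewrite !addr_ge0// mulr_ge0.
pose CK := 4 * (N * `|CM|) * (Num.sqrt 2^-1) ^- d.
have CK0 : 0 <= CK.
  by apply: mulr_ge0; [apply: mulr_ge0 => //; exact: mulr_ge0|rewrite invr_ge0 exprn_ge0// sqrtr_ge0].
pose K := CE / (2 * pi) ^+ d + (N * L + Lam) + CK + N * kb.
have K0 : 0 <= K.
  rewrite !addr_ge0// ?mulr_ge0//; last exact: ltW.
  by rewrite invr_ge0 ltW.
exists K => //.
have h2 : \forall t \near time_infty R tk, T t /\ 2 <= t.
  by exists 2; split => // x x2 Tx; split => //; exact: ltW.
apply: filterS2 h2 hkb => t [Tt t2] hkb k y.
have t0 : 0 < t by rewrite (lt_le_trans _ t2).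
have tge0 := ltW t0.
have st : 1 <= Num.sqrt t by rewrite -[leLHS]sqrtr1 ler_wsqrtr//; lra.
have ts := sqr_sqrtr tge0.
set s := Num.sqrt t in st ts.
have s0 : 0 < s by rewrite (lt_le_trans _ st).
have [oD cD g_out gC gD] := hD t Tt t0.
(* At once the size of the density on the boundary, by (AC2), and the width of the boundary
   layer. *)
pose D1 : R := s ^- d.+1.
have D10 : 0 < D1 by rewrite invr_gt0 exprn_gt0.
have g_le z : closure (D t) z -> norm0 (complex_mx (G t z)) <= `|CM|.
  by move=> cz; rewrite (le_trans (hCM t z Tt t0 cz))// ler_norm.
have g_bd z : (closure (D t) `\` D t) z -> norm0 (complex_mx (G t z)) <= kb * D1.
  move=> bz; rewrite /D1 -(powR_half_nat _ tge0) -powRN.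
  move: hkb; rewrite (ger0_norm (powR_ge0 _ _)); apply: le_trans.
  (* The real supremum dominates its elements only because the first bound of (AC2) bounds the
     set. *)
  apply: le_trans (ler_norm _); apply: ub_le_sup; last by exists z.
  by exists `|CM| => _ [u [cu _] <-]; exact: g_le.
set sigma := sup _.
have sub z : ~ D t z -> gaussian_density S (t `^ (- 2^-1) *: z) <= sigma.
  move=> nDz; apply: ub_le_sup; last by exists z.
  by exists (Num.sqrt ((2 * pi) ^+ d * \det S))^-1 => _ [u _ <-]; exact: gaussian_density_le.
have sigma0 : 0 <= sigma.
  have [[z nDz]|H] := pselect (exists z, ~ D t z).
    exact: le_trans (gaussian_density_ge0 _ _) (sub z nDz).
  (* If [D t] is the whole space, the supremum is over the empty set and equals 0. *)
  rewrite /sigma (_ : [set _ | _ in _] = set0) ?sup0//.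
  by apply/seteqP; split => // u [z nDz _]; apply: H; exists z.
pose b := width s; pose delta := D1.
have b0 : 0 < b by rewrite invr_gt0 exprn_gt0.
have b1 : b <= 1 by rewrite invf_le1 ?exprn_gt0// exprn_ege1.
have hE x : `|\int[leb]_z (gauss_mass d b * expR (- (b^-1 * dot (x - z) (x - z) / 2)) *
    \sum_l G t z k l) - (2 * pi) ^+ d * gaussian_density (t *: S) x| <= CE * D1.
  have gm0 := ltW (@gauss_mass_gt0 R d b b0).
  have mF : measurable_fun setT (fun z : 'rV[R]_d => gauss_mass d b * expR (- (b^-1 * dot (x - z) (x - z) / 2))).
    have bV0 : 0 < b^-1 by rewrite invr_gt0.
    apply/measurable_EFinP.
    have := measurable_int _ (integrableZ (gauss_mass d b) (isotropic_integrable (- x) bV0)).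
    apply: eq_measurable_fun => z _; congr (EFin (_ * expR (- (_ / 2)))).
    by rewrite -(opprB x z) dotNr dotC dotNr opprK.
  have F0 (z : 'rV[R]_d) : 0 <= gauss_mass d b * expR (- (b^-1 * dot (x - z) (x - z) / 2)).
    by apply: mulr_ge0 => //; exact: expR_ge0.
  have FM (z : 'rV[R]_d) : gauss_mass d b * expR (- (b^-1 * dot (x - z) (x - z) / 2)) <= gauss_mass d b.
    rewrite ler_piMr// -expR0 ler_expR oppr_le0 divr_ge0// mulr_ge0 ?dot_ge0//.
    by rewrite invr_ge0 ltW.
  have [_ h1] := singular_part_bound MAP dec k Tt mF F0 FM.
  have h3 := smooth k x Tt t2 (introT andP (conj b0 b1)).
  have h4 : gauss_mass d b * \sum_l singular_mass mu t k l <= Cs * C2 * D1.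
    apply: (@le_trans _ _ (gauss_mass d b * (Cs * expR (- (c1 * t))))).
      by apply: ler_wpM2l => //; exact: sing.
    by rewrite mulrCA -mulrA ler_wpM2l// mulrC -ts hC2.
  have h5 : B * (s ^- d.+1 + expR (- (c0 * t)) * gauss_mass d b) <= B * D1 + B * C1 * D1.
    by rewrite mulrDr lerD2l -mulrA ler_wpM2l// -ts hC1.
  rewrite /CE (mulrDl _ _ D1) (mulrDl _ _ D1).
  set I1 := \int[P k]_w _ in h1 h3; set I2 := \int[leb]_z _ in h1 *.
  rewrite (_ : I2 - _ = (I1 - (2 * pi) ^+ d * gaussian_density (t *: S) x) - (I1 - I2)); last by ring.
  apply: (le_trans (ler_normB _ _)); apply: lerD.
    exact: le_trans h3 h5.
  exact: le_trans h1 h4.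
have mf : measurable_fun setT (fun z => \sum_l G t z k l).
  by apply: measurable_sum => l; have [] := dec k l Tt.
have g0 z l : 0 <= G t z k l by have [_ + _ _] := dec k l Tt; apply.
have tp : t `^ (- 2^-1) = s^-1 by exact: powR_half_opp.
have hdens x : gaussian_density (t *: S) x = s ^- d * gaussian_density S (t `^ (- 2^-1) *: x).
  exact: gaussian_densityZ.
have sd1 : s ^- d <= 1 by rewrite invf_le1 ?exprn_gt0// exprn_ege1.
have sd0 : 0 <= s ^- d by rewrite invr_ge0 exprn_ge0// ltW.
(* The constant [Lam] of the unscaled density serves at all these times, since both scaling factors
   are at most 1. *)
have h_lip x z : `|gaussian_density (t *: S) x - gaussian_density (t *: S) z| <= Lam * euclidean_norm (x - z).
  have e0 := euclidean_norm_ge0 (x - z).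
  rewrite !hdens -mulrBr normrM (ger0_norm sd0).
  apply: (@le_trans _ _ (1 * (Lam * (1 * euclidean_norm (x - z))))); last by rewrite !mul1r.
  apply: ler_pM => //; apply: (le_trans (hLam _ _)); rewrite -scalerBr euclidean_normZ.
  apply: ler_wpM2l => //; apply: ler_wpM2r => //.
  by rewrite tp ger0_norm ?invr_ge0 ?(ltW s0)// invf_le1.
have h_out z : ~ D t z -> gaussian_density (t *: S) z <= s ^- d * sigma.
  by move=> nDz; rewrite hdens; apply: ler_wpM2l => //; exact: sub.
have sig0 : 0 <= s ^- d * sigma by exact: mulr_ge0.
have CED : 0 <= CE * D1 by apply: mulr_ge0 => //; exact: ltW.
have bD0 : 0 <= kb * D1 by apply: mulr_ge0; exact: ltW.
have := @pointwise_estimate R n d (D t) (G t) Cj k (gaussian_density (t *: S)) `|CM| (kb * D1) Lam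
  (s ^- d * sigma) (CE * D1) b delta oD cD gD gC (fun j z => hCj j t z Tt t0) g0 mf g_out g_le g_bd
  (fun z => gaussian_density_ge0 _ z) h_lip h_out.
move=> /(_ (normr_ge0 _) bD0 Lam0 sig0 CED b0 D10 hE (t `^ 2^-1 *: y)).
rewrite -/N -/L -/CK => est.
rewrite /scaled_density -(gaussian_density_scale y t0 Sspd) -mulrBr normrM (ger0_norm (powR_ge0 _ _)).
rewrite powR_half_nat// -/s tp.
have sdp : 0 < s ^+ d by rewrite exprn_gt0.
apply: (le_trans (ler_wpM2l (ltW sdp) est)).
have bd : CK * b / delta ^+ 2 <= CK * D1.
  rewrite -mulrA ler_wpM2l// /b /width /delta /D1.
  have -> : (s ^+ (4 * d.+1))^-1 / s ^- d.+1 ^+ 2 = s ^- (d.+1 * 2).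
    rewrite mulnC !exprM; have := exprn_gt0 d.+1 s0; move: (s ^+ d.+1) => r r0.
    by field; rewrite gt_eqF.
  rewrite lef_pV2 ?posrE ?exprn_gt0//; apply: ler_weXn2l => //.
  by rewrite mulnC mul2n -addnn leq_addr.
have -> : K / s + sigma = s ^+ d * (CE * D1 / (2 * pi) ^+ d + (N * L + Lam) * delta + CK * D1
   + N * (kb * D1) + s ^- d * sigma).
  rewrite mulrDr mulVKf ?gt_eqF//; congr (_ + _).
  (* The rescaling of the density by s^d turns every error of size s^-(d+1) into s^-1 = t^(-1/2). *)
  have -> : s^-1 = s ^+ d * D1 by rewrite /D1 exprS invfM mulrCA divff ?mulr1 ?gt_eqF.
  rewrite /K /delta /D1; move: (s ^- d.+1) (s ^+ d) ((2 * pi) ^+ d) => u r q; ring.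
apply: ler_wpM2l; first exact: ltW.
by rewrite !lerD2r lerD2l.
Qed.

End density_estimate.

Section characteristic_asymptotics.
Context {R : realType} (tk : time_kind) {n d : nat} {disp : measure_display}
  {Omega : measurableType disp} (P : 'I_n.+1 -> probability Omega R)
  (Xt : R -> Omega -> 'I_n.+1) (Zt : R -> Omega -> 'rV[R]_d)
  (Q : R -> R.-pker ('I_n.+1 * 'rV[R]_d)%type ~> ('I_n.+1 * 'rV[R]_d)%type)
  (p : 'rV[R]_n.+1)
  (G : R -> 'rV[R]_d -> 'M[R]_n.+1)
  (mu : R -> 'I_n.+1 -> 'I_n.+1 -> {finite_measure set 'rV[R]_d -> \bar R}).
Hypothesis MAP : markov_additive_process tk P Xt Zt Q.
Local Notation T := (time_set R tk).
Local Notation m := (stationary_mean P p Zt).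
Local Notation Yt := (fun (t : R) (w : Omega) => Zt t w - t *: m).
Local Notation charmx := (charmx P Xt Zt m).
Hypotheses (inv : unique_invariant_probability tk (transition_matrix Q) p)
  (dec : lebesgue_decomposition tk G mu P Xt Yt)
  (IA : condition_IA Q) (M3 : condition_M tk P Yt 3) (AC1 : condition_AC1 tk G mu).

Let T1 : T 1 := time_set_nat tk 1.

Lemma transition_matrix_state : transition_matrix Q 1 = state_mx P Xt.
Proof.
apply/matrixP => k l; rewrite !mxE; congr fine.
rewrite -(law_kernel MAP k T1); last exact: measurableX.
by congr (P k _); apply/seteqP; split => w /=; [case|].
Qed.

Lemma stationary_mean_centered j : \sum_k p 0 k * \int[P k]_w (Yt 1 w) 0 j = 0.
Proof.
have [[_ p1 _] _] := inv; have [M M0 HM] := third_moment M3.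
have I01 : 0 < (1 : R) <= 1 by rewrite ltr01 lexx.
have E k : \int[P k]_w (Yt 1 w) 0 j = fine ('E_(P k)[fun w => (Zt 1 w 0 j)%R])%E - m 0 j.
  have [iY _] := dot_integrable MAP HM k (delta_mx 0 j) I01 T1 measurableT.
  have dE w : dot (delta_mx 0 j) (Yt 1 w) = (Yt 1 w) 0 j.
    rewrite /dot (bigD1 j)//= big1 ?addr0 ?mxE ?eqxx ?mul1r// => i ij.
    by rewrite mxE eqxx (negbTE ij) mul0r.
  have ic : (P k).-integrable setT (EFin \o cst (m 0 j)).
    by apply: (@bounded_integrable _ _ _ _ _ measurableT _ (cst (m 0 j)) `|m 0 j|) => //; exact: fin_num_measure.
  have iY' : (P k).-integrable setT (EFin \o (fun w => (Yt 1 w) 0 j)).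
    by apply: eq_integrable iY => // w _ /=; rewrite dE.
  rewrite unlock.
  have -> : fine (\int[P k]_w (Zt 1 w 0%R j)%:E)%E = \int[P k]_w ((Yt 1 w) 0 j + m 0 j).
    by apply: eq_Rintegral => w _; rewrite !mxE mul1r subrK.
  by rewrite RintegralD// (_ : \int[P k]_w (m 0 j) = m 0 j) ?addrK// /Rintegral integral_prob_cst.
under eq_bigr do rewrite E mulrBr.
by rewrite sumrB -mulr_suml p1 mul1r [X in _ - X]mxE subrr.
Qed.

Lemma characteristic_asymptotics : exists (q : 'rV[R]_d -> R) (C C0 c0 : R),
  [/\ 0 <= C, 0 < C0, 0 < c0, forall z, c0 * dot z z <= q z &
  [/\ forall t z, T t -> row_sums_le (charmx t z) (C0 * expR (- (c0 * t * Num.min 1 (dot z z)))),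
      forall t z k, T t -> 2 <= t -> euclidean_norm z <= 1 ->
        normc (\sum_l charmx t z k l - ((expR (- (t * q z)))%:C)%C) <=
        C * (euclidean_norm z + t * euclidean_norm z ^+ 3) * expR (- (c0 * t * dot z z)) &
      forall z k, complex.Re (\sum_l charmx i%:R ((Num.sqrt i%:R)^-1 *: z) k l) @[i --> \oo]
        --> expR (- q z)]].
Proof.
have [C0 [c0 [C00 c00 decay]]] := charmx_decay MAP dec AC1.
have [M M0 HM] := third_moment M3.
have [[p0 p1 pT] _] := inv; have pP := pT 1 T1.
have [irr _] := IA; rewrite transition_matrix_state in irr pP.
have S0 k l : 0 <= state_mx P Xt k l by rewrite mxE fine_ge0.
have S1 k : \sum_l state_mx P Xt k l = 1.
  by rewrite -(sum_state_prob MAP k T1); apply: eq_bigr => l _; rewrite mxE.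
have [H HP] := poisson_equation S0 S1 irr p1 pP.
have K30 : 0 <= 3 * (1 + M) by apply: mulr_ge0 => //; exact: addr_ge0.
have [K' K'0 bnd] := eigenvector_bounds S1 p0 p1 HP K30.
pose A z := mean_mx P Xt Zt m z; pose V z := second_mx P Xt Zt m z.
pose q z := eigen_exponent p H (A z) (V z); pose v z := eigenvector p H (A z) (V z).
(* One constant for the eigenvector estimates and for the fractional time steps. *)
pose K := Num.max K' (2 * (1 + M)).
have K'K : K' <= K by rewrite le_max lexx.
have K0 : 0 <= K by exact: le_trans K'K.
have bounds (z : 'rV[R]_d) : euclidean_norm z <= 1 ->
  [/\ `|q z| <= K' * euclidean_norm z ^+ 2,
      forall k, normc (v z k 0 - 1) <= K' * euclidean_norm z &
      forall k, normc ((charmx 1 z *m v z) k 0 - ((1 - q z)%:C)%C * v z k 0) <= K' * euclidean_norm z ^+ 3].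
  move=> z1; apply: bnd.
  - by rewrite euclidean_norm_ge0 z1.
  - exact: (mean_mx_le MAP M0 HM).
  - exact: (second_mx_le MAP M0 HM).
  - exact: (charmx1_taylor MAP M0 HM).
  - exact: (mean_mx_centered MAP HM z stationary_mean_centered).
have weaken (z : 'rV[R]_d) j : K' * euclidean_norm z ^+ j <= K * euclidean_norm z ^+ j.
  by rewrite ler_wpM2r// exprn_ge0// euclidean_norm_ge0.
(* The mean matrix is linear in z and occurs twice, directly and through [corrector1]; the second
   moment matrix is quadratic. *)
have qZ a z : q (a *: z) = a ^+ 2 * q z.
  rewrite /q /A /V (mean_mxZ MAP HM) (second_mxZ MAP HM) /eigen_exponent /second_order /corrector1.
  rewrite -!scalemxAl -!scalemxAr !scalerA -expr2 [_^-1 * _]mulrC -[(_ * _^-1) *: _]scalerA -scalerDr.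
  by rewrite -scalemxAr mxE.
have q_le (z : 'rV[R]_d) : euclidean_norm z <= 1 -> `|q z| <= K * euclidean_norm z ^+ 2.
  by move=> /bounds[h _ _]; exact: (le_trans h (weaken z 2)).
have v_le (z : 'rV[R]_d) k : euclidean_norm z <= 1 -> normc (v z k 0 - 1) <= K * euclidean_norm z.
  by move=> /bounds[_ h _]; exact: (le_trans (h k) (weaken z 1)).
have Phi1_v (z : 'rV[R]_d) k : euclidean_norm z <= 1 ->
    normc ((charmx 1 z *m v z) k 0 - ((1 - q z)%:C)%C * v z k 0) <= K * euclidean_norm z ^+ 3.
  by move=> /bounds[_ _ h]; exact: (le_trans (h k) (weaken z 3)).
have ones (s : R) (z : 'rV[R]_d) k : 0 < s <= 1 -> T s -> normc (\sum_l charmx s z k l - 1) <= K * euclidean_norm z.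
  move=> s01 Ts; apply: (le_trans (charmx_ones_le MAP HM k z s01 Ts)).
  by rewrite ler_wpM2r ?euclidean_norm_ge0// le_max lexx orbT.
have sg s t z := @charmx_semigroup _ _ _ _ _ _ _ _ _ _ m MAP s t z.
have rs t z := @charmx_row_sums _ _ _ _ _ _ _ _ _ _ m MAP t z.
have [C CC near1] := char_row_sum_near sg rs decay C00 c00 K0 qZ q_le v_le Phi1_v ones.
exists q, C, C0, c0; split => //.
  exact: (exponent_lower_bound sg rs decay C00 K0 qZ q_le v_le Phi1_v).
split => // z k.
exact: (cvg_row_sum sg rs K0 qZ q_le v_le Phi1_v).
Qed.

Lemma char_row_sumE t z k : T t -> \sum_l charmx t z k l =
  ((\int[P k]_w cos (dot z (Yt t w))) +i* (\int[P k]_w sin (dot z (Yt t w))))%C.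
Proof.
move=> Tt; have mY := measurable_dot_centered m MAP z Tt.
have fP : P k setT \is a fin_num by exact: fin_num_measure.
have ic := cos_integrable measurableT fP mY; have isn := sin_integrable measurableT fP mY.
rewrite (Rintegral_states MAP Tt ic) (Rintegral_states MAP Tt isn).
apply: complexP => /=; rewrite ?Re_sum ?Im_sum; apply: eq_bigr => l _; by rewrite charmxE.
Qed.

Variable Sigma : 'M[R]_d.
Hypothesis AS : asymptotic_covariance tk P Yt Sigma.

Lemma cvg_nat_time : (i%:R : R) @[i --> \oo] --> time_infty R tk.
Proof.
move=> A [M [_ MA]]; exists (Num.truncn M).+1 => // i /= Mi.
apply: MA; last exact: time_set_nat.
by rewrite (lt_le_trans (truncnS_gt M))// ler_nat.
Qed.

(** Convergence in law is tested on cos <z, .> along the integers, which belong to both kinds of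
    time set; the limit is the Gaussian characteristic function on one side and e^(-q) on the
    other. *)
Lemma exponent_covariance (q : 'rV[R]_d -> R) :
  (forall z k, complex.Re (\sum_l charmx i%:R ((Num.sqrt i%:R)^-1 *: z) k l) @[i --> \oo]
     --> expR (- q z)) ->
  forall z, q z = quadratic_form Sigma z / 2.
Proof.
move=> hq z; have [nu [_ _ char] law] := AS.
pose h (y : 'rV[R]_d) := cos (dot z y).
have cd : continuous (fun y : 'rV[R]_d => dot z y).
  have cs : continuous (fun y : 'rV[R]_d => \sum_j (z 0 j * y 0 j) : R).
    apply: continuous_big => [|j _ y]; first exact: add_continuous.
    have c : continuous (fun u : 'rV[R]_d => u 0 j : R) by exact: coord_continuous.
    exact: (continuousM (@cst_continuous _ _ (z 0 j) y) (c y)).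
  exact: cs.
have ch : continuous h.
  by move=> y; apply: (@continuous_comp _ _ _ (dot z) cos); [exact: cd|exact: continuous_cos].
have bh : exists M : R, forall y, `|h y| <= M by exists 1 => y; exact: abs_cos_le1.
have cv := cvg_comp _ _ cvg_nat_time (law ord0 h ch bh).
have Eh (disp' : measure_display) (Om : measurableType disp') (Pr : probability Om R)
    (V : Om -> 'rV[R]_d) : measurable_fun setT V ->
    ('E_Pr[h \o V] = (\int[Pr]_w cos (dot z (V w)))%:E)%E.
  move=> mV; rewrite unlock /Rintegral fineK//.
  have fP : Pr setT \is a fin_num by exact: fin_num_measure.
  apply: (integrable_fin_num measurableT).
  exact: (cos_integrable measurableT fP (measurableT_comp (measurable_dotr z) mV)).
have hnu : ('E_nu[h] = (expR (- (quadratic_form Sigma z / 2)))%:E)%E.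
  have := char z; rewrite /complex_integral => -[+ _].
  by have /= -> := Eh _ _ nu id (@measurable_id _ _ _) => ->.
suff : expR (- q z) = expR (- (quadratic_form Sigma z / 2)) by move=> /expR_inj /oppr_inj.
apply/EFin_inj; rewrite -hnu; apply: cvg_unique cv => //=.
have E (i : nat) : ('E_(P ord0)[h \o (fun w => i%:R `^ (- 2^-1) *: Yt i%:R w)])%E =
    (complex.Re (\sum_l charmx i%:R ((Num.sqrt i%:R)^-1 *: z) ord0 l))%:E.
  have Ti := time_set_nat tk i : T i%:R.
  rewrite Eh; last first.
    apply: measurable_fun_mx => i' j; under eq_fun do rewrite mxE.
    apply: measurable_funM => //.
    exact: (measurableT_comp (measurable_fun_coord i' j) (measurable_centered m MAP Ti)).
  rewrite char_row_sumE//=; congr EFin; apply: eq_Rintegral => w _.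
  by rewrite powR_half_opp// dotZr dotZl.
apply: cvg_EFin; first by apply: nearW => i /=; rewrite E.
rewrite (_ : fine \o _ = (fun i : nat => complex.Re (\sum_l charmx i%:R ((Num.sqrt i%:R)^-1 *: z) ord0 l))).
  exact: hq.
by apply/funext => i /=; rewrite E.
Qed.

End characteristic_asymptotics.

Lemma singular_mass_decay (R : realType) (tk : time_kind) (n d : nat)
    (G : R -> 'rV[R]_d -> 'M[R]_n.+1)
    (mu : R -> 'I_n.+1 -> 'I_n.+1 -> {finite_measure set 'rV[R]_d -> \bar R}) :
  condition_AC1 tk G mu -> exists C c1 : R, [/\ 0 <= C, 0 < c1 &
    forall t k, time_set R tk t -> 0 < t ->
      \sum_l singular_mass mu t k l <= C * expR (- (c1 * t))].
Proof.
move=> [c [rho [c0 /andP[rho0 rho1] hc _]]].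
exists (n.+1%:R * c), (- ln rho); split.
- by rewrite mulr_ge0// ltW.
- by rewrite oppr_gt0 ln_lt0// rho0 rho1.
move=> t k Tt t0; rewrite -mulrA; apply: sum_le_card => l.
apply: (le_trans (ler_norm _)); apply: (le_trans (entry_le_norm0 _ _ _)).
by have := hc t Tt t0; rewrite /powR gt_eqF// mulNr opprK [ln rho * t]mulrC.
Qed.

Theorem theorem2p2 (R : realType) (tk : time_kind) (n d : nat)
  (d_gt0 : (0 < d)%N)
  (disp : measure_display) (Omega : measurableType disp)
  (P : 'I_n.+1 -> probability Omega R)
  (Xt : R -> Omega -> 'I_n.+1) (Zt : R -> Omega -> 'rV[R]_d)
  (Q : R -> R.-pker ('I_n.+1 * 'rV[R]_d)%type ~> ('I_n.+1 * 'rV[R]_d)%type)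
  (p : 'rV[R]_n.+1)
  (G : R -> 'rV[R]_d -> 'M[R]_n.+1)
  (mu : R -> 'I_n.+1 -> 'I_n.+1 -> {finite_measure set 'rV[R]_d -> \bar R})
  (D : R -> set 'rV[R]_d) (Sigma : 'M[R]_d) :
  let Yt := centered P p Zt in
  let infty := time_infty R tk in
  markov_additive_process tk P Xt Zt Q ->
  unique_invariant_probability tk (transition_matrix Q) p ->
  lebesgue_decomposition tk G mu P Xt Yt ->
  condition_IA Q ->
  condition_M tk P Yt 3 ->
  condition_AC1 tk G mu ->
  condition_AC2 tk G D ->
  asymptotic_covariance tk P Yt Sigma ->
  Sigma \in unitmx ->
  forall k : 'I_n.+1, exists u v : R -> R,
    [/\ u =O_infty (fun t : R => t `^ (- 2^-1)),
        v =O_infty (fun t : R =>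
          sup [set gaussian_density Sigma (t `^ (- 2^-1) *: y) | y in ~` D t]) &
        \forall t \near infty,
          (ereal_sup [set `|scaled_density G k t y - gaussian_density Sigma y|%:E |
                        y in [set: 'rV[R]_d]] <= (u t + v t)%:E)%E].
Proof.
move=> Yt infty MAP inv dec IA M3 AC1 AC2 AS uS k.
have [q [C [C0 [c0 [C_ge0 C00 c00 q_low [decay near_q cvg_q]]]]]] :=
  characteristic_asymptotics MAP inv dec IA M3 AC1.
have qE := exponent_covariance MAP AS cvg_q.
(* Strict positivity comes from the lower bound on [q], now identified with half the quadratic form
   of [Sigma]. *)
have sS : spd Sigma.
  have [nu [St _ _] _] := AS; split=> // v v0.
  have : 0 < q v.
    apply: lt_le_trans (q_low v); apply: mulr_gt0 => //.
    by rewrite lt_neqAle eq_sym dot_eq0 v0 dot_ge0.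
  by rewrite qE; lra.
have q_ge z : c0 * dot z z <= quadratic_form Sigma z / 2 by rewrite -qE.
have near_S (t : R) z k' : time_set R tk t -> 2 <= t -> euclidean_norm z <= 1 ->
    normc (\sum_l charmx P Xt Zt (stationary_mean P p Zt) t z k' l -
      ((expR (- (t * (quadratic_form Sigma z / 2))))%:C)%C) <=
    C * (euclidean_norm z + t * euclidean_norm z ^+ 3) * expR (- (c0 * t * dot z z)).
  by rewrite -qE; exact: near_q.
have [B B0 smooth] := smoothed_density_bound sS C_ge0 C00 c00 q_ge decay near_S.
have [Cs [c1 [Cs0 c10 sing]]] := singular_mass_decay AC1.
have [K K0 est] := density_estimate MAP dec AC2 sS uS B0 Cs0 c00 c10 q_ge sing
  (fun t k' x b Tt t2 b01 => smooth _ _ (P k') _ t k' x b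
    (measurable_centered (stationary_mean P p Zt) MAP Tt) Tt t2 b01
    (fun z => char_row_sumE p MAP z k' Tt)).
exists (fun t => K * t `^ (- 2^-1)),
  (fun t => sup [set gaussian_density Sigma (t `^ (- 2^-1) *: y) | y in ~` D t]); split.
(* The constant of a big O has to be positive, whereas [K] may vanish. *)
- apply/eqO_exP; exists (K + 1); first by rewrite ltr_wpDl.
  apply: nearW => t /=; rewrite normrM (ger0_norm K0).
  by rewrite ler_wpM2r ?normr_ge0// lerDl.
- by apply/eqO_exP; exists 1 => //; apply: nearW => t; rewrite mul1r.
- apply: filterS est => t h; apply: ge_ereal_sup => _ [y _ <-].
  by rewrite lee_fin; exact: h.
Qed.
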